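(* Let $K$ be a field of characteristic $p>0$, $V$ a $K$-vector space with $\dim V=n<\infty$, $G=GL(V)$. Let $d,r$ be positive integers with $0<d<p$ and $r-d+1\equiv 0\pmod p$, and set $\bar d=p-d$. Let $\mathbb{K}_*(r,d,V)$ be the complex of $G$-modules with $\mathbb{K}_{2i+1}(r,d,V)=K_{(r-ip-d,\,ip+d)}V$ and $\mathbb{K}_{2i}(r,d,V)=K_{(r-ip,\,ip)}V$ for $i\ge0$, with differentials $\delta_{2i+1}=\partial_d:\mathbb{K}_{2i+1}\to\mathbb{K}_{2i}$ and $\delta_{2i}=\partial_{\bar d}:\mathbb{K}_{2i}\to\mathbb{K}_{2i-1}$; and let $\mathbb{L}_*(r,d,V)$ be the complex defined in the same way with the Schur modules $L_{(r-ip-d,ip+d)}V$, $L_{(r-ip,ip)}V$ in place of the Weyl modules. If $p=2$ or $n=2$, then $\mathbb{K}_*(r,d,V)$ has homology concentrated in degree $0$ and $\mathbb{L}_*(r,d,V)$ has homology concentrated in degree $\lfloor r/p\rfloor$. In particular, for $p=2$ (so $d=1$ and $r=2r'$ is even), $$H_0(\mathbb{K}_*(r,1,V))\cong (D_{r'}V)^{(1)},\qquad H_{r'}(\mathbb{L}_*(r,1,V))\cong\big(\wedge^{r'}V\big)^{(1)}$$ as $G$-modules.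
   Context: $DV$ and $\wedge V$ are the divided power and exterior algebras of $V$ with comultiplication $\Delta$ and multiplication $m$; for $t\ge0$, $\partial_t:A_aV\otimes A_bV\to A_{a+t}V\otimes A_{b-t}V$ ($A=D$ or $\wedge$) is $(m\otimes1)\circ(1\otimes\Delta)$. For a two-part partition $\lambda=(a,b)$, $K_\lambda V$ is the Weyl module (Akin–Buchsbaum–Weyman), the cokernel of $\bigoplus_{\ell=0}^{b-1}D_{a+b-\ell}V\otimes D_\ell V\to D_aV\otimes D_bV$ (each component being $(1\otimes m)\circ(\Delta\otimes1)$), and $L_\lambda V$ is the Schur module, defined analogously with exterior powers; $K_\lambda V$ has highest weight $\lambda$ and $L_\lambda V$ is the induced module of highest weight the transpose of $\lambda$. Convention: $K_\alpha V=L_\alpha V=0$ if $\alpha$ is a sequence of nonnegative integers which is not a partition (so the complexes are bounded). The differentials above are the $G$-maps between Weyl (resp. Schur) modules induced by the maps $\partial_t$ on $D_aV\otimes D_bV$ (resp. $\wedge^aV\otimes\wedge^bV$); these are well defined, and $\delta\circ\delta=0$ since $\partial_{\bar d}\partial_d=\binom{p}{d}\partial_p=0$. $M^{(1)}$ denotes the first Frobenius twist of a $G$-module $M$ (action composed with $g=(g_{ij})\mapsto (g_{ij}^p)$). ''Homology concentrated in degree $k$'' means all homology groups in degrees $\neq k$ vanish. *)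

(* Defs.v *)
(* Concrete model: V = K^n with standard basis e_0..e_{n-1};
   D_a V and /\^a V are given by their standard bases; all maps are matrices
   acting on row vectors (v |-> v *m M). *)
From HB Require Import structures.
From mathcomp Require Import all_boot all_order all_algebra.
Set Implicit Arguments. Unset Strict Implicit. Unset Printing Implicit Defensive.
Import GRing.Theory.
Local Open Scope ring_scope.

Definition mxc (R : pzRingType) (S T : finType) (c : S -> T -> R) :
  'M[R]_(#|{: S}|, #|{: T}|) := \matrix_(i, j) c (enum_val i) (enum_val j).

(* Generic graded (co)algebra A = D or /\ : basis B a of A_a, each basis
   element has a "value" in X; mul x y z = coefficient of z in x*y,
   com z x y = coefficient of x (x) y in Delta z.                       *)
Section Complex.
Variables (K : fieldType) (X : eqType) (B : nat -> finType)
  (v : forall a, B a -> X) (mul com : X -> X -> X -> K).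

(* A_a (x) A_b has basis B a * B b *)
(* partial_t : A_a(x)A_b -> A_{a'}(x)A_{b'}  (a' = a+t, b' = b-t) is
   (m (x) 1) o (1 (x) Delta), Delta : A_b -> A_t (x) A_{b-t}.           *)
Definition dmap (a b a' b' t : nat) :
  'M[K]_(#|{: B a * B b}|, #|{: B a' * B b'}|) :=
  mxc (fun (xy : B a * B b) (xy' : B a' * B b') =>
    \sum_(z : B t) com (v xy.2) (v z) (v xy'.2) * mul (v xy.1) (v z) (v xy'.1)).

(* box map  (1 (x) m) o (Delta (x) 1) : A_{a+b-l} (x) A_l -> A_a (x) A_b *)
Definition boxm (a b l : nat) :
  'M[K]_(#|{: B (a + b - l)%N * B l}|, #|{: B a * B b}|) :=
  mxc (fun (xy : B (a + b - l)%N * B l) (xy' : B a * B b) =>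
    \sum_(z : B (b - l)%N) com (v xy.1) (v xy'.1) (v z) * mul (v z) (v xy.2) (v xy'.2)).

(* the relations: K_(a,b) = (A_a (x) A_b) / Rel a b *)
Definition Rel (a b : nat) : 'M[K]_(#|{: B a * B b}|) :=
  (\sum_(l < b) <<boxm a b l>>)%MS.

Variables (r p d : nat).

Definition deg (k : nat) : nat * nat :=
  if odd k then ((r - k./2 * p - d)%N, (k./2 * p + d)%N)
  else ((r - k./2 * p)%N, (k./2 * p)%N).

(* the term is nonzero only when its bidegree is a partition *)
Definition nz (k : nat) : bool := ((deg k).2 <= (deg k).1)%N.

Definition tk (k : nat) : nat := if odd k then d else (p - d)%N.

Definition Wk (k : nat) : finType := (B (deg k).1 * B (deg k).2)%type.

(* differential delta_k : C_k -> C_{k-1} (lifted to the tensor products);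
   zero if one of the two terms is zero (or k = 0) *)
Definition dlt (k : nat) : 'M[K]_(#|{: Wk k}|, #|{: Wk k.-1}|) :=
  if [&& (0 < k)%N, nz k & nz k.-1] then dmap (deg k).1 (deg k).2 (deg k.-1).1 (deg k.-1).2 (tk k)
  else 0.

Definition Usp (k : nat) : 'M[K]_#|{: Wk k}| := Rel (deg k).1 (deg k).2.

(* cycles (lifted to A (x) A) : preimage of Usp (k-1) under dlt k *)
Definition Zsp (k : nat) : 'M[K]_#|{: Wk k}| :=
  if nz k then kermx (dlt k *m cokermx (Usp k.-1)) else 0.

Definition Hden (k : nat) : 'M[K]_#|{: Wk k}| := (<<dlt k.+1>> + Usp k)%MS.

Definition homology_vanishes (k : nat) : bool := (Zsp k <= Hden k)%MS.

End Complex.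

(* G-actions: act a g x y = coefficient of y in g.x  (x, y basis of A_a) *)
Section Action.
Variables (X : eqType) (B : nat -> finType) (v : forall a, B a -> X)
  (F : fieldType) (n : nat) (act : nat -> 'M[F]_n -> X -> X -> F).

Definition tact (a b : nat) (g : 'M[F]_n) : 'M[F]_(#|{: B a * B b}|) :=
  mxc (fun (xy xy' : B a * B b) =>
         act a g (v xy.1) (v xy'.1) * act b g (v xy.2) (v xy'.2)).

Definition sact (a : nat) (g : 'M[F]_n) : 'M[F]_#|{: B a}| :=
  mxc (fun x y : B a => act a g (v x) (v y)).
End Action.

Definition frobmx (F : fieldType) (p n : nat) (g : 'M[F]_n) : 'M[F]_n :=
  map_mx (fun x => x ^+ p) g.

(* Isomorphism of G-modules  Z/S  ~=  F^q  (S <= Z <= F^m):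
   a linear map Phi on Z, onto, with kernel S, and G-equivariant for
   g in GL_n(L) for every field extension L of K (i.e. as modules over
   the algebraic group GL(V)). *)
Definition sq_iso (K : fieldType) (n m q : nat) (Z S : 'M[K]_m)
  (rho : forall F : fieldType, 'M[F]_n -> 'M[F]_m)
  (sig : forall F : fieldType, 'M[F]_n -> 'M[F]_q) : Prop :=
  exists Phi : 'M[K]_(m, q),
  [/\ row_full (Z *m Phi),
      forall w : 'rV[K]_m, (w <= Z)%MS -> (w *m Phi == 0) = (w <= S)%MS &
      forall (F : fieldType) (f : {rmorphism K -> F}) (g : 'M[F]_n),
        g \in unitmx -> forall w : 'rV[K]_m, (w <= Z)%MS ->
        map_mx f w *m rho F g *m map_mx f Phi = map_mx f (w *m Phi) *m sig F g].

(* Divided powers D V, V = K^n: basis x^(alpha), |alpha| = a           *)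
Definition DX (n : nat) : eqType := {ffun 'I_n -> nat}.
Definition DB (n a : nat) : finType :=
  {al : {ffun 'I_n -> 'I_a.+1} | (\sum_i (al i : nat) == a)%N}.
Definition dv (n a : nat) (al : DB n a) : DX n := [ffun i => nat_of_ord (val al i)].

(* x^(al) x^(be) = prod_i C(al_i+be_i, al_i) x^(al+be) *)
Definition Dmul (K : fieldType) (n : nat) (x y z : DX n) : K :=
  if z == [ffun i => (x i + y i)%N] then (\prod_i 'C(z i, x i))%:R else 0.
(* Delta x^(ga) = sum_(al+be=ga) x^(al) (x) x^(be) *)
Definition Dcom (K : fieldType) (n : nat) (z x y : DX n) : K :=
  if z == [ffun i => (x i + y i)%N] then 1 else 0.

Definition multinom (s : seq nat) : nat := ((sumn s)`! %/ \prod_(x <- s) x`!)%N.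

(* g e_i = sum_j g j i e_j ;  g.x^(al) = prod_i (g e_i)^(al_i) *)
Definition Dact (F : fieldType) (n a : nat) (g : 'M[F]_n) (x y : DX n) : F :=
  \sum_(ka : {ffun 'I_n -> {ffun 'I_n -> 'I_a.+1}} |
          [forall i, (\sum_j (ka i j : nat) == x i)%N] &&
          [forall j, (\sum_i (ka i j : nat) == y j)%N])
    ((\prod_i \prod_j g j i ^+ ka i j) *
     (\prod_j multinom [seq (ka i j : nat) | i <- enum 'I_n])%:R).

(* Exterior powers: basis e_A, A subset of {0..n-1}, #|A| = a           *)
Definition EX (n : nat) : eqType := {set 'I_n}.
Definition EB (n a : nat) : finType := {A : {set 'I_n} | #|A| == a}.
Definition ev (n a : nat) (A : EB n a) : EX n := val A.

Definition esign (K : fieldType) (n : nat) (A B : {set 'I_n}) : K :=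
  (-1) ^+ #|[set ij : 'I_n * 'I_n | [&& ij.1 \in A, ij.2 \in B & (ij.2 < ij.1)%N]]|.
(* e_A /\ e_B = esign A B e_(A u B) if disjoint, else 0 *)
Definition Emul (K : fieldType) (n : nat) (A B C : EX n) : K :=
  if [disjoint A & B] && (C == A :|: B) then esign K A B else 0.
(* Delta e_C = sum_(C = A u B disjoint) esign A B e_A (x) e_B *)
Definition Ecom (K : fieldType) (n : nat) (C A B : EX n) : K := Emul K A B C.

Definition gfun (F : fieldType) (n : nat) (g : 'M[F]_n) (i j : nat) : F :=
  match (insub i : option 'I_n), (insub j : option 'I_n) with
  | Some i', Some j' => g i' j'
  | _, _ => 0
  end.

(* g.e_A = sum_B det(g[B,A]) e_B  (rows B, columns A, increasing order) *)
Definition Eact (F : fieldType) (n a : nat) (g : 'M[F]_n) (A B : EX n) : F :=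
  \det (\matrix_(i < a, j < a)
          gfun g (nth 0%N (map val (enum B)) i) (nth 0%N (map val (enum A)) j)).

Definition Kcx_vanishes (K : fieldType) (n r p d k : nat) : bool :=
  @homology_vanishes K (DX n) (DB n) (@dv n) (@Dmul K n) (@Dcom K n) r p d k.
Definition Lcx_vanishes (K : fieldType) (n r p d k : nat) : bool :=
  @homology_vanishes K (EX n) (EB n) (@ev n) (@Emul K n) (@Ecom K n) r p d k.

Definition Kcx_Z (K : fieldType) (n r p d k : nat) :=
  @Zsp K (DX n) (DB n) (@dv n) (@Dmul K n) (@Dcom K n) r p d k.
Definition Kcx_den (K : fieldType) (n r p d k : nat) :=
  @Hden K (DX n) (DB n) (@dv n) (@Dmul K n) (@Dcom K n) r p d k.
Definition Lcx_Z (K : fieldType) (n r p d k : nat) :=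
  @Zsp K (EX n) (EB n) (@ev n) (@Emul K n) (@Ecom K n) r p d k.
Definition Lcx_den (K : fieldType) (n r p d k : nat) :=
  @Hden K (EX n) (EB n) (@ev n) (@Emul K n) (@Ecom K n) r p d k.

Definition Kcx_act (n r p d k : nat) (F : fieldType) (g : 'M[F]_n) :=
  @tact (DX n) (DB n) (@dv n) F n (@Dact F n) (deg r p d k).1 (deg r p d k).2 g.
Definition Lcx_act (n r p d k : nat) (F : fieldType) (g : 'M[F]_n) :=
  @tact (EX n) (EB n) (@ev n) F n (@Eact F n) (deg r p d k).1 (deg r p d k).2 g.

Definition Dtw_act (n p a : nat) (F : fieldType) (g : 'M[F]_n) :=
  @sact (DX n) (DB n) (@dv n) F n (@Dact F n) a (frobmx p g).
Definition Etw_act (n p a : nat) (F : fieldType) (g : 'M[F]_n) :=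
  @sact (EX n) (EB n) (@ev n) F n (@Eact F n) a (frobmx p g).
Arguments Kcx_act n r p d k F g : clear implicits.
Arguments Lcx_act n r p d k F g : clear implicits.
Arguments Dtw_act n p a F g : clear implicits.
Arguments Etw_act n p a F g : clear implicits.

(* Main.v *)
Require Import Defs.
From HB Require Import structures.
From mathcomp Require Import all_boot all_order all_algebra.
From mathcomp Require Import zify ring.
Set Implicit Arguments. Unset Strict Implicit. Unset Printing Implicit Defensive.
Import GRing.Theory.

(* Exactness is proved on the dual complexes. A functional on [D_a V (x) D_b V] is a polynomial
   in [x_1 .. x_n, y_1 .. y_n] of bidegree [(a, b)]; it kills the relations of the Weyl module
   iff it is invariant under the substitutions [y -> y + t x], and the differential [partial_t]
   becomes the divided power [E^(t)] of the polarization [E = sum_i y_i d/dx_i]. Fix the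
   multidegree and order monomials lexicographically by their [y]-exponents. An invariant of
   bidegree [(a, b)] vanishes if [b > a], and this forces the leading monomial of any invariant
   to be the content of a semistandard tableau; conversely every such monomial is the leading
   monomial of a product of variables [x_i] and minors [x_i y_k - x_k y_i]. For [p = 2] (resp.
   [n = 2]) the leading monomial of a cocycle is then also the leading monomial of [E g] (resp.
   [E^(t) g]) for such a product [g], and one concludes by descending induction.

   For the Schur complex with [p = 2] the exterior algebra is [K[x] / (x_i ^ 2)], and in a
   multidegree in which some variable [i] occurs once, [x_i d/dy_i] is a contracting homotopy.
   The remaining multidegrees are those of the diagonal elements [e_A (x) e_A], which give the
   top homology. For [n = 2] and [p] odd the complex has at most one nonzero term. *)

(** Dualizing removes the quotients: functionals on a Weyl module form a subspace of a polynomial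
    space, so no basis of [K_(a,b)] is ever needed. With [F = sum_i x_i d/dy_i] the operator [E]
    generates an [sl_2], and commuting divided powers of [F] past [E^t] produces the factor
    [a - b - t + 1]. The congruence on [r] makes this factor zero in [K] at every spot of the
    complex; this is why [E^(t)] maps invariants to invariants. For Weyl modules the restriction on
    [p] and [n] serves to control leading coefficients. If [p = 2], the cocycle condition makes the
    relevant exponents of [x] even, so the coefficient created by [E] is 1. If [n = 2], invariants
    of given multidegree and bidegree form a space of dimension at most one, and the only
    coefficient to control is a binomial. Where the complex ends no cocycle condition is given:
    there it holds by itself, because [E^(t) f] is an invariant with more [y] than [x]. The same
    remark, for sets, handles the top degree of the Schur complex, where [g] acts on the diagonal
    elements through squares of minors, hence through the Frobenius twist. *)

Section SupportSums.
Local Open Scope ring_scope.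

(** Sums over boxes of exponents get reindexed by translations, which do not preserve a box; only
    the support has to stay inside. *)
Lemma sum_support (V : nmodType) (T : eqType) (s1 s2 : seq T) (F : T -> V) :
  uniq s1 -> uniq s2 ->
  (forall x, F x != 0 -> (x \in s1) && (x \in s2)) ->
  \sum_(x <- s1) F x = \sum_(x <- s2) F x.
Proof.
move=> u1 u2 Fs.
have key s : \sum_(x <- s) F x = \sum_(x <- [seq x <- s | F x != 0]) F x.
  by rewrite big_filter [LHS](bigID (fun x => F x == 0)) /= big1 ?add0r // => x /eqP.
rewrite key [RHS]key; apply: perm_big; apply: uniq_perm; rewrite ?filter_uniq //.
by move=> x; rewrite !mem_filter; case: eqP => //= /eqP/Fs/andP[-> ->].
Qed.

End SupportSums.

(** * Exponent vectors and their lexicographic order *)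

Section Exponents.
Variable n : nat.
Local Notation X := {ffun 'I_n -> nat}.
Implicit Types (x y z : X) (i j k : 'I_n) (N : nat).

Definition wt x := \sum_i x i.
Definition xadd x y : X := [ffun i => x i + y i].
Definition xsub x y : X := [ffun i => x i - y i].
Definition xunit i : X := [ffun j => (j == i) : nat].
Definition xle x y := [forall i, x i <= y i].
(** Exponent vectors do not form a finite type, so sums run over this list, with [N] larger than
    every entry of the multidegree at hand. *)
Definition box N : seq X :=
  [seq [ffun i => nat_of_ord (e i)] | e : {ffun 'I_n -> 'I_N}].

Lemma xleP x y : reflect (forall i, x i <= y i) (xle x y).
Proof. exact: forallP. Qed.

Lemma mem_box N x : (x \in box N) = [forall i, x i < N].
Proof.
apply/mapP/forallP => [[e _ ->] i|xN]; first by rewrite ffunE.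
by exists [ffun i => Ordinal (xN i)]; rewrite ?mem_enum //; apply/ffunP => i; rewrite !ffunE.
Qed.

Lemma boxP N x : reflect (forall i, x i < N) (x \in box N).
Proof. by rewrite mem_box; apply: forallP. Qed.

Lemma box_uniq N : uniq (box N).
Proof.
rewrite map_inj_uniq ?enum_uniq // => e e' /ffunP E; apply/ffunP => i.
by apply: val_inj; have := E i; rewrite !ffunE.
Qed.

Lemma wt_add x y : wt (xadd x y) = wt x + wt y.
Proof. by rewrite /wt -big_split; apply: eq_bigr => i _; rewrite ffunE. Qed.

Lemma wt_unit i : wt (xunit i) = 1.
Proof.
rewrite /wt (bigD1 i) //= ffunE eqxx big1 // => j /negPf ji.
by rewrite ffunE ji.
Qed.

Lemma xsubK x y : xle y x -> xadd (xsub x y) y = x.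
Proof. by move/xleP=> h; apply/ffunP => i; rewrite !ffunE subnK. Qed.

Lemma xaddK x y : xsub (xadd x y) y = x.
Proof. by apply/ffunP => i; rewrite !ffunE addnK. Qed.

Lemma xaddC x y : xadd x y = xadd y x.
Proof. by apply/ffunP => i; rewrite !ffunE addnC. Qed.

Lemma xaddA x y z : xadd x (xadd y z) = xadd (xadd x y) z.
Proof. by apply/ffunP => i; rewrite !ffunE addnA. Qed.

Lemma xsubBK x y : xle y x -> xsub x (xsub x y) = y.
Proof. by move/xleP=> h; apply/ffunP => i; rewrite !ffunE subKn. Qed.

Lemma wt_sub x y : xle y x -> wt (xsub x y) = wt x - wt y.
Proof. by move=> h; rewrite -{2}(xsubK h) wt_add addnK. Qed.

Lemma wt_le x y : xle x y -> wt x <= wt y.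
Proof. by move/xleP=> h; apply: leq_sum => i _. Qed.

Lemma unit_le i x : xle (xunit i) x = (0 < x i).
Proof.
apply/xleP/idP => [/(_ i)|x0 j]; first by rewrite ffunE eqxx.
by rewrite ffunE; case: eqP => // ->.
Qed.

Lemma xle_trans x y z : xle x y -> xle y z -> xle x z.
Proof. by move=> /xleP h1 /xleP h2; apply/xleP => i; apply: leq_trans (h2 i). Qed.

Lemma xle_addr x y : xle y (xadd x y).
Proof. by apply/xleP => i; rewrite ffunE leq_addl. Qed.

Lemma wt_ge x i : x i <= wt x.
Proof. by rewrite /wt (bigD1 i) //= leq_addr. Qed.

Lemma box_le N x y : xle x y -> y \in box N -> x \in box N.
Proof.
by move=> /xleP h /boxP h'; apply/boxP => i; apply: leq_ltn_trans (h i) (h' i).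
Qed.

Lemma wt_box N x : wt x < N -> x \in box N.
Proof. by move=> h; apply/boxP => i; apply: leq_ltn_trans (wt_ge x i) h. Qed.

Lemma ex_max (P : pred 'I_n) i0 : P i0 -> exists2 k, P k & forall j, k < j -> ~~ P j.
Proof.
move=> Pi; case: (@arg_maxnP _ i0 P (fun i => nat_of_ord i) Pi) => k Pk km.
by exists k => // j kj; apply/negP => /km /=; rewrite leqNgt kj.
Qed.

Lemma shift_sum (V : nmodType) N i (h : X -> V) :
  (forall x, h x != 0%R -> xadd x (xunit i) \in box N) ->
  (\sum_(x <- box N | (0 < x i)%N) h (xsub x (xunit i)) = \sum_(x <- box N) h x)%R.
Proof.
move=> hN; rewrite big_mkcond.
have injs : injective (fun x => xadd x (xunit i)).
  by move=> x y /(congr1 (fun z => xsub z (xunit i))); rewrite !xaddK.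
transitivity (\sum_(x <- map (fun x => xadd x (xunit i)) (box N))
                (if (0 < x i)%N then h (xsub x (xunit i)) else 0))%R; last first.
  by rewrite big_map; apply: eq_bigr => x _; rewrite xaddK ffunE [xunit i i]ffunE eqxx addn1.
apply: sum_support; first exact: box_uniq.
  by rewrite map_inj_uniq //; apply: box_uniq.
move=> x.
case: ifP; rewrite ?eqxx // -unit_le => ux hx; have := hN _ hx; rewrite xsubK // => ->.
rewrite andTb; apply/mapP; exists (xsub x (xunit i)); rewrite ?xsubK //.
apply: box_le (hN _ hx); apply/xleP => j; rewrite [xadd _ _ _]ffunE; exact: leq_addr.
Qed.

(** Exponents read as digits in base [N], the last variable being the most significant. The order
    becomes additive: multiplying by a variable adds a power of [N], and leading terms are compared
    by arithmetic. *)
Definition code N x := \sum_i x i * N ^ i.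

Lemma codeD N x y : code N (xadd x y) = code N x + code N y.
Proof. by rewrite /code -big_split; apply: eq_bigr => i _; rewrite ffunE mulnDl. Qed.

Lemma code_unit N i : code N (xunit i) = N ^ i.
Proof.
rewrite /code (bigD1 i) //= ffunE eqxx mul1n big1 ?addn0 // => j /negPf ji.
by rewrite ffunE ji.
Qed.

Lemma code_ge N x j : 0 < x j -> N ^ j <= code N x.
Proof. by move=> xj; rewrite /code (bigD1 j) //= -[X in X <= _]addn0 leq_add // leq_pmull. Qed.

Lemma code_low N x (j : nat) : 0 < N -> x \in box N -> \sum_(i < n | i < j) x i * N ^ i < N ^ j.
Proof.
move=> N0 /boxP xN.
have aux (f : nat -> nat) : (forall i : nat, f i < N) -> forall m, \sum_(i < m) f i * N ^ i < N ^ m.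
  move=> fN; elim=> [|m IH]; first by rewrite big_ord0.
  rewrite big_ord_recr /= expnS; apply: leq_trans (leq_mul (fN m) (leqnn _)).
  by rewrite mulSn -addSn leq_add2r.
case: n x xN => [|n'] x xN.
  by rewrite big1 ?expn_gt0 ?N0 // => -[].
(* The digits are extended by zero to all of [nat], because [j] need not be an index: the lemma is
   later used at [k.+1], which may equal the number of variables. *)
pose f (i : nat) := if i < n'.+1 then x (inord i) else 0.
apply: leq_ltn_trans (aux f _ j); last first.
  by move=> i; rewrite /f; case: ifP.
have -> : \sum_(i < n'.+1 | i < j) x i * N ^ i = \sum_(0 <= i < n'.+1 | i < j) f i * N ^ i :> nat.
  by rewrite big_mkord; apply: eq_bigr => i _; rewrite /f ltn_ord inord_val.
rewrite -(big_mkord xpredT (fun i : nat => f i * N ^ i)) /index_iota !subn0.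
case: (leqP j n'.+1) => [jn|nj].
  rewrite -(subnKC jn) iotaD big_cat /= [X in _ + X]big1_seq ?addn0.
    by rewrite big_mkcond; apply: leq_sum => i _; case: ifP.
  by move=> i /andP[ij]; rewrite mem_iota add0n leqNgt ij.
rewrite -(subnKC (ltnW nj)) iotaD big_cat /=; apply: leq_trans (leq_addr _ _).
by rewrite big_mkcond; apply: leq_sum => i _; case: ifP.
Qed.

Lemma code_lt N x y j : x \in box N -> (forall i, j < i -> x i <= y i) -> x j < y j ->
  code N x < code N y.
Proof.
move=> xN hi hj; rewrite /code (bigID (fun i : 'I_n => i < j)) /=.
rewrite [X in _ < X](bigID (fun i : 'I_n => i < j)) /= -addSn.
have N0 : 0 < N by apply: leq_ltn_trans (boxP _ _ xN j).
have h1 := code_low j N0 xN.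
apply: leq_trans (leq_addl _ _).
have e (F : 'I_n -> nat) : \sum_(i < n | ~~ (i < j)) F i =
    F j + \sum_(i < n | ~~ (i < j) && (i != j)) F i by rewrite (bigD1 j) ?ltnn.
rewrite !e {e}.
have h2 : \sum_(i < n | ~~ (i < j) && (i != j)) x i * N ^ i <=
          \sum_(i < n | ~~ (i < j) && (i != j)) y i * N ^ i.
  apply: leq_sum => i /andP[h3 h4]; rewrite leq_mul2r hi ?orbT //.
  by rewrite ltn_neqAle leqNgt h3 andbT eq_sym -val_eqE in h4 *.
have h3 : (x j).+1 * N ^ j <= y j * N ^ j by rewrite leq_mul2r hj orbT.
rewrite mulSn in h3; apply: leq_trans (leq_add h3 h2).
by rewrite addnA !leq_add2r.
Qed.

Lemma code_inj N x y : x \in box N -> y \in box N -> code N x = code N y -> x = y.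
Proof.
move=> xN yN E; apply/eqP/contraT => xy.
have [i0 Pi] : exists i, x i != y i.
  apply/existsP; apply: contraT; rewrite negb_exists => /forallP h.
  by case/eqP: xy; apply/ffunP => i; apply/eqP; have := h i; rewrite negbK.
have [k Pk km] := @ex_max (fun i => x i != y i) i0 Pi.
have kE j : k < j -> x j = y j by move/km; rewrite negbK => /eqP.
case: (ltngtP (x k) (y k)) => [h|h|/eqP]; last by rewrite (negPf Pk).
- by have := @code_lt N x y k xN (fun i ki => eq_leq (kE i ki)) h; rewrite E ltnn.
- by have := @code_lt N y x k yN (fun i ki => eq_leq (esym (kE i ki))) h; rewrite E ltnn.
Qed.

End Exponents.

(** * Products of binomial coefficients *)

Section Binomials.
Variable n : nat.
Local Notation X := {ffun 'I_n -> nat}.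
Implicit Types (B T : X) (i : 'I_n).

(** The coefficient of [x^(B - T) y^T] in [(x + y)^B]. *)
Definition xbin B T := \prod_i 'C(B i, T i).

Lemma xbin_neq0 B T : (xbin B T != 0) = xle T B.
Proof.
rewrite -lt0n; apply/idP/xleP => [h i|h].
  by move: h; rewrite /xbin (bigD1 i) //= muln_gt0 bin_gt0 => /andP[].
by rewrite prodn_gt0 // => i; rewrite bin_gt0.
Qed.

Lemma xbin_refl B : xbin B B = 1.
Proof. by rewrite /xbin big1 // => i _; rewrite binn. Qed.

Lemma xle_wt_eq B T : xle T B -> wt T = wt B -> T = B.
Proof.
move=> TB E; apply/ffunP => i; apply/eqP; rewrite eqn_leq (xleP _ _ TB).
rewrite leqNgt; apply/negP => h; move: E; apply/eqP; rewrite neq_ltn; apply/orP; left.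
rewrite /wt (bigD1 i) //= [X in _ < X](bigD1 i) //= -addSn leq_add //.
by apply: leq_sum => j _; apply/xleP.
Qed.

Lemma xbin_unit B T i :
  xbin (xadd B (xunit i)) T = xbin B T + (if 0 < T i then xbin B (xsub T (xunit i)) else 0).
Proof.
rewrite /xbin !(bigD1 i (P := xpredT)) //=.
have e : \prod_(j < n | j != i) 'C(xadd B (xunit i) j, T j) =
         \prod_(j < n | j != i) 'C(B j, T j).
  by apply: eq_bigr => j /negPf ji; rewrite !ffunE ji addn0.
have e' : \prod_(j < n | j != i) 'C(B j, xsub T (xunit i) j) =
         \prod_(j < n | j != i) 'C(B j, T j).
  by apply: eq_bigr => j /negPf ji; rewrite !ffunE ji subn0.
rewrite e e' !ffunE eqxx addn1 subn1; case: (T i) => [|t] /=; first by rewrite !bin0 addn0.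
by rewrite binS mulnDl.
Qed.

(** The absorption rule [t C(m, t) = (m - t + 1) C(m, t - 1)] in the coordinate [i], arranged
    without truncated subtraction. *)
Lemma xbin_mul B T i : 0 < T i ->
  B i * xbin B (xsub T (xunit i)) =
  (T i).-1 * xbin B (xsub T (xunit i)) + T i * xbin B T.
Proof.
rewrite /xbin !(bigD1 i (P := xpredT)) //= => Ti.
have -> : \prod_(j < n | j != i) 'C(B j, xsub T (xunit i) j) =
         \prod_(j < n | j != i) 'C(B j, T j).
  by apply: eq_bigr => j /negPf ji; rewrite !ffunE ji subn0.
rewrite !ffunE eqxx subn1; case: (T i) Ti => // t _ /=; rewrite !mulnA -mulnDl; congr (_ * _).
have := mul_bin_left (B i) t => ->; rewrite -mulnDl.
have [h|h] := leqP t (B i); first by rewrite subnKC.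
by rewrite bin_small ?muln0.
Qed.

End Binomials.

(** * Functionals as polynomials in two rows of variables; the polarization operator *)

Section Functionals.
Local Open Scope ring_scope.
Variables (K : fieldType) (n : nat).
Local Notation X := {ffun 'I_n -> nat}.
Implicit Types (B T al : X) (i : 'I_n) (f g : X -> K) (N b : nat).

(* [f] lists the coefficients, indexed by the exponents [B] of [y], of a polynomial in
   [x_i, y_i] of multidegree [al] and [y]-degree [b]; the exponents of [x] are [al - B]. *)
Definition supp al b f := forall B, f B != 0 -> xle B al && (wt B == b).

(** The coefficient of [y^T] after replacing [y] by [y + x]. With a parameter, [y + t x], this
    coefficient is attached to [t^(b - wt T)], so invariance needs no parameter: it concerns exactly
    the [T] with [wt T < b]. *)
Definition pairing N T f : K := \sum_(B <- box n N) (xbin B T)%:R * f B.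

(* Invariance under the substitutions [y_i -> y_i + t x_i]. *)
Definition shift_inv N b f := forall T, (wt T < b)%N -> pairing N T f = 0.

(** The operator [sum_i y_i d/dx_i] on coefficients; the integer factor is the exponent of [x_i] in
    the source monomial. *)
Definition Dx al f : X -> K := fun B =>
  \sum_(i | (0 < B i)%N) (al i - xsub B (xunit i) i)%:R * f (xsub B (xunit i)).

Lemma supp0 al b f B : supp al b f -> ~~ (xle B al && (wt B == b)) -> f B = 0.
Proof. by move=> sf; apply: contraNeq => /sf. Qed.

Lemma supp_Dx al b f : supp al b f -> supp al b.+1 (Dx al f).
Proof.
move=> sf B; apply: contraR => nB; rewrite /Dx big1 // => i Bi.
case: (eqVneq (f (xsub B (xunit i))) 0) => [->|]; first by rewrite mulr0.
move/sf=> /andP[/xleP le /eqP wB].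
have uB : xle (xunit i) B by rewrite unit_le.
case: (leqP (al i) (xsub B (xunit i) i)) => [/eqP ->|lt]; first by rewrite mul0r.
case/negP: nB; rewrite -(xsubK uB) wt_add wB wt_unit addn1 eqxx andbT.
apply/xleP => j; rewrite ffunE [xunit i j]ffunE; case: eqP => [->|_]; last by rewrite addn0.
by rewrite addn1.
Qed.

Lemma box_addunit N al B i : al \in box n N -> xle B al -> (B i < al i)%N ->
  xadd B (xunit i) \in box n N.
Proof.
move=> /boxP aN /xleP Ba lt; apply/boxP => j; rewrite !ffunE; case: eqP => [->|_].
  by rewrite addn1; apply: leq_trans (aN i).
by rewrite addn0; apply: leq_ltn_trans (aN j).
Qed.

(** Chain rule for [g(x, y) = f(x, y + x)]. The substitution turns [E f] into the sum of
    [(y_i + x_i) (df/dx_i)(x, y + x)]. Euler's relation evaluates the part with [x_i] to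
    [(wt al - b) g]; the part with [y_i] is [E g] minus the [y]-degree operator applied to [g]. *)
Lemma pairing_Dx N al b f T : al \in box n N -> supp al b f ->
  pairing N T (Dx al f) = ((wt al)%:R - b%:R - (wt T)%:R) * pairing N T f +
    \sum_(i | (0 < T i)%N) ((al i)%:R - (T i).-1%:R) * pairing N (xsub T (xunit i)) f.
Proof.
move=> aN sf.
have -> : pairing N T (Dx al f) =
   \sum_i \sum_(B <- box n N) (xbin (xadd B (xunit i)) T)%:R * (al i - B i)%:R * f B.
  transitivity (\sum_i \sum_(B <- box n N | (0 < B i)%N)
     (xbin (xadd (xsub B (xunit i)) (xunit i)) T)%:R * (al i - xsub B (xunit i) i)%:R
       * f (xsub B (xunit i))).
    rewrite /pairing; under eq_bigr do rewrite /Dx big_distrr /=.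
    rewrite (exchange_big_dep xpredT) //=; apply: eq_bigr => i _; apply: eq_bigr => B Bi.
    by rewrite mulrA xsubK ?unit_le.
  apply: eq_bigr => i _; rewrite (shift_sum (i := i)
    (h := fun B => (xbin (xadd B (xunit i)) T)%:R * (al i - B i)%:R * f B)) // => B.
  rewrite !mulf_eq0 !negb_or => /andP[/andP[_ h]] /sf/andP[le _].
  apply: box_addunit aN le _.
  by rewrite -subn_gt0 lt0n; apply: contraNneq h => ->.
rewrite exchange_big /= /pairing mulr_sumr.
under [X in _ = _ + X]eq_bigr do rewrite mulr_sumr.
rewrite [X in _ = _ + X](exchange_big_dep xpredT) //= -big_split; apply: eq_bigr => B _ /=.
case: (eqVneq (f B) 0) => [->|/sf/andP[/xleP le /eqP wB]].
  by rewrite !mulr0 !big1 ?addr0 // => i; rewrite !mulr0.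
under eq_bigr do rewrite xbin_unit natrD !mulrDl.
rewrite big_split /=.
have -> : \sum_i (xbin B T)%:R * (al i - B i)%:R * f B =
    ((wt al)%:R - b%:R) * ((xbin B T)%:R * f B).
  have -> : (wt al)%:R - b%:R = \sum_i (al i - B i)%:R :> K.
    by rewrite -natr_sum sumnB // natrB ?leq_sum // -wB.
  by rewrite mulr_suml; apply: eq_bigr => i _; rewrite mulrA; congr (_ * _); rewrite mulrC.
rewrite [X in _ = X + _]mulrBl -[RHS]addrA; congr (_ + _).
rewrite (bigID (fun i => (0 < T i)%N)) /= [X in _ + X = _]big1 ?addr0; last first.
  by move=> i /negPf ->; rewrite !mul0r.
have -> : (wt T)%:R * ((xbin B T)%:R * f B) =
   \sum_(i | (0 < T i)%N) (T i)%:R * ((xbin B T)%:R * f B).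
  rewrite -mulr_suml -natr_sum /wt (bigID (fun i => (0 < T i)%N)) /= [X in (_ + X)%N]big1 ?addn0 //.
  by move=> i; rewrite -eqn0Ngt => /eqP.
rewrite [RHS]addrC; under [X in _ = X - _]eq_bigl do rewrite andbT.
rewrite -sumrB; apply: eq_bigr => i Ti; rewrite Ti.
have /(congr1 (fun m => m%:R : K)) := xbin_mul B Ti.
rewrite natrD !natrM natrB // => h.
rewrite mulrBr !mulrBl [_ * (B i)%:R]mulrC h; ring.
Qed.

Lemma pairing_wt N al b f T : supp al b f -> (b < wt T)%N -> pairing N T f = 0.
Proof.
move=> sf bT; rewrite /pairing big1 // => B _.
case: (eqVneq (f B) 0) => [->|/sf/andP[_ /eqP wB]]; first by rewrite mulr0.
rewrite (_ : xbin B T = 0%N) ?mul0r //; apply/eqP; apply: contraTT bT.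
by rewrite xbin_neq0 -leqNgt -wB => /wt_le.
Qed.

Lemma pairing_top N al b f T : al \in box n N -> supp al b f -> wt T = b ->
  pairing N T f = f T.
Proof.
move=> aN sf wT.
have eq0 B : B != T -> (xbin B T)%:R * f B = 0.
  move=> BT; case: (eqVneq (f B) 0) => [->|/sf/andP[_ /eqP wB]]; first by rewrite mulr0.
  rewrite (_ : xbin B T = 0%N) ?mul0r //; apply/eqP; apply: contraNT BT.
  by rewrite xbin_neq0 => le; rewrite eq_sym; apply/eqP/xle_wt_eq; rewrite ?wT ?wB.
case: (boolP (T \in box n N)) => [TN|TN].
  by rewrite /pairing (bigD1_seq T) ?box_uniq //= xbin_refl mul1r big1 ?addr0.
rewrite /pairing big1_seq => [|B /= BN].
  apply/esym/supp0; first exact: sf.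
  by apply: contra TN => /andP[/box_le -> //].
by apply: eq0; apply: contraNneq TN => <-.
Qed.

Lemma supp_iter_Dx al b f t : supp al b f -> supp al (b + t) (iter t (Dx al) f).
Proof.
move=> sf; elim: t => [|t IH]; first by rewrite addn0.
by rewrite addnS; apply: supp_Dx.
Qed.

Lemma pairing_iter_low N al b f t T : al \in box n N -> supp al b f -> shift_inv N b f ->
  (wt T < b)%N -> pairing N T (iter t (Dx al) f) = 0.
Proof.
move=> aN sf vf; elim: t T => [|t IH] T Tb; first exact: vf.
rewrite iterS (pairing_Dx _ aN (supp_iter_Dx (t := t) sf)) IH // mulr0 add0r big1 // => i Ti.
rewrite IH ?mulr0 // wt_sub ?unit_le //; apply: leq_ltn_trans Tb; exact: leq_subr.
Qed.

(* The commutator of [Dx ^ t] with the divided powers of the opposite root operator. *)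
Lemma pairing_iter N al b f t s T : al \in box n N -> supp al b f -> shift_inv N b f ->
  wt T = (b + s)%N ->
  pairing N T (iter t (Dx al) f) =
  ('C(t, s))%:R * (\prod_(s <= i < t) ((wt al)%:R - b%:R *+ 2 - i%:R)) * iter s (Dx al) f T.
Proof.
move=> aN sf vf; elim: t s T => [|t IH] s T wT.
  case: s wT => [|s] wT.
    by rewrite bin0 big_geq // !mul1r (pairing_top aN sf) // wT addn0.
  by rewrite bin0n !mul0r (pairing_wt _ sf) // wT addnS ltnS leq_addr.
rewrite iterS (pairing_Dx _ aN (supp_iter_Dx (t := t) sf)) (IH s T wT).
case: s wT => [|s] wT.
  rewrite [X in _ + X = _]big1 => [|i Ti].
    rewrite addr0 wT !bin0 !mul1r big_nat_recr //= addn0 natrD.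
    by rewrite mulrA; congr (_ * _); rewrite [RHS]mulrC; congr (_ * _); ring.
  rewrite (pairing_iter_low _ aN sf vf) ?mulr0 // wt_sub ?unit_le // wt_unit wT addn0 subn1.
  by have := wt_ge T i; rewrite wT addn0 => h; rewrite prednK // (leq_trans Ti h).
have -> : \sum_(i | (0 < T i)%N) ((al i)%:R - (T i).-1%:R) *
     pairing N (xsub T (xunit i)) (iter t (Dx al) f) =
  ('C(t, s))%:R * (\prod_(s <= i < t) ((wt al)%:R - b%:R *+ 2 - i%:R)) * iter s.+1 (Dx al) f T.
  rewrite iterS {3}/Dx mulr_sumr; apply: eq_bigr => i Ti.
  rewrite (IH s) ?wt_sub ?unit_le // ?wt_unit ?wT ?addnS ?subn1 //.
  rewrite mulrCA; congr (_ * _).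
  case: (eqVneq (iter s (Dx al) f (xsub T (xunit i))) 0) => [->|]; first by rewrite !mulr0.
  move/(supp_iter_Dx sf)=> /andP[/xleP/(_ i) le _]; congr (_ * _); rewrite natrB //.
  by rewrite ffunE [xunit i i]ffunE eqxx subn1.
rewrite !mulrA -mulrDl; congr (_ * _).
(* What remains is a recursion for the scalar factor: Pascal's rule together with
   [(s + 1) C(t, s + 1) = (t - s) C(t, s)]. *)
case: (ltngtP s t) => [st|st|->].
- rewrite (@big_ltn _ _ _ s t) // big_nat_recr //= wT natrD.
  set P := \prod_(_ <= _ < _) _.
  have h : (s.+1)%:R * 'C(t, s.+1)%:R = (t%:R - s%:R) * 'C(t, s)%:R :> K.
    by rewrite -natrB ?(ltnW st) // -!natrM mul_bin_left.
  have -> : ('C(t.+1, s.+1))%:R = ('C(t, s.+1))%:R + ('C(t, s))%:R :> K by rewrite binS natrD.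
  transitivity (P * (((wt al)%:R - b%:R *+ 2 - t%:R) * 'C(t, s.+1)%:R
     - (s.+1)%:R * 'C(t, s.+1)%:R + ((wt al)%:R - b%:R *+ 2 - s%:R) * 'C(t, s)%:R)).
    by rewrite !natrD; ring.
  by rewrite h; ring.
- by rewrite !bin_small ?ltnS // ?(leqW _) // ?mul0r ?mulr0 ?mul0r ?addr0 // ltnW.
by rewrite binn bin_small // !mulr0 mul0r add0r !big_geq // ?binn ?mulr1.
Qed.

(** If [wt T = b + s] with [s < t], the product in [pairing_iter] contains the factor for
    [i = t - 1], which the numerical hypothesis makes zero. *)
Lemma shift_inv_iter N al b f t : al \in box n N -> supp al b f -> shift_inv N b f ->
  (wt al)%:R - b%:R *+ 2 = t%:R - 1 :> K -> shift_inv N (b + t) (iter t (Dx al) f).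
Proof.
move=> aN sf vf m T Tbt; case: (ltnP (wt T) b) => Tb.
  exact: pairing_iter_low aN sf vf Tb.
have wT : wt T = (b + (wt T - b))%N by rewrite subnKC.
have st : (wt T - b < t)%N by rewrite ltn_subLR.
rewrite (pairing_iter t aN sf vf wT); case: t st {Tbt} m => // t; rewrite ltnS => st m.
rewrite big_nat_recr //= m; set P := \prod_(_ <= _ < _) _.
by rewrite -natr1; ring.
Qed.

End Functionals.

(** * Divided powers of the polarization operator *)

Section DividedPowers.
Local Open Scope ring_scope.
Variables (K : fieldType) (n : nat).
Local Notation X := {ffun 'I_n -> nat}.
Implicit Types (B T al z : X) (i : 'I_n) (f g : X -> K) (N b t : nat).

(* The divided power [Dx ^ t / t!]. *)
Definition Dt N al t f : X -> K := fun B =>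
  \sum_(z <- box n N | xle z B && (wt z == t))
    (xbin (xsub al (xsub B z)) z)%:R * f (xsub B z).

Lemma eq_Dx al f g : f =1 g -> Dx al f =1 Dx al g.
Proof. by move=> fg B; apply: eq_bigr => i _; rewrite fg. Qed.

Lemma supp_Dt N al b t f : supp al b f -> supp al (b + t) (Dt N al t f).
Proof.
move=> sf B; apply: contraR => nB; rewrite /Dt big1 // => z /andP[zB /eqP wz].
case: (eqVneq (f (xsub B z)) 0) => [->|]; first by rewrite mulr0.
move=> /sf/andP[le /eqP wB].
case: (eqVneq (xbin (xsub al (xsub B z)) z) 0%N) => [->|]; first by rewrite mul0r.
rewrite xbin_neq0 => /xleP zal; case/negP: nB.
rewrite -(xsubK zB) wt_add wB wz eqxx andbT; apply/xleP => i.
have := zal i; have /xleP/(_ i) := le; rewrite !ffunE; lia.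
Qed.

Lemma Dt0 N al b f : al \in box n N -> supp al b f -> Dt N al 0 f =1 f.
Proof.
move=> aN sf B.
have sD := supp_Dt (N := N) (t := 0%N) sf.
case: (boolP (xle B al)) => [Ba|nBa]; last first.
  by rewrite (supp0 sf) ?(negPf nBa) // (supp0 sD) ?(negPf nBa).
pose z0 : X := [ffun=> 0%N].
have z0B : z0 \in box n N by apply: box_le aN; apply/xleP => i; rewrite ffunE.
have wz z : (wt z == 0)%N -> z = z0.
  move=> /eqP w; apply/ffunP => i; rewrite ffunE; apply/eqP.
  by rewrite -leqn0 -w wt_ge.
rewrite /Dt -big_filter.
have -> : [seq z <- box n N | xle z B & (wt z == 0)%N] = [:: z0]; last first.
  rewrite big_seq1 (_ : xsub B z0 = B); last by apply/ffunP => i; rewrite !ffunE subn0.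
  by rewrite /xbin big1 ?mul1r // => i _; rewrite [z0 i]ffunE bin0.
apply: perm_small_eq => //; apply: uniq_perm; rewrite ?filter_uniq ?box_uniq // => z.
rewrite mem_filter inE; apply/idP/eqP => [/andP[/andP[_ /wz]] //|->].
rewrite z0B andbT; apply/andP; split; first by apply/xleP => i; rewrite ffunE.
by rewrite /wt big1 // => i _; rewrite ffunE.
Qed.

Lemma Dx_Dt N al b t f : al \in box n N -> supp al b f -> forall B,
  Dx al (Dt N al t f) B = t.+1%:R * Dt N al t.+1 f B.
Proof.
move=> aN sf B.
have sD s := supp_Dt (N := N) (t := s) sf.
case: (boolP (xle B al)) => [Ba|nBa]; last first.
  by rewrite (supp0 (supp_Dx (sD t))) ?(negPf nBa) // (supp0 (sD t.+1)) ?(negPf nBa) ?mulr0.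
have BN : B \in box n N by apply: box_le aN.
(* Common refinement of the two sides: on the right [t + 1] is split as the sum of the [z i], and
   the pair [(i, z)] corresponds on the left to [xsub z (xunit i)]. *)
pose F i z : K := if [&& xle z B & wt z == t.+1] then
   (z i)%:R * (xbin (xsub al (xsub B z)) z)%:R * f (xsub B z) else 0.
transitivity (\sum_i \sum_(z <- box n N | (0 < z i)%N) F i z); last first.
  transitivity (\sum_i \sum_(z <- box n N) F i z).
    apply: eq_bigr => i _; rewrite big_mkcond; apply: eq_bigr => z _.
    by case: posnP => // z0; rewrite /F z0 !mul0r; case: ifP.
  rewrite exchange_big /= /Dt mulr_sumr [RHS]big_mkcond; apply: eq_bigr => z _.
  rewrite /F; case: ifP => [/andP[_ /eqP wz]|_]; last by rewrite big1.
  under eq_bigr do rewrite -mulrA.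
  by rewrite -mulr_suml -natr_sum -[(\sum_i _)%N]/(wt z) wz.
rewrite /Dx big_mkcond; apply: eq_bigr => i _.
pose h z : K := F i (xadd z (xunit i)).
transitivity (\sum_(z <- box n N) h z); last first.
  rewrite -(shift_sum (i := i) (h := h)) => [|z].
    by apply: eq_bigr => z zi; rewrite /h xsubK ?unit_le.
  by rewrite /h /F; case: ifP; rewrite ?eqxx // => /andP[le _] _; apply: box_le le BN.
case: posnP => Bi.
  rewrite big1 // => z _; rewrite /h /F; case: ifP => // /andP[/xleP/(_ i)].
  by rewrite Bi !ffunE eqxx addn1.
rewrite /Dt mulr_sumr [LHS]big_mkcond; apply: eq_bigr => z _.
rewrite /h /F wt_add wt_unit addn1 eqSS.
have -> : xle (xadd z (xunit i)) B = xle z (xsub B (xunit i)).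
  apply/xleP/xleP => le j; have := le j; rewrite !ffunE; case: eqP => [->|_]; lia.
have -> : xsub B (xadd z (xunit i)) = xsub (xsub B (xunit i)) z.
  by apply/ffunP => j; rewrite !ffunE; lia.
case: ifP => // /andP[/xleP zB _].
case: (eqVneq (f (xsub (xsub B (xunit i)) z)) 0) => [->|]; first by rewrite !mulr0.
move=> /sf/andP[/xleP le _]; rewrite mulrA; congr (_ * _); rewrite -!natrM; congr (_%:R).
set M := xsub al _.
have zi : (0 < xadd z (xunit i) i)%N by rewrite !ffunE eqxx addn1.
have := xbin_mul M zi; rewrite xaddK.
have -> : (al i - xsub B (xunit i) i = M i - (xadd z (xunit i) i).-1)%N.
  have := le i; have := zB i; have /xleP/(_ i) := Ba; rewrite !ffunE eqxx; lia.
move=> E; rewrite mulnBl E addKn //.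
Qed.

Lemma Dt_iter N al b t f : al \in box n N -> supp al b f ->
  forall B, iter t (Dx al) f B = t`!%:R * Dt N al t f B.
Proof.
move=> aN sf; elim: t => [|t IH] B; first by rewrite (Dt0 aN sf) mul1r.
rewrite iterS (eq_Dx al IH) factS natrM mulrAC -(Dx_Dt t aN sf) mulrC.
by rewrite /Dx mulr_sumr; apply: eq_bigr => i _; rewrite mulrCA.
Qed.

Lemma fact_pchar_neq0 p t : p \in [pchar K] -> (t < p)%N -> t`!%:R != 0 :> K.
Proof.
move=> pK; elim: t => [|t IH] tp; first by rewrite oner_eq0.
rewrite factS natrM mulf_eq0 negb_or IH ?(ltnW tp) // andbT.
by rewrite -(dvdn_pcharf pK) gtnNdvd.
Qed.

(** Invariance passes from [E^t] to its divided power because [t!] is invertible in [K] for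
    [t < p]. *)
Lemma shift_inv_Dt p N al b t f : p \in [pchar K] -> (t < p)%N ->
  al \in box n N -> supp al b f -> shift_inv N b f ->
  (wt al)%:R - b%:R *+ 2 = t%:R - 1 :> K -> shift_inv N (b + t) (Dt N al t f).
Proof.
move=> pK tp aN sf vf m T Tb; have := shift_inv_iter aN sf vf m Tb.
have -> : pairing N T (iter t (Dx al) f) = t`!%:R * pairing N T (Dt N al t f).
  by rewrite /pairing mulr_sumr; apply: eq_bigr => B _; rewrite (Dt_iter t aN sf) mulrCA.
by move/eqP; rewrite mulf_eq0 (negPf (fact_pchar_neq0 pK tp)) => /eqP.
Qed.

End DividedPowers.

(** * Invariants with more [y] than [x] vanish *)

Section Dominance.
Local Open Scope ring_scope.
Variables (K : fieldType) (n : nat).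
Local Notation X := {ffun 'I_n -> nat}.
Implicit Types (B T al z : X) (i : 'I_n) (f g : X -> K) (N b t : nat).

(** Inclusion-exclusion for the [q]-subsets of an [a]-set that avoid [N] given points:
    [C(a - m, q - m)] counts those containing [m] prescribed points. *)
Lemma alternating_bin (N a q : nat) : (N <= a)%N ->
  \sum_(m < q.+1) (-1) ^+ m * 'C(N, m)%:R * 'C(a - m, q - m)%:R = 'C(a - N, q)%:R :> K.
Proof.
elim: N a q => [|N IH] a q Na.
  rewrite big_ord_recl !subn0 bin0 !mul1r big1 ?addr0 // => m _.
  by rewrite /= bin0n mulr0 mul0r.
case: a Na => // a Na; case: q => [|q].
  by rewrite big_ord1 !subn0 !bin0 !mul1r.
rewrite big_ord_recl /= !subn0 bin0 !mul1r.
have := IH a.+1 q.+1 (leqW Na); rewrite big_ord_recl /= !subn0 bin0 !mul1r => E1.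
have E2 := IH a q Na.
transitivity ('C(a.+1, q.+1)%:R +
   (\sum_(m < q.+1) (-1) ^+ (lift ord0 m) * 'C(N, lift ord0 m)%:R
      * 'C(a.+1 - lift ord0 m, q.+1 - lift ord0 m)%:R
    - \sum_(m < q.+1) (-1) ^+ m * 'C(N, m)%:R * 'C(a - m, q - m)%:R) : K).
  congr (_ + _); rewrite -sumrB; apply: eq_bigr => m _.
  by rewrite /bump /= add1n binS natrD exprS !subSS; ring.
by rewrite addrA E1 E2 subSn // binS natrD subSS; ring.
Qed.

(** A combination of vanishing pairings isolates the single coefficient [f B0]. All [T] involved lie
    below the exponent [A0 = al - B0] of [x], whose weight [wt al - b] is less than [b], so
    invariance applies to each of them. *)
Lemma dominance N al b f : al \in box n N -> supp al b f -> shift_inv N b f ->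
  (wt al < b + b)%N -> f =1 (fun=> 0).
Proof.
move=> aN sf vf lt B0.
case: (boolP (xle B0 al && (wt B0 == b))) => [/andP[B0a /eqP wB0]|]; last exact: supp0.
pose A0 := xsub al B0.
have A0N i : (A0 i < N)%N by have /boxP/(_ i) := aN; apply: leq_ltn_trans; rewrite ffunE leq_subr.
have wA0 : wt A0 = (wt al - b)%N by rewrite wt_sub // wB0.
(* Chosen so that [alternating_bin] in each coordinate turns the combination of the [xbin B T] into
   [xbin (xsub al B) A0]. Both arguments of the latter have the same weight, so it is 1 at [B = B0]
   and 0 elsewhere on the support. *)
pose cf i (m : nat) : K :=
  if (m < (A0 i).+1)%N then (-1) ^+ m * 'C(al i - m, A0 i - m)%:R else 0.
have E0 : \sum_(T <- box n N) (\prod_i cf i (T i)) * pairing N T f = 0.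
  rewrite big1 // => T _; case: (boolP (xle T A0)) => [TA|].
    by rewrite vf ?mulr0 //; have := wt_le TA; have := wt_le B0a; lia.
  rewrite negb_forall => /existsP[i]; rewrite -ltnNge => h.
  by rewrite (bigD1 i) //= /cf ltnS leqNgt h !mul0r.
rewrite -E0 /pairing.
under [RHS]eq_bigr do rewrite mulr_sumr.
rewrite exchange_big /=.
have E1 B : xle B al -> \sum_(T <- box n N) (\prod_i cf i (T i)) * ((xbin B T)%:R * f B)
    = (xbin (xsub al B) A0)%:R * f B.
  move=> /xleP Ba.
  under eq_bigr do rewrite mulrA; rewrite -mulr_suml; congr (_ * _).
  transitivity (\sum_(T <- box n N) \prod_i (cf i (T i) * 'C(B i, T i)%:R)).
    by apply: eq_bigr => T _; rewrite big_split /= /xbin natr_prod.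
  rewrite /box big_image /=.
  transitivity (\sum_(e : {ffun 'I_n -> 'I_N}) \prod_i (cf i (e i) * 'C(B i, e i)%:R)).
    by apply: eq_bigr => e _; apply: eq_bigr => i _; rewrite ffunE.
  rewrite -(bigA_distr_bigA (fun i (m : 'I_N) => cf i m * 'C(B i, m)%:R)) /= natr_prod.
  apply: eq_bigr => i _; rewrite [xsub al B i]ffunE -alternating_bin //.
  rewrite (big_ord_widen N (fun m => (-1) ^+ m * 'C(B i, m)%:R * 'C(al i - m, A0 i - m)%:R)) //.
  rewrite [RHS]big_mkcond; apply: eq_bigr => m _ /=; rewrite /cf.
  by case: ifP => _; rewrite ?mul0r // mulrAC.
have B0N : B0 \in box n N by apply: box_le aN.
rewrite (bigD1_seq B0) ?box_uniq //= E1 // xbin_refl mul1r big1 ?addr0 // => B BB0.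
case: (eqVneq (f B) 0) => [->|/sf/andP[Ba /eqP wB]].
  by rewrite big1 // => T _; rewrite !mulr0.
rewrite E1 // (_ : xbin _ _ = 0%N) ?mul0r //; apply/eqP; apply: contraNT BB0.
rewrite xbin_neq0 => /xle_wt_eq le; rewrite -(xsubBK Ba) -le ?xsubBK //.
by rewrite !wt_sub // wB wB0.
Qed.

End Dominance.

(** * Leading monomials of invariants are standard, and every standard monomial occurs *)

Section LeadingTerms.
Local Open Scope ring_scope.
Variables (K : fieldType) (n : nat).
Local Notation X := {ffun 'I_n -> nat}.
Implicit Types (B T C al z : X) (i j k : 'I_n) (f g : X -> K) (N b t : nat).

Definition leads N f B := forall C, (code N B < code N C)%N -> f C = 0.

(* [(al - B, B)] is the content of the two rows of a semistandard tableau. *)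
Definition standard al B := forall k : 'I_n,
  (\sum_(j < n | j <= k) B j <= \sum_(j < n | j < k) (al j - B j))%N.

Lemma sum_ord_leq (F : 'I_n -> nat) k :
  (\sum_(j < n | j <= k) F j = F k + \sum_(j < n | j < k) F j)%N.
Proof.
rewrite (bigD1 k) //=; congr (_ + _)%N; apply: eq_bigl => j.
by rewrite ltn_neqAle andbC.
Qed.

(* Keeping only the monomials with the leading exponents of [y_j], [j > k], and dividing by
   the largest possible power of [x_k] gives an invariant, to which dominance applies. *)
Lemma leads_standard N al b f B : al \in box n N -> supp al b f -> shift_inv N b f ->
  f B != 0 -> leads N f B -> standard al B.
Proof.
move=> aN sf vf fB0 lB k; have /andP[Ba /eqP wB] := sf _ fB0.
have BN : B \in box n N by apply: box_le aN.
(* At [k] the new multidegree is [B k]: the leading monomial has the least exponent [al k - B k] of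
   [x_k] among the retained ones, and that power is divided out. Nothing is left above [k], where
   the exponents are frozen to [Bh]. *)
pose al' : X := [ffun j : 'I_n => if (j < k)%N then al j else if j == k then B j else 0%N].
pose B' : X := [ffun j : 'I_n => if (j <= k)%N then B j else 0%N].
pose Bh : X := [ffun j : 'I_n => if (j <= k)%N then 0%N else B j].
have BE : xadd B' Bh = B.
  by apply/ffunP => j; rewrite !ffunE; case: ifP; rewrite ?addn0.
have wBE : (wt B' + wt Bh)%N = b by rewrite -wt_add BE.
pose u C := if xle C al' && (wt C == wt B') then f (xadd C Bh) else 0.
have su : supp al' (wt B') u by move=> C; rewrite /u; case: ifP; rewrite ?eqxx.
have al'a : xle al' al.
  apply/xleP => j; rewrite ffunE; case: ifP => // _; case: eqP => // ->; exact: (xleP _ _ Ba).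
have al'N : al' \in box n N by apply: box_le aN.
have B'a : xle B' al'.
  apply/xleP => j; rewrite !ffunE; case: ltngtP => // [_|/val_inj->]; last by rewrite eqxx.
  exact: (xleP _ _ Ba).
have uB : u B' != 0 by rewrite /u B'a eqxx BE.
have al'hi C j : xle C al' -> (k < j)%N -> C j = 0%N.
  move=> /xleP/(_ j); rewrite ffunE; case: ltngtP => // kj; rewrite ifN ?leqn0.
    by move/eqP.
  by rewrite -val_eqE gtn_eqF.
have vu : shift_inv N (wt B') u.
  move=> T wT; case: (boolP [exists j : 'I_n, (k < j)%N && (0 < T j)%N]).
    move=> /existsP[j /andP[kj Tj]]; rewrite /pairing big1 // => C _.
    case: (eqVneq (u C) 0) => [->|/su/andP[Ca _]]; first by rewrite mulr0.
    by rewrite /xbin (bigD1 j) //= (al'hi C) // bin0n; case: (T j) Tj => // ? _; rewrite !mul0r.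
  rewrite negb_exists => /forallP Thi.
  have {}Thi j : (k < j)%N -> T j = 0%N.
    by move=> kj; have := Thi j; rewrite kj -eqn0Ngt => /eqP.
  (* Only exponents of the form [xadd C Bh] contribute to the pairing of [f] with [xadd T Bh]. As
     [B] leads, such a [C] vanishes above [k] and satisfies [C k <= B k], so [u] retains all these
     terms, with the same binomials. *)
  have wTB : (wt (xadd T Bh) < b)%N by rewrite wt_add -wBE ltn_add2r.
  rewrite -(vf _ wTB) /pairing.
  have injs : injective (fun C => xadd C Bh).
    by move=> C C' /(congr1 (fun z => xsub z Bh)); rewrite !xaddK.
  transitivity (\sum_(C <- map (fun C => xadd C Bh) (box n N)) (xbin C (xadd T Bh))%:R * f C);
    last first.
    apply: sum_support; first by rewrite map_inj_uniq //; apply: box_uniq.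
      exact: box_uniq.
    move=> C; rewrite mulf_eq0 negb_or => /andP[h /sf/andP[Ca _]].
    have CN : C \in box n N by apply: box_le aN.
    have TC : xle (xadd T Bh) C by rewrite -xbin_neq0; apply: contraNneq h => ->.
    have BC : xle Bh C by apply: xle_trans TC; apply: xle_addr.
    rewrite CN andbT; apply/mapP; exists (xsub C Bh); rewrite ?xsubK //.
    by apply: box_le CN; apply/xleP => j; rewrite ffunE leq_subr.
  rewrite [RHS]big_map; apply: eq_bigr => C _; rewrite /u; case: ifP => [/andP[Ca _]|nC].
    congr (_%:R * _); rewrite /xbin; apply: eq_bigr => j _; rewrite !ffunE; case: leqP => jk.
      by rewrite !addn0.
    by rewrite Thi // (al'hi C) // !add0n !binn.
  rewrite mulr0; apply/esym/eqP; apply: contraFT nC; rewrite mulf_eq0 negb_or => /andP[_ fC].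
  have /andP[/xleP Ca /eqP wC] := sf _ fC.
  have nlt : ~~ (code N B < code N (xadd C Bh))%N by apply: contra fC => /lB ->.
  have Chi j : (k < j)%N -> C j = 0%N.
    move=> kj; apply/eqP; rewrite -leqn0 leqNgt; apply: contra nlt => Cj.
    apply: (@code_lt _ N B _ j) => // [i ji|]; rewrite !ffunE.
      by rewrite ifN ?leq_addl // -ltnNge (ltn_trans kj ji).
    by rewrite ifN -?ltnNge // -[X in (X < _)%N]add0n ltn_add2r.
  have Ck : (C k <= B k)%N.
    rewrite leqNgt; apply: contra nlt => Ck.
    apply: (@code_lt _ N B _ k) => // [i ki|]; rewrite !ffunE.
      by rewrite ifN ?leq_addl // -ltnNge.
    by rewrite leqnn addn0.
  rewrite -(eqn_add2r (wt Bh)) -wt_add wC wBE eqxx andbT; apply/xleP => j; rewrite ffunE.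
  case: ltngtP => [jk|kj|/val_inj->]; last by rewrite eqxx.
    by have := Ca j; rewrite !ffunE (ltnW jk) addn0.
  by rewrite Chi.
(* Failure of standardness at [k] says precisely that [wt al' < 2 wt B']. *)
rewrite leqNgt; apply/negP => lt; move/eqP: uB; apply.
apply: (dominance al'N su vu).
have -> : wt B' = (\sum_(j < n | j <= k) B j)%N.
  by rewrite /wt [RHS]big_mkcond; apply: eq_bigr => j _; rewrite ffunE.
have -> : wt al' = (B k + \sum_(j < n | j < k) al j)%N.
  rewrite /wt (bigD1 k) //= ffunE ltnn eqxx; congr (_ + _)%N.
  rewrite [LHS]big_mkcond [RHS]big_mkcond; apply: eq_bigr => j _; rewrite ffunE.
  case: eqP => [->|_] /=; first by rewrite ltnn.
  by case: ifP.
have : (\sum_(j < n | j < k) al j =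
        \sum_(j < n | j < k) (al j - B j) + \sum_(j < n | j < k) B j)%N.
  by rewrite -big_split; apply: eq_bigr => j _ /=; rewrite subnK //; apply: (xleP _ _ Ba).
by move: lt; rewrite !sum_ord_leq; lia.
Qed.

(* Multiplication by the minor [x_i y_k - x_k y_i]. *)
Definition minor_mul i k g : X -> K := fun C =>
  (if (0 < C k)%N then g (xsub C (xunit k)) else 0) -
  (if (0 < C i)%N then g (xsub C (xunit i)) else 0).

Lemma supp_minor_mul al b g i k : supp al b g ->
  supp (xadd al (xadd (xunit i) (xunit k))) b.+1 (minor_mul i k g).
Proof.
move=> sg.
have key C j : (j == i) || (j == k) ->
   (if (0 < C j)%N then g (xsub C (xunit j)) else 0) != 0 ->
   xle C (xadd al (xadd (xunit i) (xunit k))) && (wt C == b.+1).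
  move=> ji; case: ifP; rewrite ?eqxx // -unit_le => uC /sg/andP[/xleP le /eqP w].
  rewrite -(xsubK uC) wt_add w wt_unit addn1 eqxx andbT; apply/xleP => l.
  have := le l; rewrite !ffunE; case: (l =P j) => [->|_]; last by lia.
  by case/orP: ji => /eqP->; rewrite eqxx; lia.
move=> C; rewrite /minor_mul.
case: (eqVneq (if (0 < C k)%N then g (xsub C (xunit k)) else 0) 0) => [->|h _]; last first.
  by apply: key h; rewrite eqxx orbT.
by rewrite sub0r oppr_eq0; apply: key; rewrite eqxx.
Qed.

(** Substituting in [y_j g] yields an [x_j] term and a [y_j] term. The [x] terms of the two halves
    of the minor both contribute [pairing N T g], possibly nonzero when [wt T = b], and cancel; the
    [y] terms pair [g] with [xsub T (xunit j)], of weight below [b]. *)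
Lemma shift_inv_minor_mul N al b g i k :
  xadd al (xadd (xunit i) (xunit k)) \in box n N ->
  supp al b g -> shift_inv N b g -> shift_inv N b.+1 (minor_mul i k g).
Proof.
move=> aN sg vg T Tb.
have key j : (j == i) || (j == k) -> \sum_(B <- box n N)
   (xbin B T)%:R * (if (0 < B j)%N then g (xsub B (xunit j)) else 0) =
   pairing N T g + (if (0 < T j)%N then pairing N (xsub T (xunit j)) g else 0).
  move=> ji.
  transitivity (\sum_(B <- box n N | (0 < B j)%N)
     (xbin (xadd (xsub B (xunit j)) (xunit j)) T)%:R * g (xsub B (xunit j))).
    rewrite [RHS]big_mkcond; apply: eq_bigr => B _; case: ifP => [Bj|_].
      by rewrite xsubK ?unit_le.
    by rewrite mulr0.
  rewrite (shift_sum (h := fun B => (xbin (xadd B (xunit j)) T)%:R * g B)) => [|B].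
    transitivity (\sum_(B <- box n N) ((xbin B T)%:R * g B +
       (if (0 < T j)%N then (xbin B (xsub T (xunit j)))%:R * g B else 0))).
      by apply: eq_bigr => B _; rewrite xbin_unit natrD mulrDl; case: ifP; rewrite ?mul0r.
    by rewrite big_split /=; congr (_ + _); case: ifP => // _; rewrite big1.
  rewrite mulf_eq0 negb_or => /andP[_ /sg/andP[/xleP le _]]; apply: box_le aN.
  apply/xleP => l; have := le l; rewrite !ffunE; case: (l =P j) => [->|_]; last by lia.
  by case/orP: ji => /eqP->; rewrite eqxx; lia.
rewrite /pairing /minor_mul; under eq_bigr do rewrite mulrBr.
rewrite sumrB !key ?eqxx ?orbT // opprD addrACA subrr add0r.
have z j : (if (0 < T j)%N then pairing N (xsub T (xunit j)) g else 0) = 0.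
  case: ifP => // Tj; rewrite vg // wt_sub ?unit_le // wt_unit.
  have := wt_ge T j; lia.
by rewrite !z subrr.
Qed.

(** Induction by peeling off one column of the tableau: [k] is the largest entry of the second row
    and [i] the largest first-row entry below [k]. The minor for [(i, k)] has [x_i y_k] as leading
    monomial because [i < k]. *)
Lemma standard_exists N al b B : al \in box n N -> xle B al -> wt B = b -> standard al B ->
  exists g, [/\ supp al b g, shift_inv N b g, g B = 1 & leads N g B].
Proof.
elim: b al B => [|b IH] al B aN Ba wB stB.
  have B0 j : B j = 0%N by apply/eqP; rewrite -leqn0 -wB wt_ge.
  exists (fun C => (C == B)%:R); split => //; last 2 first.
  - by rewrite eqxx.
  - by move=> C h; case: (C =P B) h => // ->; rewrite ltnn.
  by move=> C /=; case: (C =P B) => [->|_]; rewrite ?eqxx // Ba wB eqxx.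
have [i0 Bi0] : exists j, (0 < B j)%N.
  apply/existsP; apply: contra_eqT wB; rewrite negb_exists => /forallP h.
  by rewrite /wt big1 // => j _; have := h j; rewrite -eqn0Ngt => /eqP.
have [k Bk km] := @ex_max _ (fun j => 0 < B j)%N i0 Bi0.
have {}km j : (k < j)%N -> B j = 0%N by move/km; rewrite -eqn0Ngt => /eqP.
have [i1 Pi1] : exists j, (j < k)%N && (0 < al j - B j)%N.
  apply/existsP; apply/contraT; rewrite negb_exists => /forallP h.
  have := stB k; rewrite sum_ord_leq [X in (_ <= X)%N]big1; first by lia.
  by move=> j jk; have := h j; rewrite jk /= -eqn0Ngt => /eqP.
have [i /andP[ik Ai] im] := @ex_max _ (fun j : 'I_n => (j < k)%N && (0 < al j - B j)%N) i1 Pi1.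
have {}im j : (i < j)%N -> (j < k)%N -> (al j - B j = 0)%N.
  by move=> /im; case: ltnP => //= _; rewrite -eqn0Ngt => /eqP.
have ik' : i != k by rewrite -val_eqE ltn_eqF.
have uk : xle (xunit k) B by rewrite unit_le.
pose B' := xsub B (xunit k).
pose al' := xsub al (xadd (xunit i) (xunit k)).
have leal : xle (xadd (xunit i) (xunit k)) al.
  apply/xleP => j; have /xleP/(_ j) := Ba; rewrite !ffunE.
  by case: (j =P i) => [->|_]; case: (_ =P k) => [E|_]; move: Ai Bk ik'; rewrite ?E ?eqxx //; lia.
have alE : xadd al' (xadd (xunit i) (xunit k)) = al by rewrite xsubK.
have al'N : al' \in box n N.
  by apply: box_le aN; apply/xleP => j; rewrite ffunE leq_subr.
have B'a : xle B' al'.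
  apply/xleP => j; have /xleP/(_ j) := Ba; rewrite !ffunE.
  case: (j =P i) => [->|_]; case: (_ =P k) => [E|_]; move: Ai Bk ik'; rewrite ?E ?eqxx //; lia.
have AE j : (al' j - B' j = (al j - B j) - (j == i))%N.
  rewrite !ffunE; case: (j =P k) => [->|_]; last by rewrite addn0 subn0 -!subnDA addnC.
  by rewrite [k == i]eq_sym (negPf ik') ?eqxx; move: Bk; have /xleP/(_ k) := Ba; move=> /= *; lia.
have wB' : wt B' = b by rewrite wt_sub // wB wt_unit subn1.
have st' : standard al' B'.
  move=> m; have stm := stB m.
  under [X in (_ <= X)%N]eq_bigr do rewrite AE.
  case: (leqP m i) => mi.
    have -> : (\sum_(j < n | j < m) (al j - B j - (j == i)) = \sum_(j < n | j < m) (al j - B j))%N.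
      by apply: eq_bigr => j jm; rewrite -val_eqE ltn_eqF ?subn0 // (leq_trans jm).
    by apply: leq_trans stm; apply: leq_sum => j _; rewrite ffunE leq_subr.
  have E1 : (\sum_(j < n | j < m) (al j - B j - (j == i)) + 1 =
             \sum_(j < n | j < m) (al j - B j))%N.
    rewrite (bigD1 i) //= [RHS](bigD1 i) //= eqxx -addnA [(_ + 1)%N]addnC addnA subnK //.
    by congr (_ + _)%N; apply: eq_bigr => j /andP[_ /negPf->]; rewrite subn0.
  case: (leqP k m) => km'.
    have E2 : (\sum_(j < n | j <= m) B' j + 1 = \sum_(j < n | j <= m) B j)%N.
      rewrite (bigD1 k) //= [RHS](bigD1 k) //= !ffunE eqxx -addnA [(_ + 1)%N]addnC addnA subnK //.
      by congr (_ + _)%N; apply: eq_bigr => j /andP[_ /negPf h]; rewrite !ffunE h subn0.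
    by rewrite -(leq_add2r 1) E1 E2.
  (* Here [i < m < k]. The first row has no entry in [[m, k)], so the condition at [m] follows from
     the one at [k], where [B k > 0] supplies the unit lost by removing [i]. *)
  have E3 : (\sum_(j < n | j <= m) B' j <= \sum_(j < n | j < k) B j)%N.
    rewrite big_mkcond [X in (_ <= X)%N]big_mkcond; apply: leq_sum => j _.
    by case: (leqP j m) => // jm; rewrite (leq_ltn_trans jm km') ffunE leq_subr.
  have E4 : (\sum_(j < n | j < k) (al j - B j) = \sum_(j < n | j < m) (al j - B j))%N.
    rewrite big_mkcond [RHS]big_mkcond; apply: eq_bigr => j _.
    case: (ltnP j m) => jm; first by rewrite (ltn_trans jm km').
    by case: ifP => // jk; rewrite im // (leq_trans mi jm).
  rewrite -(leq_add2r 1) E1 -E4; apply: leq_trans (stB k).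
  by rewrite [X in (_ <= X)%N]sum_ord_leq addnC leq_add.
have [g [sg vg gB lg]] := IH al' B' al'N B'a wB' st'.
have N1 : (1 < N)%N.
  by have /boxP/(_ k) := aN; have /xleP/(_ k) := Ba; lia.
have cB : (code N B = code N B' + N ^ k)%N by rewrite -{1}(xsubK uk) codeD code_unit.
have lt : (N ^ i < N ^ k)%N by rewrite ltn_exp2l.
exists (minor_mul i k g); split.
- by rewrite -alE; apply: supp_minor_mul.
- by apply: (shift_inv_minor_mul (al := al')) => //; rewrite alE.
- rewrite /minor_mul Bk gB; case: ifP => [Bi|_]; last by rewrite subr0.
  have ui : xle (xunit i) B by rewrite unit_le.
  rewrite lg ?subr0 //.
  have : (code N B = code N (xsub B (xunit i)) + N ^ i)%N by rewrite -{1}(xsubK ui) codeD code_unit.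
  by lia.
move=> C BC; rewrite /minor_mul.
have key j : (N ^ j <= N ^ k)%N -> (if (0 < C j)%N then g (xsub C (xunit j)) else 0) = 0.
  move=> le; case: ifP => //; rewrite -unit_le => uC; apply: lg.
  have : (code N C = code N (xsub C (xunit j)) + N ^ j)%N by rewrite -{1}(xsubK uC) codeD code_unit.
  by lia.
by rewrite !key ?subrr // ltnW.
Qed.

End LeadingTerms.

(** * Exactness of the dual Weyl complex in characteristic 2 *)

Section Exactness.
Local Open Scope ring_scope.
Variables (K : fieldType) (n : nat).
Local Notation X := {ffun 'I_n -> nat}.
Implicit Types (B T C al z : X) (i j k : 'I_n) (f g u v : X -> K) (N b t : nat) (c : K).

Lemma leads_exists N al b f B : al \in box n N -> supp al b f -> f B != 0 ->
  exists2 B', f B' != 0 & leads N f B'.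
Proof.
move=> aN sf fB.
have inb C : f C != 0 -> C \in box n N by move=> /sf/andP[Ca _]; apply: box_le aN.
pose nf (e : {ffun 'I_n -> 'I_N}) : X := [ffun i => nat_of_ord (e i)].
have /mapP[e0 _ Be0] := inb _ fB.
have Pe0 : f (nf e0) != 0 by rewrite -[nf e0]Be0.
case: (@arg_maxnP _ e0 (fun e => f (nf e) != 0) (fun e => code N (nf e)) Pe0) => e fe me.
exists (nf e) => // C lt; apply/eqP; apply: contraTT lt => fC.
have /mapP[e' _ Ce'] := inb _ fC; rewrite -leqNgt Ce'; apply: (me e').
by rewrite -[nf e']Ce'.
Qed.

Lemma supp_lin al b u v c : supp al b u -> supp al b v -> supp al b (fun B => u B + c * v B).
Proof.
move=> su sv B; case: (eqVneq (u B) 0) => [->|/su-> //].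
by rewrite add0r mulf_eq0 negb_or => /andP[_ /sv].
Qed.

Lemma pairing_lin N T u v c :
  pairing N T (fun B => u B + c * v B) = pairing N T u + c * pairing N T v.
Proof.
rewrite /pairing mulr_sumr -big_split; apply: eq_bigr => B _ /=; ring.
Qed.

Lemma shift_inv_lin N b u v c : shift_inv N b u -> shift_inv N b v ->
  shift_inv N b (fun B => u B + c * v B).
Proof. by move=> vu vv T Tb; rewrite pairing_lin vu // vv // mulr0 addr0. Qed.

Lemma Dx_lin al u v c B : Dx al (fun B => u B + c * v B) B = Dx al u B + c * Dx al v B.
Proof. rewrite /Dx mulr_sumr -big_split; apply: eq_bigr => i _ /=; ring. Qed.

Lemma Dt_lin N al t u v c B :
  Dt N al t (fun B => u B + c * v B) B = Dt N al t u B + c * Dt N al t v B.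
Proof. rewrite /Dt mulr_sumr -big_split; apply: eq_bigr => i _ /=; ring. Qed.

Lemma Dt1 N al b f : al \in box n N -> supp al b f -> Dt N al 1 f =1 Dx al f.
Proof. by move=> aN sf B; rewrite -[RHS]/(iter 1 (Dx al) f B) (Dt_iter 1 aN sf) mul1r. Qed.

Lemma Dx_Dx0 N al b f : 2%N \in [pchar K] -> al \in box n N -> supp al b f ->
  forall B, Dx al (Dx al f) B = 0.
Proof.
move=> K2 aN sf B; rewrite -[LHS]/(iter 2 (Dx al) f B) (Dt_iter 2 aN sf).
by rewrite (pcharf0 K2) mul0r.
Qed.

Lemma code_sub N C i : (0 < C i)%N -> (code N (xsub C (xunit i)) + N ^ i)%N = code N C.
Proof. by rewrite -unit_le => uC; rewrite -{2}(xsubK uC) codeD code_unit. Qed.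

Lemma Dx_exact_char2 N al b f : 2%N \in [pchar K] -> al \in box n N ->
  (wt al)%:R = 0 :> K ->
  supp al b.+1 f -> shift_inv N b.+1 f -> (forall B, Dx al f B = 0) ->
  exists psi, [/\ supp al b psi, shift_inv N b psi & forall B, f B = Dx al psi B].
Proof.
move=> K2 aN wal.
have [m mf] : exists m, forall C, C \in box n N -> (code N C < m)%N.
  exists (\max_(C <- box n N) code N C).+1 => C CN; rewrite ltnS; exact: leq_bigmax_seq.
move=> sf vf df.
have {mf} : forall C, f C != 0 -> (code N C < m)%N.
  by move=> C /sf/andP[Ca _]; apply: mf; apply: box_le aN.
elim: m f sf vf df => [|m IH] f sf vf df mf.
  exists (fun=> 0); split => [B|T _|B]; first by rewrite eqxx.
    by rewrite /pairing big1 // => B _; rewrite mulr0.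
  rewrite /Dx big1 => [|i _]; last by rewrite mulr0.
  by apply/eqP; apply: contraT => /mf.
case: (boolP (has (fun B => f B != 0) (box n N))) => [/hasP[B1 _ fB1]|nf]; last first.
  apply: IH => // C fC; case/negP: nf; apply/hasP; exists C => //.
  by have /andP[Ca _] := sf _ fC; apply: box_le aN.
have [B fB lB] := leads_exists aN sf fB1.
have /andP[Ba /eqP wB] := sf _ fB.
have BN : B \in box n N by apply: box_le aN.
have stB := leads_standard aN sf vf fB lB.
have [i0 Bi0] : exists j, (0 < B j)%N.
  apply/existsP; apply: contra_eqT wB; rewrite negb_exists => /forallP h.
  by rewrite /wt big1 // => j _; have := h j; rewrite -eqn0Ngt => /eqP.
have [k Bk km] := @ex_max _ (fun j => 0 < B j)%N i0 Bi0.
have {}km j : (k < j)%N -> B j = 0%N by move/km; rewrite -eqn0Ngt => /eqP.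
have N1 : (1 < N)%N by have /boxP/(_ k) := BN; lia.
(* Evaluate [Dx al f = 0] at [xadd B (xunit i)]. Apart from [B] itself, the contributing exponents
   arise by removing some [y_j] with [j < i], hence lie above the leading one. *)
have alB i : (k <= i)%N -> (al i - B i)%:R = 0 :> K.
  move=> ki; have := df (xadd B (xunit i)).
  rewrite /Dx (bigD1 i) /=; last by rewrite !ffunE eqxx addn1.
  rewrite xaddK big1 ?addr0.
    by move/eqP; rewrite mulf_eq0 (negPf fB) orbF => /eqP.
  move=> j /andP[Bj ji]; rewrite lB ?mulr0 //.
  rewrite -(ltn_add2r (N ^ j)) (code_sub N Bj) codeD code_unit ltn_add2l.
  rewrite ltn_exp2l //; move: Bj; rewrite !ffunE (negPf ji) addn0 => Bj.
  case: (ltngtP j k) => [jk|kj|/val_inj E]; first exact: leq_trans ki.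
    by rewrite km in Bj.
  by rewrite ltn_neqAle val_eqE ji /= -E in ki *.
pose B' := xsub B (xunit k).
have cB : (code N B' + N ^ k)%N = code N B by apply: code_sub.
have uk : xle (xunit k) B by rewrite unit_le.
have B'B : xle B' B by apply/xleP => j; rewrite ffunE leq_subr.
have B'a : xle B' al by apply: xle_trans Ba.
have wB' : wt B' = b by rewrite wt_sub // wB wt_unit subn1.
have st' : standard al B'.
  move=> j; apply: leq_trans (leq_trans (stB j) _); apply: leq_sum => l _.
    exact: (xleP _ _ B'B).
  by apply: leq_sub2l; apply: (xleP _ _ B'B).
have [g [sg vg gB lg]] := standard_exists K aN B'a wB' st'.
have sDg := supp_Dx sg.
have vDg : shift_inv N b.+1 (Dx al g).
  rewrite -addn1; apply: (@shift_inv_iter K n N al b g 1 aN sg vg).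
  by rewrite wal -[X in _ - X](mulr_natr _ 2) (pcharf0 K2) mulr0 !subrr.
have DgB : Dx al g B = 1.
  rewrite /Dx (bigD1 k) //= gB mulr1 big1 ?addr0 => [|j /andP[Bj jk]].
    rewrite !ffunE eqxx subn1 (_ : (al k - (B k).-1)%N = (al k - B k).+1).
      by rewrite -natr1 alB // add0r.
    by have /xleP/(_ k) := Ba; lia.
  rewrite lg ?mulr0 // -(ltn_add2r (N ^ k)) cB -(code_sub N Bj) ltn_add2l.
  rewrite ltn_exp2l // ltn_neqAle val_eqE jk leqNgt.
  by apply: contraTN Bj => /km ->.
have DgC C : C != B -> (code N B <= code N C)%N -> Dx al g C = 0.
  move=> CB le; apply/eqP; apply: contraT => DC.
  have CN : C \in box n N by have /andP[Ca _] := sDg _ DC; apply: box_le aN.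
  case/eqP: DC; rewrite /Dx big1 // => j Cj; have cC := code_sub N Cj.
  case: (eqVneq (g (xsub C (xunit j))) 0) => [->|gC]; first by rewrite mulr0.
  have le' : (code N (xsub C (xunit j)) <= code N B')%N.
    by rewrite leqNgt; apply: contra gC => /lg->.
  have kj : (k <= j)%N.
    rewrite -(leq_exp2l _ _ N1) -(leq_add2l (code N B')) cB; apply: leq_trans le _.
    by rewrite -cC leq_add2r.
  case: (ltngtP k j) kj => // [kj|/val_inj kj] _; last first.
    case/eqP: CB; apply: (code_inj CN BN); subst j; apply/eqP.
    by rewrite eqn_leq le andbT -cC -cB leq_add2r.
  (* For [j > k] the source monomial is too small to contain [y_j], so the factor in [Dx] is [al j],
     which is zero in [K] by [alB]. *)
  have Bk1 : (code N B < N ^ k.+1)%N.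
    apply: leq_ltn_trans (code_low k.+1 (ltnW N1) BN).
    rewrite /code [X in (_ <= X)%N]big_mkcond; apply: leq_sum => l _ /=.
    by case: (ltnP l k.+1) => // kl; rewrite km.
  have C0 : xsub C (xunit j) j = 0%N.
    apply/eqP; rewrite -leqn0 leqNgt; apply/negP => /(code_ge N) h.
    have cle : (code N B' <= code N B)%N by rewrite -cB leq_addr.
    have := leq_ltn_trans (leq_trans h (leq_trans le' cle)) Bk1.
    by rewrite ltn_exp2l // ltnS leqNgt kj.
  by rewrite C0 subn0; have := alB j (ltnW kj); rewrite (km _ kj) subn0 => ->; rewrite mul0r.
pose f' C := f C + - f B * Dx al g C.
have [psi [sp vp dp]] : exists psi, [/\ supp al b psi, shift_inv N b psi & forall B, f' B = Dx al psi B].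
  apply: IH.
  - exact: supp_lin.
  - exact: shift_inv_lin.
  - by move=> C; rewrite Dx_lin df (Dx_Dx0 K2 aN sg) mulr0 addr0.
  move=> C f'C; suff h : (code N C < code N B)%N by apply: leq_trans h _; rewrite -ltnS mf.
  have CN : C \in box n N.
    by have /andP[Ca _] := supp_lin (c := - f B) sf sDg f'C; apply: box_le aN.
  rewrite ltnNge; apply: contra f'C => le; rewrite /f'.
  case: (eqVneq C B) => [->|CB]; first by rewrite DgB mulr1 subrr.
  rewrite (DgC C CB le) mulr0 addr0; apply/eqP/lB; rewrite ltn_neqAle le andbT.
  by apply: contra CB => /eqP E; apply/eqP/(code_inj CN BN).
exists (fun C => psi C + f B * g C); split.
- exact: supp_lin.
- exact: shift_inv_lin.
by move=> C; rewrite Dx_lin -dp /f' mulNr subrK.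
Qed.

End Exactness.

(** * Exactness of the dual Weyl complex for two variables *)

Section TwoVariables.
Local Open Scope ring_scope.
Variable K : fieldType.
Local Notation X := {ffun 'I_2 -> nat}.
Implicit Types (B al z : X) (f g : X -> K) (N b t : nat).

(** Since [t!] is prime to [p], the question is whether one of the [t] consecutive factors
    [M, M - 1, ..., M - t + 1] is a multiple of [p]. *)
Lemma dvdn_bin p M t : prime p -> (t < p)%N -> (p %| 'C(M, t))%N = (M %% p < t)%N.
Proof.
move=> pp tp; have p0 := prime_gt0 pp; have [Mt|tM] := ltnP M t.
  by rewrite bin_small // dvdn0 modn_small ?Mt // (ltn_trans Mt).
have cp : coprime p t`! .
  by rewrite coprime_sym; elim: t tp {tM} => [|t IH] tp; rewrite ?coprime1n //
    factS coprimeMl IH ?(ltnW tp) // andbT coprime_sym prime_coprime // gtnNdvd.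
rewrite -(Gauss_dvdl _ cp) bin_ffact ffact_prod.
apply/idP/idP => [|lt].
  rewrite Euclid_dvd_prod // big_orE => /existsP[i /= dv].
  have : (M = i %[mod p])%N.
    by apply/eqP; rewrite eqn_mod_dvd // (leq_trans (ltnW (ltn_ord i)) tM).
  by move->; rewrite modn_small // (ltn_trans (ltn_ord i)).
rewrite (bigD1 (Ordinal lt)) //=; apply: dvdn_mulr.
by rewrite {1}(divn_eq M p) addnK dvdn_mull.
Qed.

(** The only possible second row of a standard tableau in two letters: all its entries are the
    larger letter. *)
Definition xlast b : X := [ffun j : 'I_2 => if j == ord0 then 0%N else b].

Lemma wt2 B : wt B = (B ord0 + B ord_max)%N.
Proof. by rewrite /wt big_ord_recr big_ord1 /=; congr (B _ + B _)%N; apply: val_inj. Qed.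

Lemma ord2P (j : 'I_2) : j = ord0 \/ j = ord_max.
Proof. by case: j => -[|[|//]] h; [left|right]; apply: val_inj. Qed.

Lemma xlastP B : B ord0 = 0%N -> B = xlast (wt B).
Proof.
move=> B0; apply/ffunP => j; rewrite ffunE wt2 B0.
by case: (ord2P j) => ->.
Qed.

Lemma wt_xlast b : wt (xlast b) = b.
Proof. by rewrite wt2 !ffunE. Qed.

Lemma xlast_le b al : xle (xlast b) al = (b <= al ord_max)%N.
Proof.
apply/xleP/idP => [/(_ ord_max)|h j]; first by rewrite ffunE.
by rewrite ffunE; case: (ord2P j) => ->.
Qed.

Lemma standard_xlast al b : (b <= al ord0)%N -> standard al (xlast b).
Proof.
move=> h k; case: (ord2P k) => ->.
  rewrite big1 // => j; rewrite leqn0 => /eqP j0.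
  by rewrite ffunE (_ : j == ord0) //; apply/eqP/val_inj.
apply: leq_trans (_ : al ord0 - xlast b ord0 <= _)%N; last by rewrite (bigD1 ord0) //= leq_addr.
rewrite ffunE subn0; apply: leq_trans h.
by rewrite -[X in (_ <= X)%N]wt_xlast /wt [X in (X <= _)%N]big_mkcond; apply: leq_sum => j _; case: ifP.
Qed.

(** Standardness at the first letter forces the leading exponent to be [xlast b]. Hence an invariant
    is determined by this one coefficient, and exactness reduces to comparing scalars. *)
Lemma xlast_leads N al b f B : al \in box 2 N -> supp al b f -> shift_inv N b f ->
  f B != 0 -> f (xlast b) != 0 /\ (b <= al ord0)%N.
Proof.
move=> aN sf vf fB; have [C fC lC] := leads_exists aN sf fB.
have st := leads_standard aN sf vf fC lC; have /andP[Ca /eqP wC] := sf _ fC.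
have C0 : C ord0 = 0%N.
  by have := st ord0; rewrite [X in (_ <= X)%N]big1 // leqn0 sum_ord_leq addn_eq0 => /andP[/eqP].
split; first by rewrite -wC -xlastP.
have := st ord_max; rewrite sum_ord_leq.
have e (F : 'I_2 -> nat) : (\sum_(j < 2 | (j < (ord_max : 'I_2))%N) F j = F ord0)%N.
  by rewrite (bigD1 ord0) //= big1 ?addn0 // => -[[|[|//]] h] //= /andP[].
by rewrite !e C0 addn0 subn0 -wC wt2 C0.
Qed.

Lemma Dt_xlast N al b t f : al \in box 2 N -> supp al b f ->
  Dt N al t f (xlast (b + t)) = 'C(al ord_max - b, t)%:R * f (xlast b).
Proof.
move=> aN sf.
case: (leqP (b + t) (al ord_max)) => [le|lt]; last first.
  rewrite (supp0 (supp_Dt (N := N) (t := t) sf)); last by rewrite xlast_le leqNgt lt.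
  case: (leqP b (al ord_max)) => lb; first by rewrite bin_small ?mul0r //; lia.
  by rewrite (supp0 sf) ?mulr0 // xlast_le leqNgt lb.
have tN : xlast t \in box 2 N by apply: box_le aN; rewrite xlast_le; lia.
rewrite /Dt -big_filter.
have -> : [seq z <- box 2 N | xle z (xlast (b + t)) & wt z == t] = [:: xlast t].
  apply: perm_small_eq => //; apply: uniq_perm; rewrite ?filter_uniq ?box_uniq // => z.
  rewrite mem_filter inE; apply/idP/eqP => [/andP[/andP[/xleP/(_ ord0)]]|->].
    by rewrite ffunE leqn0 => /eqP/xlastP E /eqP wz _; rewrite -wz.
  by rewrite tN wt_xlast eqxx xlast_le ffunE /= leq_addl.
rewrite big_seq1; have -> : xsub (xlast (b + t)) (xlast t) = xlast b.
  by apply/ffunP => j; rewrite !ffunE; case: ifP; rewrite ?addnK.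
congr (_%:R * _); rewrite /xbin big_ord_recr big_ord1 /= !ffunE /= bin0 mul1n.
by congr 'C(al _ - _, _); apply: val_inj.
Qed.

Lemma Dt_exact_two p N al b t f : p \in [pchar K] -> (0 < t < p)%N -> al \in box 2 N ->
  (wt al)%:R - b%:R *+ 2 = t%:R - 1 :> K ->
  supp al (b + t) f -> shift_inv N (b + t) f -> (forall B, Dt N al (p - t) f B = 0) ->
  exists psi, [/\ supp al b psi, shift_inv N b psi & forall B, f B = Dt N al t psi B].
Proof.
move=> pK /andP[t0 tp] aN m sf vf df; have pp := pcharf_prime pK.
have s0 : supp al b (fun _ : X => 0 : K) by move=> B; rewrite eqxx.
have v0 : shift_inv N b (fun _ : X => 0 : K).
  by move=> T _; rewrite /pairing big1 // => B _; rewrite mulr0.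
case: (eqVneq (f (xlast (b + t))) 0) => [f0|f0].
  exists (fun=> 0); split => // B.
  rewrite /Dt big1 => [|z _]; last by rewrite mulr0.
  apply/eqP; apply: contraT => /(xlast_leads aN sf vf)[].
  by rewrite f0 eqxx.
have [_ bt0] := xlast_leads aN sf vf f0.
have /andP[] := sf _ f0; rewrite xlast_le => bt1 _.
have st : standard al (xlast b) by apply: standard_xlast; lia.
have ble : xle (xlast b) al by rewrite xlast_le; lia.
have [g [sg vg gB lg]] := standard_exists K aN ble (wt_xlast b) st.
pose c : K := 'C(al ord_max - b, t)%:R.
have c0 : c != 0.
  (* The cocycle condition says that [al ord_max - (b + t)] has residue less than [p - t] modulo
     [p]. Adding [t] then produces no carry, so [al ord_max - b] has residue at least [t] and the
     binomial [c] is nonzero. *)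
  have := df (xlast (b + t + (p - t))); rewrite Dt_xlast //.
  move/eqP; rewrite mulf_eq0 (negPf f0) orbF -(dvdn_pcharf pK) dvdn_bin //; last by lia.
  move=> h; rewrite /c -(dvdn_pcharf pK) dvdn_bin // -leqNgt.
  have -> : (al ord_max - b = t + (al ord_max - (b + t)))%N by lia.
  by rewrite -modnDmr modn_small ?leq_addr //; lia.
pose e := f (xlast (b + t)) / c.
exists (fun B => 0 + e * g B); split.
- exact: supp_lin.
- exact: shift_inv_lin.
move=> B; rewrite Dt_lin {1}/Dt big1 ?add0r => [|z _]; last by rewrite mulr0.
pose f' B := f B + - e * Dt N al t g B.
have sf' : supp al (b + t) f' by apply: supp_lin => //; apply: supp_Dt.
have vf' : shift_inv N (b + t) f'.
  by apply: shift_inv_lin => //; apply: shift_inv_Dt pK tp aN sg vg m.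
suff : f' B = 0 by rewrite /f' mulNr => /eqP; rewrite subr_eq0 => /eqP.
apply/eqP; apply: contraT => /(xlast_leads aN sf' vf')[].
by rewrite /f' (Dt_xlast t aN sg) gB mulr1 -/c mulNr divfK // subrr eqxx.
Qed.

End TwoVariables.

Section ExactnessBoth.
Local Open Scope ring_scope.

Lemma Dt_exact (K : fieldType) n p N (al : {ffun 'I_n -> nat}) b t (f : {ffun 'I_n -> nat} -> K) :
  p \in [pchar K] -> (p = 2 \/ n = 2)%N -> (0 < t < p)%N -> al \in box n N ->
  (wt al)%:R - b%:R *+ 2 = t%:R - 1 :> K ->
  supp al (b + t) f -> shift_inv N (b + t) f -> (forall B, Dt N al (p - t) f B = 0) ->
  exists psi, [/\ supp al b psi, shift_inv N b psi & forall B, f B = Dt N al t psi B].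
Proof.
move=> pK [p2|n2] tp aN m sf vf df; last first.
  by subst n; apply: (Dt_exact_two pK tp aN m sf vf df).
subst p; have t1 : t = 1%N by lia.
subst t; have wal : (wt al)%:R = 0 :> K.
  by move: m; rewrite -[X in _ - X](mulr_natr _ 2) (pcharf0 pK) mulr0 subr0 subrr.
rewrite addn1 in sf vf *.
have [|psi [sp vp dp]] := Dx_exact_char2 pK aN wal sf vf.
  by move=> B; rewrite -(Dt1 aN sf) df.
by exists psi; split=> // B; rewrite (Dt1 aN sp).
Qed.

End ExactnessBoth.

(** * Functionals as column vectors *)

Section Columns.
Local Open Scope ring_scope.
Variable K : fieldType.

Definition colf (T : finType) (phi : T -> K) : 'cV[K]_#|{: T}| :=
  \col_i phi (enum_val i).

Lemma colf_rank (T : finType) (c : 'cV[K]_#|{: T}|) : colf (fun t => c (enum_rank t) 0) = c.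
Proof. by apply/colP => i; rewrite mxE enum_valK. Qed.

Lemma eq_colf (T : finType) (phi psi : T -> K) : phi =1 psi -> colf phi = colf psi.
Proof. by move=> E; apply/colP => i; rewrite !mxE E. Qed.

Lemma colf_eq0 (T : finType) (phi : T -> K) : colf phi = 0 -> forall t, phi t = 0.
Proof. by move=> /colP E t; have := E (enum_rank t); rewrite !mxE enum_rankK. Qed.

Lemma sum_enum_val (T : finType) (F : T -> K) :
  \sum_(i < #|{: T}|) F (enum_val i) = \sum_t F t.
Proof.
by rewrite [RHS](reindex (@enum_val T {: T})) //=; apply: onW_bij; apply: enum_val_bij.
Qed.

Lemma mxc_colf (S T : finType) (F : S -> T -> K) (phi : T -> K) :
  mxc F *m colf phi = colf (fun s => \sum_t F s t * phi t).
Proof.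
apply/colP => i; rewrite !mxE -[RHS]sum_enum_val; apply: eq_bigr => j _.
by rewrite !mxE.
Qed.

Lemma submx_mul0 m1 m2 m n (A : 'M[K]_(m1, m)) (B : 'M[K]_(m2, m)) (C : 'M[K]_(m, n)) :
  (A <= B)%MS -> B *m C = 0 -> A *m C = 0.
Proof. by move=> /submxP[D ->] E; rewrite -mulmxA E mulmx0. Qed.

(** Row spaces are compared through the functionals vanishing on the larger one; the columns of its
    cokernel matrix suffice. *)
Lemma submx_cols m1 m2 m (A : 'M[K]_(m1, m)) (S : 'M[K]_(m2, m)) :
  (forall c : 'cV_m, S *m c = 0 -> A *m c = 0) -> (A <= S)%MS.
Proof.
move=> h; rewrite submxE; apply/eqP/matrixP => i j.
have /h/colP/(_ i) : S *m col j (cokermx S) = 0 by rewrite colE mulmxA mulmx_coker mul0mx.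
by rewrite colE mulmxA -colE !mxE.
Qed.

Lemma row_full_cols m q (M : 'M[K]_(m, q)) :
  (forall c : 'cV_q, M *m c = 0 -> c = 0) -> row_full M.
Proof. by move=> h; rewrite -sub1mx; apply: submx_cols => c /h ->; rewrite mulmx0. Qed.

Lemma mxc_mul (S T U : finType) (F : S -> T -> K) (G : T -> U -> K) :
  mxc F *m mxc G = mxc (fun s u => \sum_t F s t * G t u).
Proof.
apply/matrixP => i j; rewrite !mxE -[RHS]sum_enum_val; apply: eq_bigr => k _.
by rewrite !mxE.
Qed.

End Columns.

(** * Vanishing of homology in terms of functionals *)

Section Duality.
Local Open Scope ring_scope.
Variables (K : fieldType) (X : eqType) (B : nat -> finType)
  (v : forall a, B a -> X) (mul com : X -> X -> X -> K).

Lemma Rel_mul0 a b n (C : 'M[K]_(_, n)) :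
  (forall l, (l < b)%N -> boxm v mul com a b l *m C = 0) <-> Rel v mul com a b *m C = 0.
Proof.
split=> [h|h l lb]; last first.
  apply: submx_mul0 h; apply: submx_trans (_ : (<<boxm v mul com a b l>> <= _)%MS).
    by rewrite genmxE.
  exact: (sumsmx_sup (Ordinal lb)).
apply/sub_kermxP/sumsmx_subP => l _; rewrite genmxE; apply/sub_kermxP; exact: h.
Qed.

Variables (r p d : nat).
Notation nz := (nz r p d).
Notation deg := (deg r p d).
Notation dlt := (dlt v mul com r p d).
Notation Usp := (Usp v mul com r p d).
Notation Zsp := (Zsp v mul com r p d).
Notation Hden := (Hden v mul com r p d).

Lemma Zsp_mul_dlt k n (e : 'M[K]_(_, n)) : nz k -> Usp k.-1 *m e = 0 ->
  Zsp k *m (dlt k *m e) = 0.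
Proof.
move=> nzk Ue; rewrite /Zsp nzk mulmxA; apply: submx_mul0 Ue.
by rewrite submxE -mulmxA mulmx_ker.
Qed.

Lemma Hden_mul0 k n (c : 'M[K]_(_, n)) : Hden k *m c = 0 ->
  dlt k.+1 *m c = 0 /\ Usp k *m c = 0.
Proof.
move=> h; split; apply: submx_mul0 h.
  by apply: submx_trans (addsmxSl _ _); rewrite genmxE.
exact: addsmxSr.
Qed.

(** A functional killing boundaries and relations has to kill the cycles. It does if it is the
    pullback along [dlt k] of a functional killing the relations one degree lower, as cycles are
    sent into those relations. *)
Lemma vanishes_dual k :
  (nz k -> forall phi : Wk B r p d k -> K,
    (forall l, (l < (deg k).2)%N -> boxm v mul com (deg k).1 (deg k).2 l *m colf phi = 0) ->
    (nz k.+1 -> dmap v mul com (deg k.+1).1 (deg k.+1).2 (deg k).1 (deg k).2 (tk p d k.+1)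
       *m colf phi = 0) ->
    exists2 e : 'cV_#|{: Wk B r p d k.-1}|, Usp k.-1 *m e = 0 & colf phi = dlt k *m e) ->
  homology_vanishes v mul com r p d k.
Proof.
move=> H; apply: submx_cols => c /Hden_mul0[dc Uc].
case: (boolP (nz k)) => [nzk|nnz]; last by rewrite /Zsp (negPf nnz) mul0mx.
move: dc Uc; rewrite -(colf_rank c) => dc Uc.
have [||e Ue ->] := H nzk (fun t => c (enum_rank t) 0); last exact: Zsp_mul_dlt.
  by apply/Rel_mul0.
by move=> nzS; move: dc; rewrite /dlt nzS nzk.
Qed.

End Duality.

(** * Arithmetic of the bidegrees *)

Section Degrees.
Variables r p d : nat.
Hypothesis dp : 0 < d < p.
Notation deg := (deg r p d).
Notation nz := (nz r p d).

Lemma deg1E k : (deg k).1 = r - (deg k).2.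
Proof. by rewrite /deg; case: odd => //=; rewrite subnDA. Qed.

Lemma deg2S k : (deg k.+1).2 = (deg k).2 + tk p d k.+1.
Proof.
rewrite /deg /tk /= uphalf_half; case: (odd k) => /=; last by [].
by rewrite add1n mulSn; lia.
Qed.

Lemma tkS k : tk p d k.+1 = p - tk p d k.
Proof. by rewrite /tk /=; case: odd => /=; lia. Qed.

Lemma tk_bnd k : 0 < tk p d k < p.
Proof. by rewrite /tk; case: odd; lia. Qed.

Lemma nzP k : 0 < r -> nz k = ((deg k).2 + (deg k).2 <= r).
Proof. by move=> r0; rewrite /nz deg1E; lia. Qed.

(** This is the numerical hypothesis of [shift_inv_Dt] at every spot. Modulo [p], [r] is [d - 1] and
    the second degree is 0 or [d] according to parity, so the difference is [d - 1] or
    [(p - d) - 1]. *)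
Lemma deg_congr (K : fieldType) k : p \in [pchar K]%R -> r.+1 = d %[mod p] ->
  (r%:R - (deg k).2%:R *+ 2 = (tk p d k.+1)%:R - 1 :> K)%R.
Proof.
move=> pK rd.
have rK : (r%:R = d%:R - 1 :> K)%R.
  apply/eqP; rewrite eq_sym subr_eq natr1 eq_sym.
  have E m : (m%:R = (m %% p)%:R :> K)%R.
    by rewrite {1}(divn_eq m p) natrD natrM (pcharf0 pK) mulr0 add0r.
  by rewrite E rd -E.
have pE m : ((m * p)%:R = 0 :> K)%R by rewrite natrM (pcharf0 pK) mulr0.
rewrite /deg /tk /=; case: (odd k) => /=; last by rewrite pE mul0rn subr0.
rewrite natrD pE add0r natrB; last by lia.
by rewrite (pcharf0 pK) rK; ring.
Qed.

End Degrees.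

(** * Translation of the Weyl complex into polynomials *)

Section WeylBridge.
Local Open Scope ring_scope.
Variables (K : fieldType) (n : nat).
Local Notation X := {ffun 'I_n -> nat}.
Implicit Types (al C T : X) (a b t N : nat).

Lemma dv_inj a : injective (@dv n a).
Proof.
move=> x y /ffunP E; apply/val_inj/ffunP => i; apply: val_inj.
by have := E i; rewrite !ffunE.
Qed.

Lemma wt_dv a (x : DB n a) : wt (dv x) = a.
Proof.
rewrite -[RHS](eqP (valP x)); apply: eq_bigr => i _; by rewrite ffunE.
Qed.

Lemma dv_ex a (x : X) : wt x = a -> exists u : DB n a, dv u = x.
Proof.
move=> wx; have lt i : (x i < a.+1)%N by rewrite ltnS -wx wt_ge.
have h : (\sum_i ([ffun i => Ordinal (lt i)] i : nat) == a)%N.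
  by rewrite -[X in _ == X]wx; apply/eqP/eq_bigr => i _; rewrite ffunE.
by exists (exist (fun e : {ffun 'I_n -> 'I_a.+1} => \sum_i (e i : nat) == a)%N _ h); apply/ffunP => i; rewrite !ffunE.
Qed.

Lemma sum_DB N t (H : X -> K) : (t < N)%N ->
  \sum_(z : DB n t) H (dv z) = \sum_(z <- box n N | wt z == t) H z.
Proof.
move=> tN; transitivity (\sum_(z <- [seq dv u | u : DB n t]) if wt z == t then H z else 0).
  by rewrite big_image /=; apply: eq_bigr => u _; rewrite wt_dv eqxx.
rewrite [RHS]big_mkcond; apply: sum_support; last 1 first.
- move=> z; case: (wt z =P t) => [wz _|_]; last by rewrite eqxx.
  have [u uz] := dv_ex wz; rewrite -{1}uz image_f //=.
  by apply: wt_box; rewrite wz.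
- by rewrite map_inj_uniq ?enum_uniq //; apply: dv_inj.
exact: box_uniq.
Qed.

(** The component of multidegree [al]. All maps of the complex preserve multidegrees, so functionals
    are treated one component at a time. *)
Definition slice a b (phi : DB n a * DB n b -> K) al : X -> K := fun C =>
  if xle C al then
    \sum_(w : DB n a * DB n b | (dv w.1 == xsub al C) && (dv w.2 == C)) phi w
  else 0.

Lemma slice_dv a b (phi : DB n a * DB n b -> K) u w :
  slice phi (xadd (dv u) (dv w)) (dv w) = phi (u, w).
Proof.
rewrite /slice xle_addr xaddK (big_pred1 (u, w)) // => -[u' w'] /=.
by rewrite !(inj_eq (@dv_inj _)).
Qed.

Lemma supp_slice a b (phi : DB n a * DB n b -> K) al : supp al b (slice phi al).
Proof.
move=> C; rewrite /slice; case: ifP; rewrite ?eqxx // => le; apply: contraR => nw.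
rewrite big1 // => w /andP[_ /eqP E]; case/negP: nw.
by rewrite -E wt_dv eqxx.
Qed.

Lemma sum_slice a b (phi : DB n a * DB n b -> K) al N (G : X -> K) : al \in box n N ->
  \sum_(C <- box n N) G C * slice phi al C =
  \sum_(w | xadd (dv w.1) (dv w.2) == al) G (dv w.2) * phi w.
Proof.
move=> aN.
transitivity (\sum_(C <- box n N) \sum_w
  (if [&& xle C al, dv w.1 == xsub al C & dv w.2 == C] then G (dv w.2) * phi w else 0)).
  apply: eq_bigr => C _; rewrite /slice; case: ifP => le; last by rewrite mulr0 big1.
  rewrite mulr_sumr [LHS]big_mkcond; apply: eq_bigr => w _ /=.
  by case: ifP => // /andP[_ /eqP->].
rewrite exchange_big [RHS]big_mkcond; apply: eq_bigr => w _ /=.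
have [E|nE] := eqVneq (xadd (dv w.1) (dv w.2)) al; last first.
  rewrite big1 // => C _; case: ifP => // /and3P[le /eqP E1 /eqP E2].
  by rewrite E1 E2 xsubK ?eqxx in nE.
have le : xle (dv w.2) al by rewrite -E xle_addr.
have wN : dv w.2 \in box n N by apply: box_le aN.
rewrite (bigD1_seq (dv w.2)) ?box_uniq //= le -{1}E xaddK !eqxx /= big1 ?addr0 // => C CE.
by case: ifP => // /and3P[_ _ /eqP E2]; rewrite E2 eqxx in CE.
Qed.

Lemma xbin_sub C T : xle T C -> xbin C (xsub C T) = xbin C T.
Proof. by move=> /xleP le; apply: eq_bigr => i _; rewrite ffunE bin_sub. Qed.

(** At a pair with second exponent [C] the only contributing [z] is [C - T], and the product of [z]
    and [T] carries the coefficient [xbin C T]. So each box relation is one coefficient of the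
    substitution [y -> y + x]. *)
Lemma boxm_pairing N a b l (phi : DB n a * DB n b -> K)
    (S : DB n (a + b - l)) (T : DB n l) :
  (l <= b)%N -> xadd (dv S) (dv T) \in box n N ->
  \sum_w (\sum_(z : DB n (b - l)) Dcom K (dv S) (dv w.1) (dv z) * Dmul K (dv z) (dv T) (dv w.2))
     * phi w =
  pairing N (dv T) (slice phi (xadd (dv S) (dv T))).
Proof.
move=> lb aN; rewrite /pairing sum_slice // [RHS]big_mkcond; apply: eq_bigr => w _ /=.
set A := dv w.1; set C := dv w.2.
have [le|nle] := boolP (xle (dv T) C); last first.
  rewrite big1 => [|z _]; last first.
    rewrite /Dmul; case: eqP => [E|_]; last by rewrite mulr0.
    by case/negP: nle; rewrite E; apply/xleP => i; rewrite [X in (_ <= X)%N]ffunE leq_addl.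
  rewrite mul0r (_ : xbin C (dv T) = 0%N) ?mul0r; first by case: ifP.
  by apply/eqP; rewrite -[_ == _]negbK xbin_neq0.
have wz : wt (xsub C (dv T)) = (b - l)%N by rewrite wt_sub // !wt_dv.
have [z0 z0E] := dv_ex wz.
rewrite (bigD1 z0) //= big1 ?addr0 => [|z zz0]; last first.
  rewrite /Dmul; case: eqP => [E|_]; last by rewrite mulr0.
  case/eqP: zz0; apply: dv_inj; rewrite z0E E; apply/esym.
  by apply/ffunP => i; rewrite !ffunE addnK.
rewrite /Dcom /Dmul z0E.
have -> : C == [ffun i => (xsub C (dv T) i + dv T i)%N].
  by apply/eqP; rewrite -[LHS](xsubK le).
have -> : (\prod_i 'C(C i, xsub C (dv T) i))%N = xbin C (dv T) by rewrite -xbin_sub.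
have -> : (dv S == [ffun i => (A i + xsub C (dv T) i)%N]) = (xadd A C == xadd (dv S) (dv T)).
  apply/eqP/eqP => [->|E].
    by rewrite -[in LHS](xsubK le) xaddA.
  apply/ffunP => i; have /ffunP/(_ i) := E; have /xleP/(_ i) := le; rewrite !ffunE; lia.
by case: ifP => _; rewrite ?mul1r ?mul0r.
Qed.

Lemma boxm_shift_inv N a b (phi : DB n a * DB n b -> K) al :
  al \in box n N -> wt al = (a + b)%N ->
  (forall l, (l < b)%N -> boxm (@dv n) (@Dmul K n) (@Dcom K n) a b l *m colf phi = 0) ->
  shift_inv N b (slice phi al).
Proof.
move=> aN wal h T Tb.
have [le|nle] := boolP (xle T al); last first.
  rewrite /pairing big1 // => C _.
  case: (eqVneq (slice phi al C) 0) => [->|/supp_slice/andP[Ca _]]; first by rewrite mulr0.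
  rewrite (_ : xbin C T = 0%N) ?mul0r //; apply/eqP; apply: contraNT nle.
  by rewrite xbin_neq0 => /xle_trans; apply.
have [T' TE] := @dv_ex (wt T) T erefl.
have wS : wt (xsub al T) = (a + b - wt T)%N by rewrite wt_sub // wal.
have [S SE] := dv_ex wS.
have := h _ Tb; rewrite mxc_colf => /colf_eq0/(_ (S, T')) /=.
rewrite (boxm_pairing (N := N)) ?(ltnW Tb) ?TE ?SE ?xsubK //.
Qed.

(** Conversely to slicing, a functional is assembled from a family of polynomials indexed by
    multidegrees. *)
Lemma slice_family a b (psi : X -> X -> K) al C : wt al = (a + b)%N -> supp al b (psi al) ->
  slice (fun w : DB n a * DB n b => psi (xadd (dv w.1) (dv w.2)) (dv w.2)) al C = psi al C.
Proof.
move=> wal sp; case: (eqVneq (psi al C) 0) => [p0|/sp/andP[Ca /eqP wC]].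
  rewrite /slice; case: ifP => // Ca; rewrite big1 ?p0 // => w /andP[/eqP -> /eqP ->].
  by rewrite xsubK.
have [w wE] := dv_ex wC.
have wA : wt (xsub al C) = a by rewrite wt_sub // wal wC addnK.
have [u uE] := dv_ex wA.
have alE : al = xadd (dv u) (dv w) by rewrite uE wE xsubK.
by rewrite alE -wE slice_dv.
Qed.

Lemma shift_inv_boxm a b (psi : X -> X -> K) N : (a + b < N)%N ->
  (forall al, wt al = (a + b)%N -> supp al b (psi al) /\ shift_inv N b (psi al)) ->
  forall l, (l < b)%N -> boxm (@dv n) (@Dmul K n) (@Dcom K n) a b l *m
    colf (fun w : DB n a * DB n b => psi (xadd (dv w.1) (dv w.2)) (dv w.2)) = 0.
Proof.
move=> abN h l lb; rewrite mxc_colf; apply/colP => i; rewrite !mxE.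
case: (enum_val i) => S T /=.
have wal : wt (xadd (dv S) (dv T)) = (a + b)%N by rewrite wt_add !wt_dv subnK //; lia.
rewrite (boxm_pairing (N := N)) ?(ltnW lb) //; last by rewrite wt_box ?wal.
have [sp vp] := h _ wal; rewrite -[RHS](vp (dv T)) ?wt_dv //.
by apply: eq_bigr => C _; rewrite slice_family.
Qed.

(** Splitting [z] off [C] costs no coefficient, while multiplying it into [A] costs the binomial of
    [A + z] over [z]: the coefficient with which the divided power of [E] moves [z] from [x] to
    [y]. *)
Lemma dmap_Dt N a b a' b' t (psi : DB n a' * DB n b' -> K) (A : DB n a) (C : DB n b) :
  (a + b < N)%N ->
  b = (b' + t)%N ->
  \sum_w (\sum_(z : DB n t) Dcom K (dv C) (dv z) (dv w.2) * Dmul K (dv A) (dv z) (dv w.1))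
     * psi w =
  Dt N (xadd (dv A) (dv C)) t (slice psi (xadd (dv A) (dv C))) (dv C).
Proof.
move=> abN bE; under eq_bigr do rewrite mulr_suml.
rewrite exchange_big /=; set al := xadd _ _.
transitivity (\sum_(z <- box n N | wt z == t)
   if xle z (dv C) then (xbin (xsub al (xsub (dv C) z)) z)%:R * slice psi al (xsub (dv C) z) else 0);
  last by rewrite /Dt [RHS]big_mkcondl; apply: eq_bigr.
rewrite -sum_DB; last by lia.
apply: eq_bigr => z _; set c := dv C; set a0 := dv A.
have [le|nle] := boolP (xle (dv z) c); last first.
  rewrite big1 // => w _; rewrite /Dcom; case: eqP => [E|_]; last by rewrite !mul0r.
  by case/negP: nle; rewrite E; apply/xleP => i; rewrite [X in (_ <= X)%N]ffunE leq_addr.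
have leal : xle (xsub c (dv z)) al.
  by apply/xleP => i; rewrite !ffunE; lia.
have aE : xsub al (xsub c (dv z)) = xadd a0 (dv z).
  by apply/ffunP => i; have /xleP/(_ i) := le; rewrite !ffunE; lia.
rewrite /slice leal mulr_sumr [RHS]big_mkcond; apply: eq_bigr => w _.
rewrite aE /Dcom /Dmul.
have -> : (c == [ffun i => (dv z i + dv w.2 i)%N]) = (dv w.2 == xsub c (dv z)).
  apply/eqP/eqP => [->|->]; apply/ffunP => i; rewrite !ffunE ?addKn // subnKC //.
  by have /xleP/(_ i) := le; rewrite !ffunE.
rewrite -[[ffun i => _]]/(xadd a0 (dv z)).
case: eqP => [_|_] /=; case: eqP => [E|_] /=; rewrite ?mul1r ?mul0r // E.
congr (_%:R * _); rewrite -/(xbin (xadd a0 (dv z)) a0) -xbin_sub.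
  by rewrite xaddC xaddK.
by rewrite xaddC xle_addr.
Qed.

End WeylBridge.

(** * Exactness of the Weyl complex in positive degrees *)

Section WeylExact.
Local Open Scope ring_scope.
Variables (K : fieldType) (n p r d : nat).
Local Notation X := {ffun 'I_n -> nat}.
Hypotheses (pK : p \in [pchar K]) (dp : (0 < d < p)%N) (r0 : (0 < r)%N)
  (rd : r.+1 = d %[mod p]) (pn : (p = 2 \/ n = 2)%N).
Notation deg := (deg r p d).

Lemma eq_Dt N (al : X) t (f g : X -> K) : f =1 g -> Dt N al t f =1 Dt N al t g.
Proof. by move=> fg B; apply: eq_bigr => z _; rewrite fg. Qed.

Lemma Kcx_exact k : (0 < k)%N -> Kcx_vanishes K n r p d k.
Proof.
case: k => // k _; apply: vanishes_dual => nzk phi hbox hd.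
have nzk' : nz r p d k by move: nzk; rewrite !nzP // deg2S //; lia.
have le1 : ((deg k.+1).2 + (deg k.+1).2 <= r)%N by rewrite -nzP.
have bE : (deg k.+1).2 = ((deg k).2 + tk p d k.+1)%N by rewrite deg2S.
have a1 : ((deg k.+1).1 + (deg k.+1).2 = r)%N by rewrite deg1E; lia.
have a0 : ((deg k).1 + (deg k).2 = r)%N by rewrite deg1E; lia.
pose N := r.+1; pose t := tk p d k.+1.
have tp : (0 < t < p)%N by apply: tk_bnd.
have ex (u : DB n r) : exists psi : X -> K,
   [/\ supp (dv u) (deg k).2 psi, shift_inv N (deg k).2 psi &
       forall C, slice phi (dv u) C = Dt N (dv u) t psi C].
  set al := dv u; have wal : wt al = r by rewrite wt_dv.
  have aN : al \in box n N by apply: wt_box; rewrite wal.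
  have sf := @supp_slice K n _ _ phi al.
  have vf : shift_inv N (deg k.+1).2 (slice phi al).
    by apply: boxm_shift_inv => //; rewrite wal a1.
  apply: (@Dt_exact K n p) => //; rewrite ?wal ?(deg_congr dp k pK) -?bE // => C.
  have t'E : tk p d k.+2 = (p - t)%N by rewrite tkS.
  have sD : supp al ((deg k.+1).2 + (p - t)) (Dt N al (p - t) (slice phi al)).
    exact: supp_Dt.
  have bE' : (deg k.+2).2 = ((deg k.+1).2 + (p - t))%N by rewrite deg2S // t'E.
  (* If the next bidegree is a partition, the cocycle condition is [hd]. If not, it holds
     automatically: the divided power of an invariant is an invariant, and its [y]-degree exceeds
     half of [r], so [dominance] applies. *)
  have [nz2|nnz2] := boolP (nz r p d k.+2).
    have := nz2; rewrite nzP // => le2.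
    have a2 : ((deg k.+2).1 + (deg k.+2).2 = r)%N by rewrite deg1E; lia.
    case: (boolP (xle C al && (wt C == (deg k.+2).2))) => [/andP[Ca /eqP wC]|]; last first.
      by rewrite bE'; apply: supp0.
    have wA : wt (xsub al C) = (deg k.+2).1 by rewrite wt_sub // wal wC; lia.
    have [A AE] := dv_ex wA; have [C' CE] := dv_ex wC.
    have := hd nz2; rewrite mxc_colf => /colf_eq0/(_ (A, C')) /=.
    rewrite (dmap_Dt (N := N)) ?a2 ?ltnS //; last by rewrite bE' t'E.
    by rewrite AE CE xsubK // t'E.
  apply: (dominance aN sD); last by move: nnz2; rewrite nzP // wal -bE' -ltnNge.
  have -> : (p - t)%N = tk p d k.+2 by [].
  apply: (shift_inv_Dt pK) => //; last by rewrite wal (deg_congr dp k.+1 pK).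
  by have := tk_bnd dp k.+2; lia.
(* Preimages are chosen separately in each of the finitely many multidegrees of weight [r], then
   glued. *)
have [Psi PsiP] := fin_all_exists ex.
pose psi (al : X) : X -> K := if [pick u : DB n r | dv u == al] is Some u then Psi u else fun=> 0.
have psiP al : wt al = r -> exists2 u : DB n r, dv u = al & psi al = Psi u.
  move=> wal; rewrite /psi; case: pickP => [u /eqP uE|no]; first by exists u.
  by have [u uE] := dv_ex wal; have := no u; rewrite uE eqxx.
pose e (w : DB n (deg k).1 * DB n (deg k).2) := psi (xadd (dv w.1) (dv w.2)) (dv w.2).
exists (colf e).
  apply/Rel_mul0; apply: (@shift_inv_boxm K n _ _ psi N); rewrite a0 ?ltnS // => al wal.
  by have [u uE ->] := psiP _ wal; have [s v _] := PsiP u; rewrite -uE.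
rewrite /dlt nzk nzk' /= mxc_colf; apply: eq_colf => -[A C] /=.
rewrite (dmap_Dt (N := N)) ?a1 //.
have wal : wt (xadd (dv A) (dv C)) = r by rewrite wt_add !wt_dv.
have [u uE pE] := psiP _ wal; have [s v H] := PsiP u.
rewrite -slice_dv -uE H; apply: eq_Dt => B.
by rewrite slice_family ?uE ?pE ?a0 // -uE.
Qed.

End WeylExact.

(** * Parity of binomial and multinomial coefficients *)

Section ParityOfMultinomials.

(** Pascal's rule applied twice: the middle term [C(2n, 2k + 1)] occurs twice and drops out modulo
    2. *)
Lemma odd_bin_double n k : odd 'C(n.*2, k.*2) = odd 'C(n, k).
Proof.
elim: n k => [|n IH] [|k]; rewrite ?bin0 //.
rewrite !doubleS !binS !oddD -!doubleS !IH.
by case: (odd 'C(_.*2, k.*2.+1)); do 2 case: odd.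
Qed.

Lemma odd_bin_even n k : ~~ odd n -> odd k -> odd 'C(n, k) = false.
Proof.
case: k => // k; case: n => [|n] en ok; first by rewrite bin0n.
have := congr1 odd (mul_bin_diag n.+1 k).
by rewrite !oddM ok (negPf en) /= => <-.
Qed.

Lemma multinom_fact (s : seq nat) : multinom s * \prod_(x <- s) x`! = (sumn s)`!.
Proof.
rewrite /multinom divnK //; elim: s => [|x s IH]; first by rewrite big_nil.
rewrite big_cons /= -(@bin_fact (x + sumn s) x) ?leq_addr // addKn.
by apply: dvdn_mull; apply: dvdn_mul.
Qed.

Lemma multinom_cons x s : multinom (x :: s) = 'C(x + sumn s, x) * multinom s.
Proof.
have pos : 0 < \prod_(y <- x :: s) y`! by rewrite prodn_gt0 // => y; rewrite fact_gt0.
apply/eqP; rewrite -(eqn_pmul2r pos) multinom_fact big_cons /=.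
rewrite -(@bin_fact (x + sumn s) x) ?leq_addr // addKn -multinom_fact; apply/eqP; ring.
Qed.

Lemma odd_multinom_odd s : ~~ odd (sumn s) -> has odd s -> odd (multinom s) = false.
Proof.
elim: s => //= x s IH; rewrite multinom_cons oddM oddD; case: (boolP (odd x)) => ox /=.
  by move=> os _; rewrite odd_bin_even // oddD ox.
by move=> /IH h /h ->; rewrite andbF.
Qed.

Lemma odd_multinom_double s : odd (multinom [seq x.*2 | x <- s]) = odd (multinom s).
Proof.
elim: s => //= x s IH; rewrite !multinom_cons !oddM IH.
have -> : sumn [seq x.*2 | x <- s] = (sumn s).*2.
  by elim: s {IH} => //= y s ->; rewrite doubleD.
by rewrite -doubleD odd_bin_double.
Qed.

End ParityOfMultinomials.

(** * The action on divided powers and the Frobenius twist in characteristic 2 *)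

Section WeylH0.
Local Open Scope ring_scope.

Lemma natr_char2 (F : fieldType) (m : nat) : 2%N \in [pchar F] -> m%:R = (odd m)%:R :> F.
Proof.
by move=> F2; rewrite -[in LHS](odd_double_half m) natrD -muln2 natrM (pcharf0 F2) mulr0 addr0.
Qed.

Lemma prod_natr_odd (F : fieldType) (I : finType) (G H : I -> nat) : 2%N \in [pchar F] ->
  (forall i, odd (G i) = odd (H i)) -> (\prod_i G i)%:R = (\prod_i H i)%:R :> F.
Proof.
move=> F2 E; rewrite !natr_prod; apply: eq_bigr => i _.
by rewrite (natr_char2 (G i) F2) E -natr_char2.
Qed.

Variable n : nat.
Local Notation X := {ffun 'I_n -> nat}.
Definition xdbl (x : X) : X := [ffun i => (x i).*2].

Lemma xdbl_inj : injective xdbl.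
Proof.
move=> x y /ffunP E; apply/ffunP => i; have := E i; rewrite !ffunE; exact: double_inj.
Qed.

Lemma wt_dbl x : wt (xdbl x) = (wt x).*2.
Proof. by rewrite /wt -mul2n big_distrr; apply: eq_bigr => i _; rewrite ffunE /= mul2n. Qed.

(* Multinomial coefficients of even sums are even unless all entries are even, so only
   the doubled matrices [ka] contribute. *)
Lemma Dact_dbl (F : fieldType) m (g : 'M[F]_n) (x y : X) : 2%N \in [pchar F] -> wt y = m ->
  @Dact F n m.*2 g (xdbl x) (xdbl y) = @Dact F n m (frobmx 2 g) x y.
Proof.
move=> F2 wy.
pose P (ka : {ffun 'I_n -> {ffun 'I_n -> 'I_m.*2.+1}}) :=
  [forall i, (\sum_j (ka i j : nat) == xdbl x i)%N] &&
  [forall j, (\sum_i (ka i j : nat) == xdbl y j)%N].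
pose ev (ka : {ffun 'I_n -> {ffun 'I_n -> 'I_m.*2.+1}}) := [forall i, forall j, ~~ odd (ka i j)].
rewrite /Dact (bigID ev) /= [X in _ + X]big1 ?addr0; last first.
  move=> ka /andP[/andP[_ /forallP cols]]; rewrite negb_forall => /existsP[i].
  rewrite negb_forall => /existsP[j]; rewrite negbK => oij.
  rewrite [X in _ * X](_ : _ = 0) ?mulr0 // (bigD1 j) //= natrM.
  rewrite (natr_char2 (multinom _) F2) odd_multinom_odd ?mul0r //.
    rewrite sumnE big_map big_enum /= (eqP (cols j)) ffunE odd_double //.
  by apply/hasP; exists (ka i j : nat) => //; apply/mapP; exists i; rewrite ?mem_enum.
have dlt (k : 'I_m.+1) : (k.*2 < m.*2.+1)%N by rewrite ltnS leq_double -ltnS.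
have hlt (k : 'I_m.*2.+1) : (k./2 < m.+1)%N.
  by rewrite ltnS -[X in (_ <= X)%N]doubleK; apply: half_leq; rewrite -ltnS.
pose dbl (kb : {ffun 'I_n -> {ffun 'I_n -> 'I_m.+1}}) : {ffun 'I_n -> {ffun 'I_n -> 'I_m.*2.+1}} :=
  [ffun i => [ffun j => Ordinal (dlt (kb i j))]].
pose hlf (ka : {ffun 'I_n -> {ffun 'I_n -> 'I_m.*2.+1}}) : {ffun 'I_n -> {ffun 'I_n -> 'I_m.+1}} :=
  [ffun i => [ffun j => Ordinal (hlt (ka i j))]].
rewrite (reindex_onto dbl hlf) => [|ka /andP[_ /forallP eka]]; last first.
  apply/ffunP => i; apply/ffunP => j; apply: val_inj; rewrite !ffunE /= -[RHS]odd_double_half.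
  by have /forallP/(_ j)/negPf -> := eka i.
have dE kb i j : (dbl kb i j = (kb i j).*2 :> nat) by rewrite !ffunE.
apply: eq_big => [kb|kb _].
  have -> : hlf (dbl kb) == kb.
    by apply/eqP/ffunP => i; apply/ffunP => j; apply: val_inj; rewrite !ffunE /= ?dE ?doubleK.
  have -> : ev (dbl kb) by apply/forallP => i; apply/forallP => j; rewrite dE odd_double.
  rewrite !andbT; congr (_ && _); apply: eq_forallb => i.
    rewrite [xdbl x i]ffunE; under eq_bigr do rewrite dE -mul2n.
    by rewrite -big_distrr /= -mul2n eqn_pmul2l.
  rewrite [xdbl y i]ffunE; under eq_bigr do rewrite dE -mul2n.
  by rewrite -big_distrr /= -mul2n eqn_pmul2l.
congr (_ * _).
  by apply: eq_bigr => i _; apply: eq_bigr => j _; rewrite mxE dE -muln2 mulnC exprM.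
apply: prod_natr_odd => // j; rewrite -[RHS]odd_multinom_double -map_comp.
by congr (odd (multinom _)); apply: eq_map => i /=; rewrite dE.
Qed.

(** An odd row sum of [ka] forces an odd entry; the multinomial of its column, whose sum is even, is
    then even. *)
Lemma Dact_not_dbl (F : fieldType) a (g : 'M[F]_n) (x y : X) : 2%N \in [pchar F] ->
  (exists i, odd (x i)) -> @Dact F n a g x (xdbl y) = 0.
Proof.
move=> F2 [i0 ox]; rewrite /Dact big1 // => ka /andP[/forallP rows /forallP cols].
have [j oij] : exists j, odd (ka i0 j).
  apply/existsP; apply: contraTT ox; rewrite negb_exists => /forallP h.
  rewrite -(eqP (rows i0)); elim/big_ind: _ => // u v.
  by rewrite oddD => /negPf-> /negPf->.
rewrite [X in _ * X](_ : _ = 0) ?mulr0 // (bigD1 j) //= natrM.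
rewrite (natr_char2 (multinom _) F2) odd_multinom_odd ?mul0r //.
  by rewrite sumnE big_map big_enum /= (eqP (cols j)) ffunE odd_double.
by apply/hasP; exists (ka i0 j : nat) => //; apply/mapP; exists i0; rewrite ?mem_enum.
Qed.

Lemma Dact_deg0 (F : fieldType) (g : 'M[F]_n) (x y : X) : wt x = 0%N -> wt y = 0%N ->
  @Dact F n 0 g x y = 1.
Proof.
move=> wx wy.
have x0 i : x i = 0%N by apply/eqP; rewrite -leqn0 -wx wt_ge.
have y0 i : y i = 0%N by apply/eqP; rewrite -leqn0 -wy wt_ge.
pose k0 : {ffun 'I_n -> {ffun 'I_n -> 'I_1}} := [ffun=> [ffun=> ord0]].
have kE ka : ka = k0.
  by apply/ffunP => i; apply/ffunP => j; rewrite [RHS]ord1 ord1.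
have z (k : 'I_1) : k = 0%N :> nat by rewrite ord1.
rewrite /Dact (big_pred1 k0) => [|ka].
  rewrite big1 => [|i _]; last by rewrite big1 // => j _; rewrite z expr0.
  rewrite mul1r big1 // => j _.
  have : multinom [seq (k0 i j : nat) | i <- enum 'I_n] = 1%N; last by [].
  have -> : [seq (k0 i j : nat) | i <- enum 'I_n] = nseq (size (enum 'I_n)) 0%N.
    by elim: (enum 'I_n) => //= i s ->; rewrite z.
  elim: (size _) => [|q IH] /=; first by rewrite /multinom big_nil.
  by rewrite multinom_cons bin0 IH.
rewrite (kE ka) /= eqxx; apply/andP; split; apply/forallP => i; rewrite big1 ?x0 ?y0 // => j _;
  exact: z.
Qed.

End WeylH0.

(** * Zeroth homology of the Weyl complex for [p = 2] *)

Section WeylH0Iso.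
Local Open Scope ring_scope.
Variables (K : fieldType) (n r : nat).
Local Notation X := {ffun 'I_n -> nat}.
Hypotheses (K2 : 2%N \in [pchar K]) (r0 : (0 < r)%N) (r2 : ~~ odd r).
Notation q := (r %/ 2)%N.
Notation a0 := (deg r 2 1 0).1.
Notation b0 := (deg r 2 1 0).2.

Let rE : r = q.*2.
Proof. by rewrite divn2 -[LHS]odd_double_half (negPf r2). Qed.

Let a0E : a0 = q.*2.
Proof. by rewrite -rE /= mul0n subn0. Qed.

(** The map that halves even exponents and kills every basis element with an odd one; it is dual to
    squaring on symmetric powers. The second factor has degree 0 and carries no information. *)
Definition half_coef (F : fieldType) (w : DB n a0 * DB n b0) (y : DB n q) : F :=
  (dv w.1 == xdbl (dv y))%:R.

Lemma dv_b0 (z : DB n b0) i : dv z i = 0%N.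
Proof. by apply/eqP; rewrite -leqn0; have := wt_ge (dv z) i; rewrite wt_dv. Qed.

Lemma DB_b0 (z z' : DB n b0) : z = z'.
Proof. by apply: dv_inj; apply/ffunP => i; rewrite !dv_b0. Qed.

Lemma evenP (x : X) : (exists i, odd (x i)) \/ exists y, x = xdbl y.
Proof.
case: (boolP [exists i, odd (x i)]) => [/existsP|]; first by left.
rewrite negb_exists => /forallP h; right; exists [ffun i => (x i)./2].
by apply/ffunP => i; rewrite !ffunE -[LHS]odd_double_half (negPf (h i)).
Qed.

Lemma half_coef_dbl (F : fieldType) (z : DB n b0) (y : DB n q) :
  exists2 u : DB n a0, dv u = xdbl (dv y) &
    forall phi : DB n q -> F, \sum_y' half_coef F (u, z) y' * phi y' = phi y.
Proof.
have w : wt (xdbl (dv y)) = a0 by rewrite wt_dbl wt_dv a0E.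
have [u uE] := dv_ex w; exists u => // phi.
rewrite (bigD1 y) //= /half_coef /= uE eqxx mul1r big1 ?addr0 // => y' ny.
case: eqP => [/xdbl_inj/dv_inj E|_]; last by rewrite mul0r.
by rewrite E eqxx in ny.
Qed.

Lemma half_coef_equiv (F : fieldType) (g : 'M[F]_n) : 2%N \in [pchar F] ->
  Kcx_act n r 2 1 0 F g *m mxc (half_coef F) = mxc (half_coef F) *m Dtw_act n 2 q F g.
Proof.
move=> F2; rewrite !mxc_mul; apply/matrixP => i j; rewrite !mxE.
case: (enum_val i) => x z; move: (enum_val j) => y' {i j} /=.
have w : wt (xdbl (dv y')) = a0 by rewrite wt_dbl wt_dv a0E.
have [u0 uE] := dv_ex w.
rewrite (bigD1 (u0, z)) //= {1}/half_coef /= uE eqxx mulr1 big1 ?addr0; last first.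
  move=> [u z'] ne; rewrite /half_coef /= -uE; case: eqP => [/dv_inj E|_]; last by rewrite mulr0.
  by rewrite E (DB_b0 z' z) eqxx in ne.
have -> : Dact b0 g (dv z) (dv z) = 1 by apply: Dact_deg0; rewrite wt_dv.
rewrite mulr1.
have key a (x1 : X) : a = q.*2 ->
    @Dact F n a g (xdbl x1) (xdbl (dv y')) = @Dact F n q (frobmx 2 g) x1 (dv y').
  by move=> ->; apply: Dact_dbl; rewrite ?wt_dv.
case: (evenP (dv x)) => [ox|[x1 xE]].
  rewrite Dact_not_dbl // big1 // => y _; rewrite /half_coef /=; case: eqP => [E|_]; last by rewrite mul0r.
  by case: ox => i; rewrite E ffunE odd_double.
rewrite xE key //.
have w1 : wt x1 = q by apply: double_inj; rewrite -wt_dbl -xE wt_dv a0E.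
have [y yE] := dv_ex w1.
rewrite (bigD1 y) //= /half_coef /= xE yE eqxx mul1r big1 ?addr0 // => y2 ne.
case: eqP => [/xdbl_inj E|_]; last by rewrite mul0r.
by case/eqP: ne; apply: dv_inj; rewrite -E.
Qed.

Lemma Kcx_H0 : sq_iso (Kcx_Z K n r 2 1 0) (Kcx_den K n r 2 1 0)
                      (Kcx_act n r 2 1 0) (Dtw_act n 2 q).
Proof.
have nz0 : nz r 2 1 0 by rewrite /nz /= mul0n.
have nz1 : nz r 2 1 1 by rewrite /nz /=; move: r0 r2; case: (r) => [|[|]].
have Zfull : (1%:M <= Kcx_Z K n r 2 1 0)%MS.
  by rewrite /Kcx_Z /Zsp nz0; apply/sub_kermxP; rewrite /dlt /= mul0mx mulmx0.
have dE : dlt (@dv n) (@Dmul K n) (@Dcom K n) r 2 1 1 =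
   dmap (@dv n) (@Dmul K n) (@Dcom K n) (deg r 2 1 1).1 (deg r 2 1 1).2 a0 b0 1.
  by rewrite /dlt nz1 nz0.
exists (mxc (half_coef K)); split.
- apply: row_full_cols => c; rewrite -mulmxA => /(submx_mul0 Zfull); rewrite mul1mx.
  rewrite -(colf_rank c) mxc_colf => E; apply/colP => i; rewrite !mxE.
  have [z0 _] : exists z : DB n b0, True.
    have w : wt (xsub [ffun=> 0%N] [ffun=> 0%N] : X) = b0.
      by rewrite /wt big1 // => j _; rewrite !ffunE.
    by have [z _] := dv_ex w; exists z.
  have [u _ U] := half_coef_dbl K z0 (enum_val i).
  by have := colf_eq0 E (u, z0); rewrite U.
- move=> w _; apply/eqP/idP => [w0|wS].
    apply: submx_cols => c /Hden_mul0[dc _].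
    rewrite -(colf_rank c); move: dc; rewrite -{1}(colf_rank c).
    set phi := (fun t => c (enum_rank t) 0); rewrite dE mxc_colf => dc.
    (* The boundary of the pair [(u - xunit j, xunit j)] has the coefficient [u j] at [u], because
       [x^(u - e_j) x_j = u_j x^(u)] in divided powers. *)
    have odd0 u z : (exists j, odd (dv u j)) -> phi (u, z) = 0.
      move=> [j oj].
      have ju : xle (xunit j) (dv u) by rewrite unit_le; case: (dv u j) oj.
      have w1 : wt (xsub (dv u) (xunit j)) = (deg r 2 1 1).1.
        by rewrite wt_sub // wt_dv wt_unit /= mul0n subn0.
      have w2 : wt (xunit j) = (deg r 2 1 1).2 by rewrite wt_unit.
      have [A AE] := dv_ex w1; have [C CE] := dv_ex w2.
      have := colf_eq0 dc (A, C) => /=.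
      rewrite (dmap_Dt (N := r.+1)) //; last first.
        by rewrite /= mul0n; move: r0; lia.
      rewrite AE CE xsubK // (@Dt1 _ _ _ _ b0); last exact: supp_slice; last first.
        by apply: wt_box; rewrite wt_dv /= mul0n subn0.
      rewrite /Dx (bigD1 j) /=; last by rewrite ffunE eqxx.
      rewrite big1 ?addr0; last by move=> i /andP[]; rewrite ffunE; case: eqP.
      have -> : xsub (xunit j) (xunit j) = dv z.
        by apply/ffunP => i; rewrite dv_b0 ffunE subnn.
      have -> : dv u = xadd (dv u) (dv z).
        by apply/ffunP => i; rewrite [xadd _ _ i]ffunE dv_b0 addn0.
      rewrite slice_dv [xadd _ _ j]ffunE addnK natr_char2 // oj mul1r //.
    (* A functional killing the boundaries sees only doubled exponents, hence factors through
       [half_coef]; dually, the kernel of [half_coef] consists of boundaries. *)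
    have -> : colf phi = mxc (half_coef K) *m colf (fun y : DB n q =>
        \sum_(u : DB n a0 * DB n b0 | dv u.1 == xdbl (dv y)) phi u).
      rewrite mxc_colf; apply: eq_colf => -[u z].
      case: (evenP (dv u)) => [ou|[x1 xE]].
        rewrite odd0 // big1 // => y _; rewrite /half_coef /=; case: eqP => [E|_]; last by rewrite mul0r.
        by case: ou => i; rewrite E ffunE odd_double.
      have w1 : wt x1 = q by apply: double_inj; rewrite -wt_dbl -xE wt_dv a0E.
      have [y yE] := dv_ex w1.
      rewrite (bigD1 y) //= /half_coef /= xE yE eqxx mul1r [X in _ = _ + X]big1 ?addr0 => [|y2 ne].
        rewrite (big_pred1 (u, z)) // => -[u' z'] /=.
        by rewrite -xE (inj_eq (@dv_inj _ _)) xpair_eqE (DB_b0 z' z) eqxx andbT.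
      case: eqP => [/xdbl_inj E|_]; last by rewrite mul0r.
      by case/eqP: ne; apply: dv_inj; rewrite -E.
    by rewrite mulmxA w0 mul0mx.
  apply: submx_mul0 wS _.
  apply: (@submx_mul0 _ _ _ _ _ _ (<<dlt (@dv n) (@Dmul K n) (@Dcom K n) r 2 1 1>>)%MS).
    rewrite /Kcx_den /Hden addsmx_sub submx_refl /=.
    apply: submx_cols => c _; apply/Rel_mul0 => l lt; exfalso; by move: lt; rewrite /= mul0n.
  apply: (@submx_mul0 _ _ _ _ _ _ (dlt (@dv n) (@Dmul K n) (@Dcom K n) r 2 1 1)).
    by rewrite genmxE.
  rewrite dE mxc_mul; apply/matrixP => i j; rewrite !mxE big1 // => -[u z] _.
  case: (enum_val i) => A C /=; move: (enum_val j) => y.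
  rewrite /half_coef /=; case: eqP => [uE|_]; last by rewrite mulr0.
  rewrite mulr1 big1 // => t _; rewrite /Dmul; case: eqP => [E|_]; last by rewrite mulr0.
  have [j0 tj] : exists j0, (0 < dv t j0)%N.
    apply/existsP; apply: contra_eqT (wt_dv t); rewrite negb_exists => /forallP h.
    by rewrite /wt big1 // => k _; have := h k; rewrite -eqn0Ngt => /eqP.
  have t1 : dv t j0 = 1%N by apply/eqP; rewrite eqn_leq tj andbT (leq_trans (wt_ge _ j0)) // wt_dv.
  rewrite (bigD1 j0) //= natrM.
  (* A boundary meets a doubled [u] only through [x^(A) x_j = u_j x^(u)], and [u_j] is even. *)
  suff -> : 'C(dv u j0, dv A j0)%:R = 0 :> K by rewrite mul0r mulr0.
  have /ffunP/(_ j0) := E; rewrite [RHS]ffunE t1 addn1 => Ej.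
  have /ffunP/(_ j0) := uE; rewrite [RHS]ffunE => Uj.
  by rewrite Ej binSn -Ej Uj natr_char2 // odd_double.
move=> F f g _ w _.
have F2 : 2%N \in [pchar F] by rewrite (fmorph_pchar f).
have -> : map_mx f (mxc (half_coef K)) = mxc (half_coef F).
  by apply/matrixP => i j; rewrite !mxE rmorph_nat.
rewrite -mulmxA half_coef_equiv // mulmxA map_mxM; congr (_ *m _ *m _).
by apply/matrixP => i j; rewrite !mxE rmorph_nat.
Qed.

End WeylH0Iso.

(** * Functions of pairs of sets: the exterior algebra in characteristic 2 *)

Ltac bool_cases x :=
  rewrite ?inE;
  repeat match goal with |- context [x \in ?A] => case: (x \in A) end;
  repeat match goal with |- context [x == ?y] => case: (x == y) end; done.
Ltac setsolve := let x := fresh "x" in apply/setP => x; bool_cases x.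

Section SetFunctions.
Local Open Scope ring_scope.
Variables (K : fieldType) (n : nat).
Hypothesis K2 : 2%N \in [pchar K].
Local Notation set := {set 'I_n}.
Implicit Types (A B S T Z W P Q V : set) (i j : 'I_n) (phi psi : set -> set -> K).

Lemma addKK (x : K) : x + x = 0.
Proof. by rewrite -mulr2n -mulr_natr (pcharf0 K2) mulr0. Qed.

Lemma char2_eq (x y : K) : x + y = 0 -> x = y.
Proof. by move=> E; rewrite -[x]addr0 -(addKK y) addrA E add0r. Qed.

(* In characteristic 2 the exterior algebra is [K[x] / (x_i ^ 2)]; [phi A B] is the
   coefficient of [x^A y^B], and [box_sum] is the substitution [y -> y + x]. *)
Definition box_sum phi S T := \sum_(Z : set | Z \subset S :\: T) phi (S :\: Z) (T :|: Z).
Definition polar phi A B := \sum_(j in B :\: A) phi (j |: A) (B :\ j).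
Definition esupp a b phi := forall A B, phi A B != 0 -> (#|A| == a) && (#|B| == b).
Definition box_inv b phi := forall S T, (#|T| < b)%N -> box_sum phi S T = 0.

Definition sdiff A B : set := (A :\: B) :|: (B :\: A).

(** The operator [x_i d/dy_i]. The symmetric difference is the set of variables occurring exactly
    once in the multidegree, so [pick] returns the same [i] throughout a multidegree; where no such
    variable exists, on the diagonal, the value is 0. *)
Definition homot phi A B :=
  if [pick i in sdiff A B] is Some i then
    if i \in A then phi (A :\ i) (i |: B) else 0
  else 0.

Lemma homot_supp a b phi : esupp a b phi -> forall A B, homot phi A B != 0 ->
  (#|A| == a.+1) && (#|B|.+1 == b).
Proof.
move=> sp A B; rewrite /homot; case: pickP => [i|]; last by rewrite eqxx.
rewrite !inE; case: (boolP (i \in A)) => iA /=; last by rewrite eqxx.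
rewrite orbF andbT => iB /sp; rewrite cardsU1 iB add1n => /andP[/eqP <- ->].
by rewrite (cardsD1 i A) iA eqxx.
Qed.

(** Moving [Z] from [S] to [T] keeps the symmetric difference, so a single [i] is used, and the sum
    is zero or the box sum of [phi] at [S] without [i] and [T] with [i]. The set [T] grows by one
    element, whence the shift of [b]. *)
Lemma homot_inv b phi : box_inv b.+1 phi -> box_inv b (homot phi).
Proof.
move=> vp S T Tb; rewrite /box_sum.
case: (pickP (mem (sdiff S T))) => [i iW|noW]; last first.
  rewrite big1 // => Z ZST; rewrite /homot; case: pickP => // j.
  have -> : sdiff (S :\: Z) (T :|: Z) = sdiff S T; last by have /= -> := noW j.
  apply/setP => x; have := subsetP ZST x; rewrite !inE.
  by case: (x \in Z); case: (x \in S); case: (x \in T) => //= /(_ isT).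
have WE Z : Z \subset S :\: T -> sdiff (S :\: Z) (T :|: Z) = sdiff S T.
  move=> ZST; apply/setP => x; have := subsetP ZST x; rewrite !inE.
  by case: (x \in Z); case: (x \in S); case: (x \in T) => //= /(_ isT).
have {iW i} [i iW iE] : exists2 i, i \in sdiff S T & [pick i in sdiff S T] = Some i.
  by case: pickP => [j jW|/(_ i) no]; [exists j|move: iW; rewrite /= no].
have hE Z : Z \subset S :\: T -> homot phi (S :\: Z) (T :|: Z) =
    if (i \in S) && (i \notin Z) then phi (S :\: Z :\ i) (i |: (T :|: Z)) else 0.
  by move=> ZST; rewrite /homot WE // iE !inE andbC.
rewrite (eq_bigr _ hE).
case: (boolP (i \in S)) => iS /=; last by rewrite big1.
have iT : i \notin T by move: iW; rewrite !inE iS /= orbF andbT.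
rewrite -[RHS](vp (S :\ i) (i |: T)); last by rewrite cardsU1 iT add1n ltnS.
rewrite /box_sum -big_mkcondr; apply: eq_big => [Z|Z _]; last by congr phi; setsolve.
apply/andP/subsetP => [[/subsetP ZST iZ] x xZ|h].
  have := ZST x xZ; rewrite !inE; case: eqP => [E|_]; first by rewrite -E xZ in iZ.
  by move=> /andP[-> ->].
split; first by apply/subsetP => x /h; rewrite !inE negb_or => /andP[/andP[_ ->] /andP[_ ->]].
by apply/negP => /h; rewrite !inE eqxx.
Qed.

(** For the fixed [i], [E h + h E] is the identity in such a multidegree: the summands of [E] with
    [j != i] commute with [h] and occur twice. The term [h E] dies by the cocycle condition. On the
    diagonal there is no [i], hence the assumption on [phi A A]. *)
Lemma polar_homot phi A B : (forall A B, polar phi A B = 0) -> phi A A = 0 ->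
  phi A B = polar (homot phi) A B.
Proof.
move=> dphi pAA; rewrite /polar.
have WE j : j \in B :\: A -> sdiff (j |: A) (B :\ j) = sdiff A B.
  rewrite inE => /andP[jA jB]; apply/setP => x; rewrite !inE; case: eqP => [->|_] //=.
  by rewrite jA jB.
case: (pickP (mem (sdiff A B))) => [i iW|noW]; last first.
  have E : B = A.
    by apply/setP => x; have := noW x; rewrite !inE; case: (x \in A); case: (x \in B).
  by rewrite E pAA big_pred0 // => j; rewrite !inE; case: (j \in A).
have {iW i} [i iW iE] : exists2 i, i \in sdiff A B & [pick i in sdiff A B] = Some i.
  by case: pickP => [j jW|/(_ i) no]; [exists j|move: iW; rewrite /= no].
have hE j : j \in B :\: A -> homot phi (j |: A) (B :\ j) =
    if (i == j) || (i \in A) then phi ((j |: A) :\ i) (i |: (B :\ j)) else 0.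
  by move=> jBA; rewrite /homot WE // iE !inE.
rewrite (eq_bigr _ hE); move: iW; rewrite !inE.
case: (boolP (i \in A)) => iA /=; last first.
  rewrite andbF /= => iB; rewrite (bigD1 i) ?inE ?iA //= ?eqxx /= big1 ?addr0.
    rewrite setU1K // setD1K //.
  by move=> j /andP[_ ji]; rewrite orbF eq_sym (negPf ji).
rewrite orbF andbT => iB; apply: char2_eq.
rewrite -[RHS](dphi (A :\ i) (i |: B)) /polar [RHS](bigD1 i) ?inE ?eqxx //=.
rewrite setD1K // setU1K //; congr (_ + _).
apply: eq_big => [j|j].
  by rewrite !inE; case: eqP => [->|_] /=; rewrite ?iA ?(negPf iB) ?andbF ?andbT.
rewrite !inE orbT => /andP[jA jB]; have ij : j != i by apply: contraNneq iB => <-.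
congr phi; apply/setP => x; rewrite !inE; case: (x =P i) => [->|_] //=.
  by rewrite eq_sym (negPf ij).
by rewrite eq_sym (negPf ij).
Qed.

Lemma sum_set1 (G : set -> K) : \sum_(Z : set | #|Z| == 1%N) G Z = \sum_j G [set j].
Proof.
transitivity (\sum_(Z : set) \sum_(j | [set j] == Z) G Z).
  rewrite [LHS]big_mkcond; apply: eq_bigr => Z _; case: ifP => [/cards1P[x ->]|nZ].
    by rewrite (big_pred1 x) // => j; rewrite /= (inj_eq set1_inj).
  by rewrite big_pred0 // => j; apply: contraFF nZ => /eqP <-; rewrite cards1.
rewrite (exchange_big_dep xpredT) //=; apply: eq_bigr => j _.
by rewrite (big_pred1 [set j]) // => Z; rewrite eq_sym.
Qed.

(** Each [V] inside [P] is counted [2 ^ #|P :\: V|] times, which is even unless [V = P]. *)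
Lemma mobius_char2 (G : set -> K) P :
  \sum_(W : set | W \subset P) \sum_(V : set | V \subset W) G V = G P.
Proof.
rewrite (exchange_big_dep (fun V : set => V \subset P)) /=; last first.
  by move=> W V WP VW; apply: subset_trans WP.
have E V : V \subset P -> \sum_(W : set | (W \subset P) && (V \subset W)) G V = G V *+ (2 ^ #|P :\: V|).
  move=> VP; rewrite sumr_const -card_powerset; congr (_ *+ _).
  rewrite -!sum1_card (reindex_onto (fun W => V :|: W) (fun W => W :\: V)) /=.
    apply: eq_bigl => W; rewrite !inE.
    apply/andP/idP => [[/andP[h _] /eqP <-]|h]; first by apply: setSD.
    have VW : [disjoint V & W] by rewrite disjoint_sym; move: h; rewrite subsetD => /andP[].
    rewrite unfold_in subsetUl andbT subUset VP (subset_trans h (subsetDl _ _)) setDUl setDv set0U.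
    by split => //; apply/eqP/setDidPl; rewrite disjoint_sym.
  by move=> W; rewrite unfold_in => /andP[WP VW]; apply/setP => x; have := subsetP VW x;
    rewrite !inE; case: (x \in V) => //= ->.
rewrite (bigD1 P) //= E // setDv cards0 expn0 mulr1n big1 ?addr0 // => V /andP[VP nV].
rewrite E //; have : (0 < #|P :\: V|)%N.
  rewrite card_gt0 setD_eq0; apply: contra nV => PV; by rewrite eqEsubset VP.
by case: #|_| => // m _; rewrite expnS mulrnA -[G V *+ 2]mulr_natr (pcharf0 K2) mulr0 mul0rn.
Qed.

(* [polar phi] is an invariant of bidegree [(q - 1, q + 1)], which violates dominance. *)
Lemma polar_middle q phi A B : esupp q q phi -> box_inv q phi -> polar phi A B = 0.
Proof.
move=> sp vp; have [Aq|qA] := eqVneq #|A|.+1 q; last first.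
  rewrite /polar big1 // => j; rewrite inE => /andP[jA _].
  apply/eqP; apply: contraT => /sp; rewrite cardsU1 jA add1n => /andP[/eqP E _].
  by rewrite -E eqxx in qA.
pose P := A :\: B; pose Q := B :\: A.
(* For [W] inside [P], the subsets of the difference of [B :|: W] and [A :\: W] are unions of
   [W :\: V] and [Z] with [V] in [W] and [Z] in [Q]. The invariance relation there says that [G]
   sums to zero over the subsets of [W], and Moebius inversion extracts [G P]. *)
pose G V := \sum_(Z : set | Z \subset Q) phi ((B :\: Z) :|: V) ((A :\: V) :|: Z).
have E1 W : W \subset P -> \sum_(V : set | V \subset W) G V = 0.
  move=> WP; rewrite -[RHS](vp (B :|: W) (A :\: W)); last first.
    by rewrite -Aq ltnS; apply: subset_leq_card; apply: subsetDl.
  rewrite /G /box_sum pair_big /=.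
  have mW x : x \in W -> (x \in A) && (x \notin B).
    by move=> /(subsetP WP); rewrite inE andbC.
  rewrite [RHS](reindex_onto (fun z : set * set => (W :\: z.1) :|: z.2)
                   (fun Z => (W :\: Z, Z :&: Q))) /=; last first.
    move=> Z /subsetP ZS; apply/setP => x.
    have /implyP := ZS x; have /implyP := mW x; bool_cases x.
  apply: eq_big => [[V Z] /=|[V Z] /= /andP[/subsetP VW /subsetP ZQ]]; last first.
    by congr phi; apply/setP => x; have /implyP := VW x; have /implyP := ZQ x;
      have /implyP := mW x; bool_cases x.
  apply/andP/andP => [[/subsetP VW /subsetP ZQ]|[_ /eqP[<- <-]]]; last first.
    by rewrite subsetDl subsetIr.
  split.
    apply/subsetP => x; apply/implyP.
    by have /implyP := VW x; have /implyP := ZQ x; have /implyP := mW x; bool_cases x.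
  by apply/eqP; congr pair; apply/setP => x; have /implyP := VW x; have /implyP := ZQ x;
    have /implyP := mW x; bool_cases x.
(* Replacing [Z] by its complement in [Q] turns the terms of [G P] into [phi (Z :|: A) (B :\: Z)];
   the bidegree of [phi] leaves only singletons [Z]. *)
have <- : G P = polar phi A B; last by rewrite -mobius_char2 big1.
transitivity (\sum_(Z : set | #|Z| == 1%N) if Z \subset Q then phi (Z :|: A) (B :\: Z) else 0).
  rewrite /G (reindex_onto (fun Z => Q :\: Z) (fun Z => Q :\: Z)) /=; last first.
    by move=> Z ZQ; rewrite setDDr setDv set0U; apply/setIidPr.
  rewrite big_mkcond [RHS]big_mkcond; apply: eq_bigr => Z _.
  rewrite subsetDl setDDr setDv set0U /=.
  have -> : (Q :&: Z == Z) = (Z \subset Q) by apply/eqP/setIidPr.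
  case: (boolP (Z \subset Q)) => [/subsetP ZQ|_]; last by case: ifP.
  have -> : B :\: (Q :\: Z) :|: P = Z :|: A.
    by apply/setP => x; have /implyP := ZQ x; bool_cases x.
  have -> : A :\: P :|: Q :\: Z = B :\: Z.
    by apply/setP => x; have /implyP := ZQ x; bool_cases x.
  case: ifP => // Z1; apply/eqP; apply: contraFT Z1 => /sp/andP[].
  rewrite cardsU -Aq (_ : Z :&: A = set0) ?cards0; last first.
    by apply/setP => x; have /implyP := ZQ x; bool_cases x.
  by rewrite subn0 -addn1 addnC eqn_add2l.
rewrite sum_set1 /polar [RHS]big_mkcond; apply: eq_bigr => j _.
by rewrite sub1set.
Qed.

End SetFunctions.

(** * Translation of the Schur complex into set functions *)

Section SchurBridge.
Local Open Scope ring_scope.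
Variables (K : fieldType) (n : nat).
Hypothesis K2 : 2%N \in [pchar K].
Local Notation set := {set 'I_n}.
Implicit Types (A B C S T Z : set) (a b l : nat).

Lemma ev_inj a : injective (@ev n a).
Proof. exact: val_inj. Qed.

Lemma card_ev a (u : EB n a) : #|ev u| = a.
Proof. exact/eqP/(valP u). Qed.

Lemma ev_ex a A : #|A| = a -> exists u : EB n a, ev u = A.
Proof.
move=> Aa; have h : #|A| == a by rewrite Aa.
by exists (exist (fun A : {set 'I_n} => #|A| == a) A h).
Qed.

Lemma sum_EB a (G : set -> K) : \sum_(z : EB n a) G (ev z) = \sum_(Z : set | #|Z| == a) G Z.
Proof.
case: (pickP (fun A : set => #|A| == a)) => [A0 A0a|no]; last first.
  rewrite [RHS]big_pred0 // big1 // => z _; by have := no (ev z); rewrite card_ev eqxx.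
pose s (A : set) : EB n a := insubd (exist _ A0 A0a) A.
rewrite [RHS](reindex_onto (@ev n a) s) => [|A Aa]; last exact: insubdK.
by apply: eq_bigl => z; rewrite card_ev eqxx /= /s /ev valKd eqxx.
Qed.

(** Extension by zero to pairs of sets of any size, so that set operations carry no proofs about
    cardinals. *)
Definition ext a b (phi : EB n a * EB n b -> K) A B :=
  \sum_(w : EB n a * EB n b | (ev w.1 == A) && (ev w.2 == B)) phi w.

Lemma ext_ev a b (phi : EB n a * EB n b -> K) u w : ext phi (ev u) (ev w) = phi (u, w).
Proof.
by rewrite /ext (big_pred1 (u, w)) // => -[u' w'] /=; rewrite !(inj_eq (@ev_inj _)).
Qed.

Lemma ext_supp a b (phi : EB n a * EB n b -> K) : esupp a b (ext phi).
Proof.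
move=> A B; apply: contraR => nAB; rewrite /ext big1 // => w /andP[/eqP E1 /eqP E2].
by case/negP: nAB; rewrite -E1 -E2 !card_ev !eqxx.
Qed.

Lemma ext_fun a b (psi : set -> set -> K) : esupp a b psi -> forall A B,
  ext (fun w : EB n a * EB n b => psi (ev w.1) (ev w.2)) A B = psi A B.
Proof.
move=> sp A B; case: (eqVneq (psi A B) 0) => [p0|/sp/andP[/eqP Aa /eqP Bb]].
  by rewrite /ext big1 ?p0 // => w /andP[/eqP -> /eqP ->].
by have [u <-] := ev_ex Aa; have [w <-] := ev_ex Bb; rewrite ext_ev.
Qed.

Lemma Emul_char2 A B C :
  Emul K A B C = ([disjoint A & B] && (C == A :|: B))%:R.
Proof.
rewrite /Emul /esign; case: ifP => // _.
have -> : -1 = 1 :> K by apply: (char2_eq K2); rewrite addNr.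
by rewrite expr1n.
Qed.

Lemma box_sum_supp a b (phi : set -> set -> K) S T : esupp a b phi ->
  (#|S| + #|T| != a + b)%N -> box_sum phi S T = 0.
Proof.
move=> sp ne; rewrite /box_sum big1 // => Z ZST.
apply/eqP; apply: contraT => /sp/andP[/eqP E1 /eqP E2]; case/eqP: ne; rewrite -E1 -E2.
move: ZST; rewrite subsetD => /andP[ZS ZT].
rewrite cardsU (_ : T :&: Z = set0) ?cards0 ?subn0; last by apply/eqP; rewrite setI_eq0 disjoint_sym.
by have := cardsD S Z; rewrite (setIidPr ZS); have := subset_leq_card ZS; lia.
Qed.

Lemma boxm_ext a b l (phi : EB n a * EB n b -> K) (S : EB n (a + b - l)) (T : EB n l) :
  (l <= b)%N ->
  \sum_w (\sum_(z : EB n (b - l)) Ecom K (ev S) (ev w.1) (ev z) * Emul K (ev z) (ev T) (ev w.2))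
     * phi w = box_sum (ext phi) (ev S) (ev T).
Proof.
move=> lb; under eq_bigr do rewrite mulr_suml.
rewrite exchange_big /=.
transitivity (\sum_(z : EB n (b - l)) if ev z \subset ev S :\: ev T then
    ext phi (ev S :\: ev z) (ev T :|: ev z) else 0).
  apply: eq_bigr => z _; rewrite /ext.
  transitivity (\sum_(w : EB n a * EB n b |
     [&& ev z \subset ev S :\: ev T, ev w.1 == ev S :\: ev z & ev w.2 == ev T :|: ev z]) phi w);
    last by case: ifP => // _; rewrite big_pred0.
  rewrite [RHS]big_mkcond; apply: eq_bigr => w _.
  rewrite /Ecom !Emul_char2 -natrM mulnb.
  set c1 := (X in (nat_of_bool X)%:R); set c2 := (X in if X then _ else _).
  suff -> : c1 = c2 by case: c2; rewrite ?mul1r ?mul0r.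
  rewrite /c1 /c2; apply/andP/and3P => [[/andP[d1 /eqP ->] /andP[d2 /eqP ->]]|[h /eqP -> /eqP ->]].
    split.
    - rewrite subsetD subsetUr /=; exact: d2.
    - by rewrite setDUl setDv setU0 eq_sym; apply/eqP/setDidPl.
    - by rewrite setUC.
  move: h; rewrite subsetD => /andP[zS zT].
  split; apply/andP; split => //.
  - by rewrite -setI_eq0; apply/eqP; setsolve.
  - by apply/eqP/setP => x; have /implyP := subsetP zS x; bool_cases x.
  - by rewrite setUC.
rewrite (sum_EB _ (fun Z => if Z \subset ev S :\: ev T then
    ext phi (ev S :\: Z) (ev T :|: Z) else 0)) /box_sum big_mkcond [RHS]big_mkcond.
apply: eq_bigr => Z _; case: ifP => // Zl; case: ifP => // ZST; apply/esym/eqP.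
apply: contraFT Zl => /ext_supp/andP[_ /eqP E2].
move: ZST; rewrite subsetD => /andP[ZS ZT].
have := cardsU (ev T) Z; rewrite (_ : ev T :&: Z = set0) ?cards0 ?subn0; last first.
  by apply/eqP; rewrite setI_eq0 disjoint_sym.
by rewrite E2 card_ev => ->; rewrite addKn.
Qed.

Lemma dmap_ext a b a' b' (psi : EB n a' * EB n b' -> K) (A : EB n a) (C : EB n b) :
  \sum_w (\sum_(z : EB n 1) Ecom K (ev C) (ev z) (ev w.2) * Emul K (ev A) (ev z) (ev w.1))
     * psi w = polar (ext psi) (ev A) (ev C).
Proof.
under eq_bigr do rewrite mulr_suml.
rewrite exchange_big /=.
transitivity (\sum_(z : EB n 1) if ev z \subset ev C :\: ev A then
    ext psi (ev z :|: ev A) (ev C :\: ev z) else 0).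
  apply: eq_bigr => z _; rewrite /ext.
  transitivity (\sum_(w : EB n a' * EB n b' |
     [&& ev z \subset ev C :\: ev A, ev w.1 == ev z :|: ev A & ev w.2 == ev C :\: ev z]) psi w);
    last by case: ifP => // _; rewrite big_pred0.
  rewrite [RHS]big_mkcond; apply: eq_bigr => w _.
  rewrite /Ecom !Emul_char2 -natrM mulnb.
  set c1 := (X in (nat_of_bool X)%:R); set c2 := (X in if X then _ else _).
  suff -> : c1 = c2 by case: c2; rewrite ?mul1r ?mul0r.
  rewrite /c1 /c2; apply/andP/and3P => [[/andP[d1 /eqP ->] /andP[d2 /eqP ->]]|[h /eqP -> /eqP ->]].
    split.
    - by rewrite subsetD subsetUl disjoint_sym.
    - by rewrite setUC.
    - by rewrite setDUl setDv set0U eq_sym; apply/eqP/setDidPl; rewrite disjoint_sym.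
  move: h; rewrite subsetD => /andP[zC zA].
  split; apply/andP; split.
  - by rewrite -setI_eq0; apply/eqP; setsolve.
  - by apply/eqP/setP => x; have /implyP := subsetP zC x; bool_cases x.
  - by rewrite disjoint_sym.
  - by rewrite setUC.
rewrite (sum_EB _ (fun Z => if Z \subset ev C :\: ev A then
    ext psi (Z :|: ev A) (ev C :\: Z) else 0)) sum_set1 /polar [RHS]big_mkcond.
by apply: eq_bigr => j _; rewrite sub1set.
Qed.

Lemma boxm_box_inv a b (phi : EB n a * EB n b -> K) :
  (forall l, (l < b)%N -> boxm (@ev n) (@Emul K n) (@Ecom K n) a b l *m colf phi = 0) ->
  box_inv b (ext phi).
Proof.
move=> h S T Tb; case: (eqVneq (#|S| + #|T|)%N (a + b)%N) => [E|]; last first.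
  by apply: box_sum_supp; apply: ext_supp.
have [T' TE] := @ev_ex #|T| T erefl.
have S1 : #|S| = (a + b - #|T|)%N by rewrite -E addnK.
have [S' SE] := ev_ex S1.
have := h _ Tb; rewrite mxc_colf => /colf_eq0/(_ (S', T')) /=.
by rewrite boxm_ext ?(ltnW Tb) // SE TE.
Qed.

Lemma box_inv_boxm a b (psi : set -> set -> K) : esupp a b psi -> box_inv b psi ->
  forall l, (l < b)%N -> boxm (@ev n) (@Emul K n) (@Ecom K n) a b l *m
    colf (fun w : EB n a * EB n b => psi (ev w.1) (ev w.2)) = 0.
Proof.
move=> sp vp l lb; rewrite mxc_colf; apply/colP => i; rewrite !mxE.
case: (enum_val i) => S T; rewrite boxm_ext ?(ltnW lb) //.
rewrite -[RHS](vp (ev S) (ev T)) ?card_ev //; apply: eq_bigr => Z _.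
by rewrite ext_fun.
Qed.

End SchurBridge.

(** * The Schur complex for [p = 2] below the top degree *)

Section SchurExact2.
Local Open Scope ring_scope.
Variables (K : fieldType) (n r : nat).
Hypotheses (K2 : 2%N \in [pchar K]) (r0 : (0 < r)%N) (r2 : ~~ odd r).
Local Notation set := {set 'I_n}.

Lemma deg2_char2 k : (deg r 2 1 k).2 = k.
Proof.
rewrite /deg; have := odd_double_half k; case: odd => /=; rewrite muln2 ?addn1 //.
Qed.

Lemma tk_char2 k : tk 2 1 k = 1%N.
Proof. by rewrite /tk; case: odd. Qed.

Lemma homot_functional k (psi : set -> set -> K) : (0 < k)%N -> (k + k <= r)%N ->
  esupp (deg r 2 1 k).1 k psi -> box_inv k psi -> (forall A B, polar psi A B = 0) ->
  (forall A, psi A A = 0) ->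
  exists2 e : 'cV[K]_#|{: Wk (EB n) r 2 1 k.-1}|,
    Usp (@ev n) (@Emul K n) (@Ecom K n) r 2 1 k.-1 *m e = 0 &
    colf (fun w : Wk (EB n) r 2 1 k => psi (ev w.1) (ev w.2)) =
    dlt (@ev n) (@Emul K n) (@Ecom K n) r 2 1 k *m e.
Proof.
case: k => // k _ kr sp vp dp pAA.
have nzk : nz r 2 1 k.+1 by rewrite nzP // deg2_char2.
have nzk' : nz r 2 1 k by rewrite nzP // deg2_char2; lia.
have sh : esupp (deg r 2 1 k).1 (deg r 2 1 k).2 (homot psi).
  move=> A B /(homot_supp sp); rewrite !deg1E // !deg2_char2 => /andP[/eqP -> ].
  by rewrite eqSS => /eqP ->; rewrite eqxx andbT; lia.
exists (colf (fun w : EB n (deg r 2 1 k).1 * EB n (deg r 2 1 k).2 => homot psi (ev w.1) (ev w.2))).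
  apply/Rel_mul0; apply: box_inv_boxm => //; rewrite deg2_char2.
  by apply: homot_inv.
rewrite /dlt nzk nzk' /= tk_char2 mxc_colf; apply: eq_colf => -[A C].
rewrite dmap_ext // (polar_homot K2 (phi := psi)) //=.
by apply: eq_bigr => j _; rewrite ext_fun.
Qed.

Lemma Lcx_exact_char2 k : k <> (r %/ 2)%N -> Lcx_vanishes K n r 2 1 k.
Proof.
move=> kq; apply: vanishes_dual => nzk phi hbox hd.
have kr : (k + k <= r)%N by move: nzk; rewrite nzP // deg2_char2.
have rE : r = (r %/ 2 + r %/ 2)%N by rewrite divn2 addnn -[LHS]odd_double_half (negPf r2).
(* As [r] is even and [k] is not the top degree, the next bidegree is still a partition, so the
   cocycle condition is available. *)
have kr' : (k.+1 + k.+1 <= r)%N by lia.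
have nz2 : nz r 2 1 k.+1 by rewrite nzP // deg2_char2.
have {}hd := hd nz2.
have aE : (deg r 2 1 k).1 = (r - k)%N by rewrite deg1E deg2_char2.
have sp : esupp (deg r 2 1 k).1 k (ext phi).
  by move=> A B /ext_supp; rewrite deg2_char2.
have vp : box_inv k (ext phi).
  have h := boxm_box_inv K2 hbox; move=> S T Tk; apply: h; by rewrite deg2_char2.
have dp A B : polar (ext phi) A B = 0.
  have [/eqP Aa|nA] := boolP (#|A| == (deg r 2 1 k.+1).1); last first.
    rewrite /polar big1 // => j; rewrite inE => /andP[jA _].
    apply/eqP; apply: contraT => /sp; rewrite cardsU1 jA add1n => /andP[/eqP E _].
    by case/eqP: nA; rewrite deg1E // deg2_char2; lia.
  have [/eqP Bb|nB] := boolP (#|B| == (deg r 2 1 k.+1).2); last first.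
    rewrite /polar big1 // => j; rewrite inE => /andP[_ jB].
    apply/eqP; apply: contraT => /sp => /andP[_ /eqP E].
    by case/eqP: nB; rewrite deg2_char2 (cardsD1 j B) jB E.
  have [A' AE] := ev_ex Aa; have [B' BE] := ev_ex Bb.
  move: hd; rewrite mxc_colf => /colf_eq0/(_ (A', B')) /=.
  by rewrite tk_char2 dmap_ext // AE BE.
have pAA A : ext phi A A = 0.
  by apply/eqP; apply: contraT => /sp/andP[/eqP E /eqP E']; lia.
have colE : colf phi = colf (fun w : Wk (EB n) r 2 1 k => ext phi (ev w.1) (ev w.2)).
  by apply: eq_colf => -[u w]; rewrite ext_ev.
(* In degree 0 there is nothing to map from: [homot] would lower the [y]-degree below 0, so it is
   zero and the functional itself vanishes. *)
case: (posnP k) => [k0|kpos]; last first.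
  by have [e Ue eE] := homot_functional kpos kr sp vp dp pAA; exists e => //; rewrite colE.
exists 0; first by rewrite mulmx0.
rewrite mulmx0 colE; apply/colP => i; rewrite !mxE (polar_homot K2) // /polar big1 // => j _.
by apply/eqP; apply: contraT => /(homot_supp sp)/andP[_ /eqP E]; move: (E); rewrite [RHS]k0.
Qed.

End SchurExact2.

(** * The Schur complex for two variables and odd [p] *)

Section SchurExactTwo.
Local Open Scope ring_scope.

Lemma card_EB_big n a b : (n < a)%N -> #|{: EB n a * EB n b}| = 0%N.
Proof.
move=> na; apply: eq_card0 => -[u w]; have := max_card (mem (ev u)).
by rewrite card_ev card_ord leqNgt na.
Qed.

(** Exterior powers beyond the second vanish, so a surviving bidegree has both entries at most 2.
    Writing [r = p s + d - 1], degree 0 then requires [r < p], degree 1 requires [p s - 1 <= 2], so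
    [s = 1], and from degree 2 on the second entry is at least [p > 2]. *)
Lemma Lcx_exact_two (K : fieldType) p r d k : prime p -> (2 < p)%N -> (0 < d < p)%N -> (0 < r)%N ->
  r.+1 = d %[mod p] -> k <> (r %/ p)%N -> Lcx_vanishes K 2 r p d k.
Proof.
move=> pp p2 dp r0 rd kq; rewrite /Lcx_vanishes /homology_vanishes.
have [nzk|nnz] := boolP (nz r p d k); last by rewrite /Zsp (negPf nnz) sub0mx.
have [a3|a2] := ltnP 2 (deg r p d k).1.
  have c0 : #|{: Wk (EB 2) r p d k}| = 0%N by apply: card_EB_big.
  by apply: submx_cols => c _; apply/colP => -[i lt]; exfalso; move: lt; rewrite c0.
exfalso; apply: kq; move: nzk a2; rewrite nzP //.
have rE : (r = p * (r.+1 %/ p) + d - 1)%N.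
  have := divn_eq r.+1 p; rewrite rd modn_small; first by lia.
  by case/andP: dp.
move: rE; set s := (r.+1 %/ p)%N => rE.
case: k => [|k].
  rewrite /deg /= mul0n subn0 => _ r2; have r1 : (r < p)%N by lia.
  by rewrite divn_small.
case: k => [|k].
  rewrite /deg /= mul0n subn0 add0n => h1 h2.
  have s1 : (s = 1 \/ s = 0 \/ 2 <= s)%N by lia.
  have s1' : s = 1%N by nia.
  have -> : r = (1 * p + (d - 1))%N by rewrite rE s1' muln1; lia.
  by rewrite divnMDl ?divn_small; lia.
have : (p <= (deg r p d k.+2).2)%N.
  rewrite deg2S // deg2S // !tkS //; have := tk_bnd dp k.+1; rewrite tkS //.
  by have := tk_bnd dp k; lia.
rewrite deg1E //; lia.
Qed.

End SchurExactTwo.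

(** * Products of linear forms and their invariance *)

Section ProductsOfForms.
Local Open Scope ring_scope.
Variables (F : fieldType) (n : nat).
Hypothesis F2 : 2%N \in [pchar F].
Local Notation set := {set 'I_n}.
Implicit Types (A B S T Z : set) (i j : 'I_n) (phi psi : set -> set -> F)
  (u : 'I_n -> F) (us : seq ('I_n -> F)).

Definition xmul i phi A B := if i \in A then phi (A :\ i) B else 0.
Definition ymul j phi A B := if j \in B then phi A (B :\ j) else 0.

Lemma box_sum_xmul i phi S T :
  box_sum (xmul i phi) S T = if i \in S then box_sum phi (S :\ i) T else 0.
Proof.
rewrite /box_sum /xmul; case: (boolP (i \in S)) => iS; last first.
  by rewrite big1 // => Z _; rewrite inE (negPf iS) andbF.
rewrite -big_mkcondr; apply: eq_big => [Z|Z _]; last by congr phi; setsolve.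
apply/andP/subsetP => [[/subsetP h iZ] x xZ|h].
  move: (h x xZ) iZ; rewrite !inE; case: (x =P i) => [<-|_] /=; first by rewrite xZ.
  by move=> /andP[-> ->].
split; first by apply/subsetP => x /h; rewrite !inE => /andP[-> /andP[_ ->]].
by rewrite inE iS andbT; apply/negP => /h; rewrite !inE eqxx andbF.
Qed.

(** The substitution is a ring homomorphism sending [y_j] to [y_j + x_j]. If [j] lies in both [S]
    and [T], the first term on the right also counts the [Z] containing [j]; this excess equals the
    second term, and the two cancel in characteristic 2. *)
Lemma box_sum_ymul j phi S T :
  box_sum (ymul j phi) S T = (if j \in T then box_sum phi S (T :\ j) else 0) +
    (if j \in S then box_sum phi (S :\ j) T else 0).
Proof.
have toggle : j \in S -> j \notin T ->
    \sum_(Z : set | (Z \subset S :\: T) && (j \in Z)) phi (S :\: Z) ((T :|: Z) :\ j) =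
    box_sum phi (S :\ j) T.
  move=> jS jT; rewrite /box_sum (reindex_onto (fun Z => j |: Z) (fun Z => Z :\ j)); last first.
    by move=> Z /andP[_ jZ]; rewrite setD1K.
  apply: eq_big => [Z|Z /andP[_ /eqP jZ]].
    rewrite setU11 andbT; apply/andP/subsetP => [[/subsetP h /eqP jZ] x xZ|h].
      have := h x; rewrite !inE xZ orbT => /(_ isT)/andP[-> ->].
      by move: xZ; rewrite -jZ !inE => /andP[->].
    have jZ : j \notin Z by apply/negP => /h; rewrite !inE eqxx andbF.
    split; last by rewrite setU1K.
    apply/subsetP => x; rewrite !inE => /orP[/eqP->|/h]; first by rewrite jS jT.
    by rewrite !inE => /andP[-> /andP[_ ->]].
  have {jZ} : j \notin Z by rewrite -jZ !inE eqxx.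
  move=> jZ; congr phi; apply/setP => x; rewrite !inE; case: (x =P j) => [->|_] //=;
  by rewrite ?(negPf jT) ?(negPf jZ) ?andbF.
rewrite {1}/box_sum /ymul; case: (boolP (j \in T)) => jT; last first.
  rewrite add0r; under eq_bigr do rewrite inE (negPf jT) /=.
  rewrite -big_mkcondr /=; case: (boolP (j \in S)) => jS; first exact: toggle.
  by rewrite big_pred0 // => Z; apply/negP => /andP[/subsetP h /h]; rewrite !inE (negPf jS) andbF.
under eq_bigr do rewrite inE jT /=.
case: (boolP (j \in S)) => jS; last first.
  rewrite addr0 /box_sum; apply: eq_big => [Z|Z].
    have -> // : S :\: T = S :\: (T :\ j).
    by apply/setP => x; rewrite !inE; case: (x =P j) => [->|] //=; rewrite (negPf jS) andbF.
  move=> /subsetP h; congr phi; apply/setP => x; rewrite !inE; case: (x =P j) => [->|_] //=.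
  by apply/esym/negbTE/negP => /h; rewrite !inE (negPf jS) andbF.
have E : box_sum phi S (T :\ j) = \sum_(Z : set | Z \subset S :\: T) phi (S :\: Z) ((T :|: Z) :\ j)
   + box_sum phi (S :\ j) T.
  rewrite {1}/box_sum (bigID (fun Z : set => j \in Z)) /= addrC; congr (_ + _).
    apply: eq_big => [Z|Z].
      apply/andP/subsetP => [[/subsetP h jZ] x xZ|h].
        move: (h x xZ); rewrite !inE negb_and negbK; case: (x =P j) => [E|_] //=.
        by rewrite -E xZ in jZ.
      split; last by apply/negP => /h; rewrite !inE jT.
      by apply/subsetP => x /h; rewrite !inE negb_and => /andP[-> ->]; rewrite orbT.
    move=> /andP[_ jZ]; congr phi; apply/setP => x; rewrite !inE; case: (x =P j) => [->|_] //=.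
    exact: negbTE.
  rewrite /box_sum (reindex_onto (fun Z => j |: Z) (fun Z => Z :\ j)); last first.
    by move=> Z /andP[_ jZ]; rewrite setD1K.
  apply: eq_big => [Z|Z _]; last first.
    by congr phi; apply/setP => x; rewrite !inE; case: (x =P j) => [->|_] //=; rewrite ?jT ?andbF.
  rewrite setU11 andbT; apply/andP/subsetP => [[/subsetP h /eqP jZ] x xZ|h].
    have xj : x != j by move: xZ; rewrite -jZ !inE => /andP[].
    by have := h x; rewrite !inE xZ orbT xj /= => /(_ isT).
  have jZ : j \notin Z by apply/negP => /h; rewrite !inE eqxx andbF.
  split; last by rewrite setU1K.
  apply/subsetP => x; rewrite !inE => /orP[/eqP->|/h]; first by rewrite eqxx jS.
  by rewrite !inE => /andP[xT /andP[_ ->]]; rewrite (negPf xT) andbF.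
by rewrite E -addrA addKK // addr0.
Qed.

(** The coefficient of [x^A] in the product of the linear forms [u(x)] modulo the squares [x_i ^ 2]:
    a permanent, which [det_per] identifies with a determinant in characteristic 2. *)
Fixpoint per us A : F :=
  if us is u :: us' then \sum_(i in A) u i * per us' (A :\ i) else (A == set0)%:R.

Lemma per_supp us A : per us A != 0 -> #|A| = size us.
Proof.
elim: us A => [|u us IH] A /=; first by case: (A =P set0) => [->|]; rewrite ?cards0 ?eqxx.
move=> h; have [i iA] : exists2 i, i \in A & per us (A :\ i) != 0.
  apply/exists_inP; apply: contraR h; rewrite negb_exists_in => /forall_inP h.
  by rewrite big1 // => i /h; rewrite negbK => /eqP ->; rewrite mulr0.
by move=> /IH <-; rewrite (cardsD1 i A) iA.
Qed.

(** The coefficient of [x^A y^B] in the product of all [u(x) u(y)]. *)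
Definition theta us A B := per us A * per us B.

Lemma sum_sym_char2 (c : 'I_n -> 'I_n -> F) : (forall i j, c i j = c j i) ->
  (forall i, c i i = 0) -> \sum_i \sum_j c i j = 0.
Proof.
move=> csym c0.
have E : \sum_i \sum_j c i j = \sum_(i < n) \sum_(j < n | (j < i)%N) c i j + \sum_(i < n) \sum_(j < n | (i < j)%N) c i j.
  rewrite -big_split; apply: eq_bigr => i _ /=; rewrite (bigD1 i) //= c0 add0r.
  rewrite (bigID (fun j : 'I_n => (j < i)%N)) /=; congr (_ + _); apply: eq_bigl => j.
    by rewrite -val_eqE; case: ltngtP.
  by rewrite -val_eqE; case: ltngtP.
rewrite E [X in _ + X](exchange_big_dep xpredT) //= -[RHS](addKK F2
  (\sum_(i < n) \sum_(j < n | (j < i)%N) c i j)); congr (_ + _).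
by apply: eq_bigr => i _; apply: eq_bigr => j _.
Qed.

Lemma theta_cons u us A B :
  theta (u :: us) A B = \sum_i \sum_j u i * u j * xmul i (ymul j (theta us)) A B.
Proof.
rewrite /theta /= mulr_suml big_mkcond; apply: eq_bigr => i _; rewrite /xmul /ymul.
case: ifP => iA; last by rewrite big1 // => j _; rewrite mulr0.
rewrite mulr_sumr big_mkcond; apply: eq_bigr => j _; case: ifP => jB; last by rewrite mulr0.
by ring.
Qed.

(** Replacing [y] by [y + x] adds [u(x)^2] to a factor [u(x) u(y)]. This square is zero: its
    diagonal terms are multiples of [x_i ^ 2] and the others come in equal pairs, which is
    [sum_sym_char2]. *)
Lemma box_sum_theta us S T : box_sum (theta us) S T = theta us S T.
Proof.
elim: us S T => [|u us IH] S T.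
  rewrite /box_sum (bigD1 set0) ?sub0set //= setD0 setU0 big1 ?addr0 // => Z /andP[h Z0].
  rewrite /theta /= setU_eq0 (negPf Z0) andbF mulr0 //.
rewrite /box_sum; under eq_bigr do rewrite theta_cons.
rewrite exchange_big /=; under eq_bigr do rewrite exchange_big /=.
have E i j : \sum_(Z : set | Z \subset S :\: T) u i * u j * xmul i (ymul j (theta us)) (S :\: Z) (T :|: Z)
   = u i * u j * xmul i (ymul j (theta us)) S T +
     (if (i \in S) && (j \in S :\ i) then u i * u j * theta us (S :\ i :\ j) T else 0).
  rewrite -mulr_sumr -[\sum_(Z | _) _]/(box_sum _ S T) box_sum_xmul {1}/xmul.
  case: (boolP (i \in S)) => iS; last by rewrite mulr0 add0r.
  rewrite box_sum_ymul {1}/ymul !IH mulrDr; congr (_ + _).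
  by case: ifP; rewrite ?mulr0.
under eq_bigr do under eq_bigr do rewrite E.
under eq_bigr do rewrite big_split /=.
rewrite big_split /= -theta_cons [X in _ + X]sum_sym_char2 ?addr0 // => [i j|i].
  rewrite !inE; case: (eqVneq i j) => [->|ij] //.
  by rewrite andbC; case: ifP => // _; rewrite setDDl setUC -setDDl; ring.
by rewrite !inE eqxx andbF.
Qed.

Lemma enum_setD1 A x : enum (A :\ x) = [seq y <- enum A | y != x].
Proof.
rewrite /enum_mem -filter_predI; apply: eq_filter => y /=.
by rewrite !inE.
Qed.

Lemma nth_filter_neq (T : eqType) (s : seq T) (x0 : T) (j k : nat) : uniq s -> (j < size s)%N ->
  nth x0 [seq y <- s | y != nth x0 s j] k = nth x0 s (bump j k).
Proof.
move=> us js; rewrite -rem_filter // remE index_uniq // nth_cat size_take js /bump.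
case: (ltnP k j) => kj; first by rewrite nth_take // add0n.
by rewrite nth_drop addSn subnKC.
Qed.

(** Cofactor expansion along the first row is the recursion of [per], all signs being 1 in
    characteristic 2. *)
Lemma det_per (vs : seq (nat -> F)) A : #|A| = size vs ->
  \det (\matrix_(i < size vs, j < size vs)
     nth (fun=> 0) vs i (nth 0%N (map val (enum A)) j)) =
  per [seq (fun i : 'I_n => v (val i)) | v <- vs] A.
Proof.
elim: vs A => [|v vs IH] A cA.
  by rewrite det_mx00 /=; move/eqP: cA; rewrite cards_eq0 => ->.
have [x0 x0A] : exists x, x \in A by apply/card_gt0P; rewrite cA.
have sE : size (enum A) = (size vs).+1 by rewrite -cardE cA.
rewrite (expand_det_row _ ord0) /=.
rewrite -[RHS]big_enum /=.
rewrite [RHS](big_nth x0) sE big_mkord; apply: eq_bigr => j _; rewrite mxE /=.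
have js : (j < size (enum A))%N by rewrite sE.
congr (_ * _); first by rewrite (nth_map x0).
have m1 : -1 = 1 :> F by apply: (char2_eq F2); rewrite addNr.
rewrite /cofactor m1 expr1n mul1r -IH; last first.
  have jA : nth x0 (enum A) j \in A by rewrite -mem_enum mem_nth.
  by have := cardsD1 (nth x0 (enum A) j) A; rewrite jA cA add1n => /succn_inj/esym.
congr (\det _); apply/matrixP => i k; rewrite !mxE /= enum_setD1; congr (nth _ _ _ _).
have -> : [seq val y | y <- [seq y <- enum A | y != nth x0 (enum A) j]] =
    [seq y <- [seq val y | y <- enum A] | y != nth 0%N [seq val y | y <- enum A] j].
  by rewrite filter_map (nth_map x0).
apply/esym/nth_filter_neq; last by rewrite size_map.
by rewrite map_inj_uniq ?enum_uniq //; apply: val_inj.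
Qed.

End ProductsOfForms.

(** * Top homology of the Schur complex for [p = 2] *)

Section SchurTop.
Local Open Scope ring_scope.
Variables (n r : nat).
Hypotheses (r0 : (0 < r)%N) (r2 : ~~ odd r).
Notation q := (r %/ 2)%N.
Notation a := (deg r 2 1 q).1.
Notation b := (deg r 2 1 q).2.
Notation set := {set 'I_n}.

Let rE : r = (q + q)%N.
Proof. by rewrite divn2 addnn -[LHS]odd_double_half (negPf r2). Qed.

Let bE : b = q.
Proof. exact: deg2_char2. Qed.

Let aE : a = q.
Proof. by rewrite deg1E // bE {1}rE addnK. Qed.

Section Coefficients.
Variable F : fieldType.
Hypothesis F2 : 2%N \in [pchar F].

(** The projection of [e_A (x) e_B] to [e_A] if [A = B] and to 0 otherwise; its transpose [diagT]
    sends [e_A] to [e_A (x) e_A]. *)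
Definition diag_coef (w : EB n a * EB n b) (y : EB n q) : F :=
  ((ev w.1 == ev y) && (ev w.2 == ev y))%:R.

Definition rows (g : 'M[F]_n) (B : set) : seq ('I_n -> F) :=
  [seq (fun i : 'I_n => v (val i)) | v <- [seq gfun g c | c <- [seq val i | i <- enum B]]].

Lemma Eact_per m (g : 'M[F]_n) (A B : set) : #|A| = m -> #|B| = m ->
  @Eact F n m g A B = per (rows g B) A.
Proof.
move=> Am Bm; rewrite /rows; set vs := [seq gfun g c | c <- _].
have sz : size vs = m by rewrite !size_map -cardE.
rewrite -(det_per F2); last by rewrite sz.
rewrite -[in LHS]sz /Eact.
congr (\det _); apply/matrixP => i j; rewrite !mxE.
rewrite (nth_map 0%N) //; apply: leq_trans (ltn_ord i) _; by rewrite /vs !size_map.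
Qed.

Lemma size_rows g (B : set) : size (rows g B) = #|B|.
Proof. by rewrite !size_map -cardE. Qed.

Lemma diag_ex (y : EB n q) : exists w : EB n a * EB n b, ev w.1 = ev y /\ ev w.2 = ev y.
Proof.
have h1 : #|ev y| = a by rewrite card_ev aE.
have h2 : #|ev y| = b by rewrite card_ev bE.
by have [u uE] := ev_ex h1; have [w wE] := ev_ex h2; exists (u, w).
Qed.

Lemma sum_diag (G : EB n a * EB n b -> F) y w : ev w.1 = ev y -> ev w.2 = ev y ->
  \sum_w' diag_coef w' y * G w' = G w.
Proof.
move=> E1 E2; rewrite (bigD1 w) //= {1}/diag_coef E1 E2 !eqxx mul1r big1 ?addr0 // => w' ne.
rewrite /diag_coef -{1}E1 -E2; case: (boolP (_ && _)) => [/andP[/eqP h1 /eqP h2]|_]; last by rewrite mul0r.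
by case/eqP: ne; move: w w' h1 h2 {E1 E2} => [u v] [u' v'] /= /ev_inj -> /ev_inj ->.
Qed.

Definition diagT := mxc (fun (y : EB n q) w => diag_coef w y).

Lemma diagT_mul (U : finType) (G : EB n a * EB n b -> U -> F) :
  exists2 H : EB n q -> U -> F, diagT *m mxc G = mxc H &
    forall y u w, ev w.1 = ev y -> ev w.2 = ev y -> H y u = G w u.
Proof.
exists (fun y u => \sum_w diag_coef w y * G w u); first exact: mxc_mul.
by move=> y u w E1 E2; apply: (@sum_diag (fun w => G w u)).
Qed.

Lemma diagT_diag : diagT *m mxc diag_coef = 1%:M.
Proof.
have [H -> HE] := diagT_mul diag_coef; apply/matrixP => i j; rewrite !mxE.
have [w [E1 E2]] := diag_ex (enum_val i); rewrite (HE _ _ w) // /diag_coef E1 E2 andbb.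
by rewrite (inj_eq (@ev_inj _ _)) (inj_eq enum_val_inj).
Qed.

Lemma boxm_col (U : finType) l (G : EB n a * EB n b -> U -> F) : (l < b)%N ->
  (forall (S T : set) u, #|T| = l -> box_sum (ext (fun w => G w u)) S T = 0) ->
  boxm (@ev n) (@Emul F n) (@Ecom F n) a b l *m mxc G = 0.
Proof.
move=> lb h; rewrite mxc_mul; apply/matrixP => i j; rewrite !mxE.
case: (enum_val i) => S T; rewrite (boxm_ext F2 (fun w => G w (enum_val j))) ?(ltnW lb) //.
by rewrite h // card_ev.
Qed.

Lemma boxm_diag l : (l < b)%N ->
  boxm (@ev n) (@Emul F n) (@Ecom F n) a b l *m mxc diag_coef = 0.
Proof.
move=> lb; apply: boxm_col => // S T y Tl; rewrite /box_sum big1 // => Z _.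
rewrite /ext big1 // => w /andP[/eqP E1 /eqP E2].
rewrite /diag_coef E1 E2; case: (boolP (_ && _)) => // /andP[/eqP h1 /eqP h2].
have Z0 : Z = set0.
  apply/setP => x; have /setP/(_ x) := h1; have /setP/(_ x) := h2; rewrite !inE => <-.
  by case: (x \in Z); rewrite ?orbT.
have := card_ev y; rewrite -h2 Z0 setU0 Tl => lq.
by move: lb; rewrite bE -lq ltnn.
Qed.

Lemma act_diag (g : 'M[F]_n) :
  Lcx_act n r 2 1 q F g *m mxc diag_coef =
  mxc (fun w (y : EB n q) => theta (rows g (ev y)) (ev w.1) (ev w.2)).
Proof.
rewrite mxc_mul; apply/matrixP => i j; rewrite !mxE.
move: (enum_val i) (enum_val j) => w y.
have [w' [E1 E2]] := diag_ex y.
transitivity (Eact a g (ev w.1) (ev w'.1) * Eact b g (ev w.2) (ev w'.2)).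
  rewrite -(sum_diag (fun w' => Eact a g (ev w.1) (ev w'.1) * Eact b g (ev w.2) (ev w'.2)) E1 E2).
  by apply: eq_bigr => w1 _; rewrite mulrC.
rewrite !Eact_per ?card_ev // E1 E2 //.
Qed.

(** The relations are stable under the group as far as the diagonal functionals can see: after
    acting by [g] such a functional is [theta] of rows of [g], which is invariant, so its box sums
    at [#|T| < b] vanish by bidegree. *)
Lemma boxm_act_diag l (g : 'M[F]_n) : (l < b)%N ->
  boxm (@ev n) (@Emul F n) (@Ecom F n) a b l *m (Lcx_act n r 2 1 q F g *m mxc diag_coef) = 0.
Proof.
move=> lb; rewrite act_diag; apply: boxm_col => // S T y Tl.
have st : esupp a b (theta (rows g (ev y))).
  move=> A B; rewrite /theta mulf_eq0 negb_or => /andP[/per_supp -> /per_supp ->].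
  by rewrite size_rows card_ev aE bE eqxx.
transitivity (box_sum (theta (rows g (ev y))) S T).
  by apply: eq_bigr => Z _; rewrite (ext_fun st).
rewrite box_sum_theta //; apply/eqP; apply: contraT => /st/andP[_ /eqP E].
by rewrite -E Tl ltnn in lb.
Qed.

(** A diagonal entry is the square of a minor of [g], and squaring, a ring morphism in
    characteristic 2, moves inside the determinant. *)
Lemma diagT_act_diag (g : 'M[F]_n) :
  diagT *m (Lcx_act n r 2 1 q F g *m mxc diag_coef) = Etw_act n 2 q F g.
Proof.
rewrite act_diag; set G := (X in mxc X); have [H -> HE] := diagT_mul G.
apply/matrixP => i j; rewrite !mxE; move: (enum_val i) (enum_val j) => y y'.
have [w [E1 E2]] := diag_ex y; rewrite (HE _ _ w) // /G /theta E1 E2.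
rewrite -(@Eact_per q) ?card_ev // -expr2 /Eact.
have -> (x : F) : x ^+ 2 = pFrobenius_aut F2 x by [].
rewrite -det_map_mx; congr (\det _); apply/matrixP => i1 j1; rewrite !mxE.
rewrite /gfun; case: insubP => [i' _ _|_]; last by rewrite rmorph0.
by case: insubP => [j' _ _|_]; rewrite ?rmorph0 // mxE.
Qed.

End Coefficients.

Variable K : fieldType.
Hypothesis K2 : 2%N \in [pchar K].
Notation Usp := (Usp (@ev n) (@Emul K n) (@Ecom K n) r 2 1).
Notation dlt := (dlt (@ev n) (@Emul K n) (@Ecom K n) r 2 1).

Let q0 : (0 < q)%N.
Proof. by move: r0; rewrite rE; lia. Qed.

(** The diagonal elements are cycles: the letter split off the second factor [e_A] already occurs in
    the first. *)
Lemma diagT_dlt : diagT K *m dlt q = 0.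
Proof.
rewrite /dlt /=; case: ifP => [_|_]; last by rewrite mulmx0.
rewrite /dmap; set G := (X in mxc X); have [H -> HE] := diagT_mul G.
apply/matrixP => i j; rewrite !mxE.
have [w [E1 E2]] := diag_ex (enum_val i); rewrite (HE _ _ w) // /G E1 E2 big1 // => z _.
rewrite /Ecom !Emul_char2 //; case: (boolP (_ && _)) => [|_]; last by rewrite mul0r.
case/andP=> _ /eqP Ez; rewrite {1}Ez.
case: (boolP (_ && _)) => [|_]; last by rewrite mulr0.
case/andP; rewrite -setI_eq0 setIUl => /eqP/setP h _.
have z1 : #|ev z| = 1%N by rewrite card_ev tk_char2.
have /eqP/cards1P[x xE] := z1.
by have := h x; rewrite !inE xE inE eqxx.
Qed.

(** Away from the diagonal a functional killing the relations is a coboundary. No cocycle condition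
    is given at the end of the complex, but [polar_middle] supplies it. *)
Lemma functional_diag (c : 'cV[K]_#|{: Wk (EB n) r 2 1 q}|) : Usp q *m c = 0 ->
  exists2 e, Usp q.-1 *m e = 0 & c = dlt q *m e + mxc (diag_coef K) *m (diagT K *m c).
Proof.
move=> Uc; pose phi t := c (enum_rank t) 0.
have cE : c = colf phi by rewrite colf_rank.
have sp : esupp a b (ext phi) by apply: ext_supp.
have vp : box_inv b (ext phi).
  by apply: boxm_box_inv => // l lb; rewrite -cE; move: l lb; apply/Rel_mul0.
have {}vp : box_inv q (ext phi) by move=> S T Tq; apply: vp; rewrite bE.
have sp' : esupp q q (ext phi) by move=> A B /sp; rewrite aE bE.
pose psi A B := if A == B then 0 else ext phi A B.
have sps : esupp q q psi by move=> A B; rewrite /psi; case: ifP; rewrite ?eqxx // => _ /sp'.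
(* Erasing the diagonal does not disturb invariance: a diagonal term of the box sum forces [Z] to be
   empty, hence [#|T| = q], which is not tested. *)
have vps : box_inv q psi.
  move=> S T Tq; rewrite -[RHS](vp S T Tq); apply: eq_bigr => Z _; rewrite /psi.
  case: (S :\: Z =P T :|: Z) => // E; apply/esym/eqP; apply: contraT => /sp'/andP[_ /eqP].
  have -> : Z = set0.
    apply/setP => x; have /setP/(_ x) := E; rewrite !inE.
    by case: (x \in Z); rewrite ?orbT.
  by rewrite setU0 => Tq'; rewrite Tq' ltnn in Tq.
have [e Ue eE] : exists2 e : 'cV[K]_#|{: Wk (EB n) r 2 1 q.-1}|, Usp q.-1 *m e = 0 &
    colf (fun w : Wk (EB n) r 2 1 q => psi (ev w.1) (ev w.2)) = dlt q *m e.
  apply: homot_functional => //.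
  - by rewrite -rE.
  - by rewrite aE.
  - move=> A B. by apply: polar_middle sps vps.
  - by move=> A; rewrite /psi eqxx.
exists e => //; rewrite -eE cE !mxc_colf; apply/colP => i; rewrite !mxE.
case: (enum_val i) => u w; rewrite /psi /= ext_ev.
have [E|ne] := eqVneq (ev u) (ev w); last first.
  rewrite big1 ?addr0 // => y _; rewrite /diag_coef /=.
  case: (boolP (_ && _)) => [/andP[/eqP h1 /eqP h2]|_]; last by rewrite mul0r.
  by rewrite h1 h2 eqxx in ne.
have uq : #|ev u| = q by rewrite card_ev aE.
have [y yE] := ev_ex uq.
rewrite add0r (bigD1 y) //= {1}/diag_coef /= -E yE eqxx mul1r [X in _ = _ + X]big1 ?addr0.
  by rewrite (@sum_diag K phi y (u, w)) //= yE.
move=> y' ne; rewrite {1}/diag_coef /= -E.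
case: (boolP (_ && _)) => [/andP[/eqP h1 _]|_]; last by rewrite mul0r.
by case/eqP: ne; apply: ev_inj; rewrite -h1.
Qed.

Lemma Lcx_top : sq_iso (Lcx_Z K n r 2 1 q) (Lcx_den K n r 2 1 q)
                       (Lcx_act n r 2 1 q) (Etw_act n 2 q).
Proof.
set Z := Lcx_Z K n r 2 1 q.
have nzq : nz r 2 1 q by rewrite nzP // bE -rE.
have dZ : (diagT K <= Z)%MS.
  by rewrite /Z /Lcx_Z /Zsp nzq; apply/sub_kermxP; rewrite mulmxA diagT_dlt mul0mx.
have key m (w : 'M[K]_(m, _)) : (w <= Z)%MS -> w *m mxc (diag_coef K) = 0 -> (w <= Usp q)%MS.
  move=> wZ w0; apply: submx_cols => c /functional_diag[e Ue ->].
  rewrite mulmxDr [w *m (mxc _ *m _)]mulmxA w0 mul0mx addr0.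
  by apply: submx_mul0 wZ _; apply: Zsp_mul_dlt.
have Ud : Usp q *m mxc (diag_coef K) = 0 by apply/Rel_mul0 => l lb; apply: boxm_diag.
exists (mxc (diag_coef K)); split.
- by rewrite -sub1mx -(diagT_diag K); apply: submxMr.
- move=> w wZ; apply/eqP/idP => [w0|wS].
    by apply: submx_trans (addsmxSr _ _); apply: key.
  apply: submx_mul0 Ud; apply: submx_trans wS _.
  rewrite addsmx_sub submx_refl andbT genmxE /dlt.
  have nnz : nz r 2 1 q.+1 = false by rewrite nzP // deg2_char2; have := rE; lia.
  by rewrite nnz /= sub0mx.
move=> F f g _ w wZ.
have F2 : 2%N \in [pchar F] by rewrite (fmorph_pchar f).
have fP : map_mx f (mxc (diag_coef K)) = mxc (diag_coef F).
  by apply/matrixP => i j; rewrite !mxE rmorph_nat.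
have fT : map_mx f (diagT K) = diagT F.
  by apply/matrixP => i j; rewrite !mxE rmorph_nat.
(* Split the cycle into its diagonal part and a remainder killed by the diagonal functionals. The
   remainder lies in the relations, and [boxm_act_diag] shows that it stays invisible after acting
   by [g]. *)
pose w' := w - w *m mxc (diag_coef K) *m diagT K.
have w'U : (w' <= Usp q)%MS.
  apply: key.
    rewrite addmx_sub // eqmx_opp; apply: submx_trans dZ; exact: submxMl.
  by rewrite mulmxBl -!mulmxA diagT_diag mulmx1 subrr.
have w'0 : map_mx f w' *m (Lcx_act n r 2 1 q F g *m mxc (diag_coef F)) = 0.
  have /sub_sumsmxP[u ->] := w'U.
  rewrite raddf_sum /= mulmx_suml big1 // => l _.
  have /submxP[D ->] : (<<boxm (@ev n) (@Emul K n) (@Ecom K n) a b l>> <=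
     boxm (@ev n) (@Emul K n) (@Ecom K n) a b l)%MS by rewrite genmxE.
  have -> : map_mx f (u l *m (D *m boxm (@ev n) (@Emul K n) (@Ecom K n) a b l)) =
     map_mx f (u l *m D) *m boxm (@ev n) (@Emul F n) (@Ecom F n) a b l.
    rewrite mulmxA map_mxM; congr (_ *m _); apply/matrixP => i j; rewrite !mxE rmorph_sum.
    by apply: eq_bigr => z _; rewrite /Ecom !Emul_char2 // rmorphM !rmorph_nat.
  by rewrite -mulmxA boxm_act_diag ?mulmx0.
have {1}-> : w = w' + w *m mxc (diag_coef K) *m diagT K by rewrite subrK.
rewrite map_mxD [map_mx f (_ *m diagT K)]map_mxM fP fT -mulmxA mulmxDl w'0 add0r.
by rewrite -mulmxA diagT_act_diag.
Qed.

End SchurTop.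

Theorem theorem1p4 (K : fieldType) (n p r d : nat) :
  (p \in [pchar K])%R -> (0 < d < p)%N -> (0 < r)%N -> r.+1 = d %[mod p] ->
  (p = 2 \/ n = 2) ->
  [/\ (forall k, (0 < k)%N -> Kcx_vanishes K n r p d k),
      (forall k, k <> (r %/ p)%N -> Lcx_vanishes K n r p d k),
      (p = 2 -> sq_iso (Kcx_Z K n r p d 0) (Kcx_den K n r p d 0)
                       (Kcx_act n r p d 0) (Dtw_act n p (r %/ 2)))
    & (p = 2 -> sq_iso (Lcx_Z K n r p d (r %/ 2)) (Lcx_den K n r p d (r %/ 2))
                       (Lcx_act n r p d (r %/ 2)) (Etw_act n p (r %/ 2)))].
Proof.
move=> pK dp r0 rd pn.
have char2 : p = 2 -> d = 1 /\ ~~ odd r.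
  move=> p2; have d1 : d = 1 by lia.
  by split=> //; move: rd; rewrite p2 d1 !modn2 /=; case: (odd r).
split.
- by move=> k; apply: Kcx_exact.
- move=> k kq; case: (eqVneq p 2) => [p2|np2].
    have [d1 r2] := char2 p2; subst p d; exact: Lcx_exact_char2.
  case: pn np2 => [->|n2] // np2; subst n; have pp := pcharf_prime pK.
  by apply: Lcx_exact_two => //; have := prime_gt1 pp; lia.
- by move=> p2; have [d1 r2] := char2 p2; subst p d; apply: Kcx_H0.
- by move=> p2; have [d1 r2] := char2 p2; subst p d; apply: Lcx_top.
Qed.
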